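(* If $\Psi\subset L^2(\mathbb{R})^n$ is a semi-orthogonal wavelet and $\Phi$ is a set of scaling functions for it, then for all $i\in\{1,\dots,n\}$ and a.e. $\xi\in\mathbb{R}$, $$\sum_{\varphi\in\Phi}|\hat\varphi_i|^2(\xi-\theta_i)=\sum_{\psi\in\Psi}\sum_{m\ge1}|\hat\psi_{\sigma^m(i)}|^2(N^m(\xi-\theta_i)).$$
   Context: Setting: fix integers $N\ge 2$, $n\ge 1$, a permutation $\sigma$ of $\{1,\dots,n\}$ and points $z_k=e^{-i\theta_k}$ with $\theta_k\in[-\pi,\pi)$ and $z_k^N=z_{\sigma(k)}$ for all $k\in\{1,\dots,n\}$. On $L^2(\mathbb{R})$ let $T_0f(x)=f(x-1)$ and $U_0f(x)=\frac1{\sqrt N}f(x/N)$. On $L^2(\mathbb{R})^n$ let $T(f_1,\dots,f_n)=(z_1T_0f_1,\dots,z_nT_0f_n)$ and $U(f_1,\dots,f_n)=(U_0f_{\sigma(1)},\dots,U_0f_{\sigma(n)})$. Fourier transform: $\hat f(\xi)=\frac1{\sqrt{2\pi}}\int_{\mathbb{R}}f(x)e^{-i\xi x}\,dx$, extended to $L^2(\mathbb{R})$; $\hat\varphi_i$ is the Fourier transform of the $i$-th component of $\varphi\in L^2(\mathbb{R})^n$. A family $(e_i)_{i\in I}$ in a Hilbert space $H$ is a normalized tight frame (NTF) for $H$ if $\sum_i|\langle f\,|\,e_i\rangle|^2=\|f\|^2$ for all $f\in H$. A closed subspace $V$ of $L^2(\mathbb{R})^n$ is shift invariant if $T^kV\subset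 V$ for all $k\in\mathbb{Z}$. A set $\Phi\subset V$ is an NTF generator for $V$ if the family $\{T^k\varphi: k\in\mathbb{Z},\varphi\in\Phi\}$ is an NTF for $V$. A finite set $\Psi=\{\psi^1,\dots,\psi^L\}\subset L^2(\mathbb{R})^n$ is a semi-orthogonal wavelet if the affine system $\{U^jT^k\psi: j,k\in\mathbb{Z},\psi\in\Psi\}$ is an NTF for $L^2(\mathbb{R})^n$ and $W_i\perp W_j$ for $i\ne j$, where $W_j=\overline{\operatorname{span}}\{U^{-j}T^k\psi: k\in\mathbb{Z},\psi\in\Psi\}$. The generalized multiresolution analysis (GMRA) associated to $\Psi$ is $V_j=\overline{\operatorname{span}}\{U^mT^k\psi: m>-j,k\in\mathbb{Z},\psi\in\Psi\}$, $j\in\mathbb{Z}$ (so $W_j=V_{j+1}\ominus V_j$). A set of scaling functions for $\Psi$ is an NTF generator $\Phi$ for $V_0$. *)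

(* Defs.v *)
From HB Require Import structures.
From mathcomp Require Import all_boot all_order all_algebra perm.
From mathcomp Require Import all_classical all_reals all_analysis.
From mathcomp Require Import measurable_realfun complex.
From mathcomp Require Import ring.

Set Implicit Arguments.
Unset Strict Implicit.
Unset Printing Implicit Defensive.

Import Order.TTheory GRing.Theory Num.Theory.
Import numFieldNormedType.Exports.
Export Normc.

Local Open Scope classical_set_scope.
Local Open Scope complex_scope.
Local Open Scope ring_scope.

Section L2.
Context {R : realType}.
Local Notation mu := (@lebesgue_measure R).
Local Notation Re := (@complex.Re R).
Local Notation Im := (@complex.Im R).

(* measurable with integrable |f|^2 = (Re f)^2 + (Im f)^2; the codomain is
   R[i]^o so that scalars range over R[i] rather than R *)
Definition sqint : {pred R -> R[i]^o} :=
  [pred f | (Re \o f \in Lfun mu 2%:E) && (Im \o f \in Lfun mu 2%:E)].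

Lemma sqint_submod_closed : submod_closed sqint.
Proof.
have l12 : (1 <= 2%:E :> \bar R)%E by rewrite lee_fin ler1n.
have cl := Lfun_submod_closed mu l12.
have ZP (c : R) (f : R -> R) : f \in Lfun mu 2%:E -> c *: f \in Lfun mu 2%:E.
  move=> hf; rewrite -[c *: f]addr0; apply: cl.2 => //; exact: cl.1.
have DP (f g : R -> R) : f \in Lfun mu 2%:E -> g \in Lfun mu 2%:E ->
    f + g \in Lfun mu 2%:E.
  by move=> hf hg; rewrite -[f]scale1r; apply: cl.2.
split=> [|/= [a b] f g /andP[fr fi] /andP[gr gi]].
  by apply/andP; split; exact: cl.1.
apply/andP; split.
- suff -> : Re \o (((a +i* b) : R[i]) *: f + g) =
    (a *: (Re \o f : R -> R) + (- b) *: (Im \o f : R -> R)) + (Re \o g : R -> R).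
    by apply: (DP) => //; apply: (DP); apply: (ZP).
  apply/funext => x /=; rewrite !fctE /=; case: (f x) => u v; case: (g x) => u' v'. by rewrite scaleNr.
- suff -> : Im \o (((a +i* b) : R[i]) *: f + g) =
    (a *: (Im \o f : R -> R) + b *: (Re \o f : R -> R)) + (Im \o g : R -> R).
    by apply: (DP) => //; apply: (DP); apply: (ZP).
  by apply/funext => x /=; rewrite !fctE /=; case: (f x) => u v; case: (g x) => u' v'.
Qed.

HB.instance Definition _ :=
  GRing.isSubmodClosed.Build _ _ sqint sqint_submod_closed.

Definition L2fun : Type := {f : R -> R[i]^o | f \in sqint}.
HB.instance Definition _ := SubChoice.on L2fun.
HB.instance Definition _ := [SubChoice_isSubLmodule of L2fun by <:].

Definition aeeqc (f g : L2fun) := `[< val f = val g %[ae mu] >].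

Let aeeqc_refl : reflexive aeeqc.
Proof. by move=> f; apply/asboolP; exact: ae_eq_refl. Qed.

Let aeeqc_sym : symmetric aeeqc.
Proof. by move=> f g; apply/idP/idP => /asboolP h; apply/asboolP/ae_eq_sym. Qed.

Let aeeqc_trans : transitive aeeqc.
Proof.
by move=> g f h /asboolP fg /asboolP gh; apply/asboolP/(ae_eq_trans fg gh).
Qed.

Canonical aeeqc_equiv := EquivRel aeeqc aeeqc_refl aeeqc_sym aeeqc_trans.

Local Open Scope quotient_scope.

Definition L2 : Type := {eq_quot aeeqc}.
HB.instance Definition _ := Choice.on L2.
HB.instance Definition _ := EqQuotient.on L2.

Lemma eq_L2P (f g : L2fun) :
  \pi_L2 f = \pi_L2 g <-> val f = val g %[ae mu].
Proof. by split=> [/eqP|h]; [rewrite eqmodE => /asboolP|apply/eqP; rewrite eqmodE; apply/asboolP]. Qed.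

Lemma repr_L2 (f : L2fun) : val (repr (\pi_L2 f)) = val f %[ae mu].
Proof. by apply/eq_L2P; rewrite reprK. Qed.

Definition addL2 (f g : L2) : L2 := \pi_L2 (repr f + repr g).
Definition oppL2 (f : L2) : L2 := \pi_L2 (- repr f).
Definition scaleL2 (c : R[i]) (f : L2) : L2 := \pi_L2 (c *: repr f).

Lemma pi_addL2 f g : addL2 (\pi_L2 f) (\pi_L2 g) = \pi_L2 (f + g).
Proof.
apply/eq_L2P; rewrite !raddfD/=.
have := repr_L2 f; have := repr_L2 g.
by apply: (filterS2 (F := almost_everywhere mu)) => x /= hg hf _; rewrite !fctE hf// hg.
Qed.

Lemma pi_oppL2 f : oppL2 (\pi_L2 f) = \pi_L2 (- f).
Proof.
apply/eq_L2P; rewrite !raddfN/=.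
have := repr_L2 f.
by apply: (filterS (F := almost_everywhere mu)) => x /= hf _; rewrite !fctE hf.
Qed.

Lemma pi_scaleL2 c f : scaleL2 c (\pi_L2 f) = \pi_L2 (c *: f).
Proof.
apply/eq_L2P; rewrite !linearZ/=.
have := repr_L2 f.
by apply: (filterS (F := almost_everywhere mu)) => x /= hf _; rewrite !fctE hf.
Qed.

Let L2P (P : L2 -> Prop) : (forall f : L2fun, P (\pi_L2 f)) -> forall f, P f.
Proof. by move=> h f; rewrite -[f]reprK. Qed.

Let addL2A : associative addL2.
Proof.
by elim/L2P => f; elim/L2P => g; elim/L2P => h; rewrite !pi_addL2 addrA.
Qed.

Let addL2C : commutative addL2.
Proof. by elim/L2P => f; elim/L2P => g; rewrite !pi_addL2 addrC. Qed.

Let add0L2 : left_id (\pi_L2 0) addL2.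
Proof. by elim/L2P => f; rewrite pi_addL2 add0r. Qed.

Let addNL2 : left_inverse (\pi_L2 0) oppL2 addL2.
Proof. by elim/L2P => f; rewrite pi_oppL2 pi_addL2 addNr. Qed.

HB.instance Definition _ := GRing.isZmodule.Build L2 addL2A addL2C add0L2 addNL2.

Let scaleL2A a b f : scaleL2 a (scaleL2 b f) = scaleL2 (a * b) f.
Proof. by elim/L2P: f => f; rewrite !pi_scaleL2 scalerA. Qed.

Let scale1L2 : left_id 1 scaleL2.
Proof. by elim/L2P => f; rewrite pi_scaleL2 scale1r. Qed.

Let scaleL2Dr : right_distributive scaleL2 +%R.
Proof.
move=> a; elim/L2P => f; elim/L2P => g.
by rewrite [_ + _]pi_addL2 !pi_scaleL2 [RHS]pi_addL2 scalerDr.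
Qed.

Let scaleL2Dl f : {morph scaleL2^~ f : a b / a + b >-> a + b}.
Proof.
by move=> a b; elim/L2P: f => f; rewrite !pi_scaleL2 [RHS]pi_addL2 scalerDl.
Qed.

HB.instance Definition _ := GRing.Zmodule_isLmodule.Build R[i] L2
  scaleL2A scale1L2 scaleL2Dr scaleL2Dl.

(* a.e.-defined values: those of the chosen representative *)
Definition fun_of_L2 (f : L2) : R -> R[i] := val (repr f).
Coercion fun_of_L2 : L2 >-> Funclass.

End L2.
Arguments L2 : clear implicits.

Section affine_change_of_variables.
Context {R : realType}.
Local Notation mu := (@lebesgue_measure R).

Lemma measurable_affine (a b : R) :
  measurable_fun [set: measurableTypeR R] (fun x => a * x + b : measurableTypeR R).
Proof.
by apply: measurable_funD => //; apply: measurable_funM.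
Qed.

Lemma lebesgue_measure_affine (a b : R) (X : set R) : 0 < a -> measurable X ->
  mu ((fun x => a * x + b) @^-1` X) = (a^-1%:E * mu X)%E.
Proof.
move=> a0 mX; have a0' : 0 <= a by exact: ltW.
have ma := measurable_affine a b.
pose nu0 : {measure set (measurableTypeR R) -> \bar R} :=
  mscale (NngNum a0') (pushforward mu (fun x : measurableTypeR R =>
    a * x + b : measurableTypeR R)).
pose nu := nu0 ma.
have nuE Y : nu Y = (a%:E * mu ((fun x => a * x + b)%R @^-1` Y))%E by [].
have -> : mu X = nu X.
  apply: lebesgue_measure_unique => // Y /ocitvP[->|[[c d] /= cd ->]].
    by rewrite !measure0.
  rewrite nuE.
  have -> : (fun x => a * x + b) @^-1` `]c, d]%classic =
      `](c - b) / a, (d - b) / a]%classic.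
    apply/seteqP; split => x /=; rewrite !in_itv/= => /andP[].
      move=> h1 h2; rewrite ltr_pdivrMr// ler_pdivlMr//.
      by rewrite ltrBlDr lerBrDr mulrC h1 h2.
    rewrite ltr_pdivrMr// ler_pdivlMr// ltrBlDr lerBrDr => h1 h2.
    by rewrite mulrC h1 h2.
  rewrite !lebesgue_measure_itv/= !lte_fin cd ltr_pM2r ?invr_gt0// ltrD2r cd.
  rewrite -!EFinB -EFinM; congr (_%:E).
  by field; rewrite gt_eqF.
by rewrite nuE muleA -EFinM mulVf ?gt_eqF// mul1e.
Qed.

Lemma ae_affine (a b : R) (P : R -> Prop) : 0 < a ->
  {ae mu, forall x, P x} -> {ae mu, forall x, P (a * x + b)}.
Proof.
move=> a0 [N [mN N0 PN]]; exists ((fun x => a * x + b) @^-1` N); split.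
- by rewrite -[X in measurable X]setTI; exact: measurable_affine.
- by rewrite lebesgue_measure_affine// N0 mule0.
- by move=> x; exact: PN.
Qed.

Lemma Lfun2_affine (a b : R) (f : R -> R) : 0 < a ->
  f \in Lfun mu 2%:E -> (fun x => f (a * x + b)) \in Lfun mu 2%:E.
Proof.
move=> a0 /andP[/[!inE] mf ff]; apply/andP; rewrite !inE; split.
  exact: (measurableT_comp mf (measurable_affine a b)).
move: ff; rewrite /= /finite_norm unlock => /(@poweR_lty _ _ 2).
rewrite -poweRrM mulVf// poweRe1; last first.
  by apply: integral_ge0 => x _; exact: poweR_ge0.
move=> ff.
apply: poweR_lty.
pose g (y : R) := (`|(f y)%:E| `^ 2)%E.
have mg : measurable_fun setT g.
  apply/measurable_EFinP.
  apply: (@measurableT_comp _ _ _ _ _ _ (@powR R ^~ 2)) => //.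
  exact: measurableT_comp.
have mX := measurable_affine a b.
rewrite -[ltLHS]/(\int[mu]_x (g \o (fun x => a * x + b)%R) x)%E.
have e := @ge0_integral_pushforward _ _ _ _ _ _ mX mu setT g measurableT mg
  (fun x _ => poweR_ge0 _ _).
rewrite preimage_setT in e; rewrite -e.
have ai0 : 0 <= a^-1 by rewrite invr_ge0 ltW.
rewrite (@eq_measure_integral _ _ _ _ (mscale (NngNum ai0) mu)).
  rewrite ge0_integral_mscale//; last by move=> x _; exact: poweR_ge0.
  by rewrite lte_mul_pinfty.
move=> Y mY _; exact: lebesgue_measure_affine.
Qed.

End affine_change_of_variables.

Section operators.
Context {R : realType}.
Local Notation mu := (@lebesgue_measure R).

(* class of f if f is square-integrable, 0 otherwise *)
Definition toL2 (f : R -> R[i]) : L2 R := (\pi_(L2 R) (insubd (0 : L2fun) f))%qT.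

Lemma toL2E (f : R -> R[i]) : f \in sqint -> toL2 f = f %[ae mu].
Proof.
move=> hf; have := repr_L2 (insubd (0 : L2fun) f).
by rewrite val_insubd hf.
Qed.

Lemma L2_sqint (f : L2 R) : (f : R -> R[i]) \in sqint.
Proof. exact: valP. Qed.

Lemma toL2_ext (f g : R -> R[i]) : f \in sqint -> g \in sqint ->
  f = g %[ae mu] -> toL2 f = toL2 g.
Proof.
move=> hf hg fg; apply/eq_L2P; rewrite !val_insubd hf hg; exact: fg.
Qed.

Lemma toL2K (f : L2 R) : toL2 f = f.
Proof.
rewrite -[RHS]reprK; apply/eq_L2P; rewrite val_insubd L2_sqint.
exact: ae_eq_refl.
Qed.

Lemma sqint_affine (a b : R) (f : R -> R[i]) : 0 < a ->
  f \in sqint -> (fun x => f (a * x + b)) \in sqint.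
Proof.
move=> a0 /andP[fr fi].
by apply/andP; split; [exact: Lfun2_affine fr|exact: Lfun2_affine fi].
Qed.

Lemma sqint_scale (c : R[i]) (f : R -> R[i]) :
  f \in sqint -> (fun x => c * f x) \in sqint.
Proof.
by move=> hf; rewrite -[X in X \in _]/(c *: (f : R -> R[i]^o)) rpredZ.
Qed.

(* The functions given to toL2 below are square-integrable (lemmas sqint_T0 to
   sqint_U0inv), so the default value of toL2 plays no role. *)
Definition T0 (f : L2 R) : L2 R := toL2 (fun x => f (x - 1)).
Definition T0inv (f : L2 R) : L2 R := toL2 (fun x => f (x + 1)).
Definition U0 (N : nat) (f : L2 R) : L2 R :=
  toL2 (fun x => ((Num.sqrt N%:R)^-1)%:C * f (x / N%:R)).
Definition U0inv (N : nat) (f : L2 R) : L2 R :=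
  toL2 (fun x => (Num.sqrt N%:R)%:C * f (x * N%:R)).

Lemma sqint_T0 (f : L2 R) : (fun x => f (x - 1)) \in sqint.
Proof.
have := @sqint_affine 1 (-1) f ltr01 (L2_sqint f).
by under eq_fun do rewrite mul1r.
Qed.

Lemma sqint_T0inv (f : L2 R) : (fun x => f (x + 1)) \in sqint.
Proof.
have := @sqint_affine 1 1 f ltr01 (L2_sqint f).
by under eq_fun do rewrite mul1r.
Qed.

Lemma sqint_U0 N (f : L2 R) : (0 < N)%N ->
  (fun x => ((Num.sqrt N%:R)^-1)%:C * f (x / N%:R)) \in sqint.
Proof.
move=> N0; apply: sqint_scale.
have N0' : 0 < (N%:R : R)^-1 by rewrite invr_gt0 ltr0n.
have := @sqint_affine _ 0 f N0' (L2_sqint f).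
by under eq_fun do rewrite addr0 mulrC.
Qed.

Lemma sqint_U0inv N (f : L2 R) : (0 < N)%N ->
  (fun x => (Num.sqrt N%:R)%:C * f (x * N%:R)) \in sqint.
Proof.
move=> N0; apply: sqint_scale.
have N0' : 0 < (N%:R : R) by rewrite ltr0n.
have := @sqint_affine _ 0 f N0' (L2_sqint f).
by under eq_fun do rewrite addr0 mulrC.
Qed.

Let L2eq (f g : R -> R[i]) (h : L2 R) : f \in sqint ->
  f = g %[ae mu] -> g = h -> toL2 f = h.
Proof.
move=> hf fg gh; rewrite -[RHS]toL2K -gh.
by apply: toL2_ext => //; rewrite gh; exact: L2_sqint.
Qed.

Lemma T0K : cancel T0 T0inv.
Proof.
move=> f; apply: (L2eq (sqint_T0inv _) (g := f)) => //.
have := ae_affine 1 (@ltr01 R) (toL2E (sqint_T0 f)).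
apply: (filterS (F := almost_everywhere mu)) => x /= h _.
by rewrite mul1r in h; rewrite h// addrK.
Qed.

Lemma T0invK : cancel T0inv T0.
Proof.
move=> f; apply: (L2eq (sqint_T0 _) (g := f)) => //.
have := ae_affine (-1) (@ltr01 R) (toL2E (sqint_T0inv f)).
apply: (filterS (F := almost_everywhere mu)) => x /= h _.
by rewrite mul1r in h; rewrite h// subrK.
Qed.

Lemma U0K N : (0 < N)%N -> cancel (U0 N) (U0inv N).
Proof.
move=> N0 f; apply: (L2eq (sqint_U0inv _ N0) (g := f)) => //.
have N0' : 0 < (N%:R : R) by rewrite ltr0n.
have := ae_affine 0 N0' (toL2E (sqint_U0 f N0)).
apply: (filterS (F := almost_everywhere mu)) => x /= h _.
rewrite addr0 mulrC in h; rewrite h// mulfK ?gt_eqF// mulrA -rmorphM/=.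
by rewrite divff ?mul1r// gt_eqF// sqrtr_gt0.
Qed.

Lemma U0invK N : (0 < N)%N -> cancel (U0inv N) (U0 N).
Proof.
move=> N0 f; apply: (L2eq (sqint_U0 _ N0) (g := f)) => //.
have N0' : 0 < (N%:R : R) by rewrite ltr0n.
have N0'' : 0 < (N%:R : R)^-1 by rewrite invr_gt0.
have := ae_affine 0 N0'' (toL2E (sqint_U0inv f N0)).
apply: (filterS (F := almost_everywhere mu)) => x /= h _.
rewrite addr0 mulrC in h; rewrite h// mulfVK ?gt_eqF// mulrA -rmorphM/=.
by rewrite mulVf ?mul1r// gt_eqF// sqrtr_gt0.
Qed.

Lemma L2_scaleE (c : R[i]) (f : L2 R) :
  (c *: f : L2 R) = (fun x => c * f x : R[i]) %[ae mu].
Proof. exact: (repr_L2 (c *: repr f)). Qed.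

Lemma T0invZ (c : R[i]) (f : L2 R) : T0inv (c *: f) = c *: T0inv f.
Proof.
rewrite -[RHS]toL2K; apply: toL2_ext; [exact: sqint_T0inv|exact: L2_sqint|].
have h1 := ae_affine 1 (@ltr01 R) (L2_scaleE c f).
have h2 := L2_scaleE c (T0inv f).
have h3 := toL2E (sqint_T0inv f).
move: h1 h2 h3.
apply: (filterS3 (F := almost_everywhere mu)) => x /= e1 e2 e3 _.
by rewrite mul1r in e1; rewrite e1// e2// e3.
Qed.

Lemma T0Z (c : R[i]) (f : L2 R) : T0 (c *: f) = c *: T0 f.
Proof. by rewrite -{1}(T0K f) -T0invZ T0invK. Qed.

Definition cintegral (f : R -> R[i]) : R[i] :=
  (\int[mu]_x complex.Re (f x)) +i* (\int[mu]_x complex.Im (f x)).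

Definition L2inner (f g : L2 R) : R[i] := cintegral (fun x => f x * conjc (g x)).

Definition L2norm (f : L2 R) : R := Num.sqrt (complex.Re (L2inner f f)).

Definition expi (t : R) : R[i] := cos t +i* sin t.

Definition fourierL1 (f : R -> R[i]) (xi : R) : R[i] :=
  ((Num.sqrt (2 * pi))^-1)%:C * cintegral (fun x => f x * expi (- (xi * x))).

(* F is the Fourier transform of f in the L^2 sense: the pair (f, F) is an
   L^2-limit of pairs (g, G) with g in the intersection of L^1 and L^2 and G its
   (integral) Fourier transform *)
Definition is_fourier (f F : L2 R) : Prop :=
  exists g G : nat -> L2 R,
  [/\ forall k, mu.-integrable setT (fun x => (normc (g k x))%:E),
      forall k, G k = fourierL1 (g k) %[ae mu],
      L2norm (g k - f) @[k --> \oo] --> 0 &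
      L2norm (G k - F) @[k --> \oo] --> 0].

(* By Plancherel's theorem there is exactly one F with is_fourier f F *)
Definition fourier (f : L2 R) : L2 R := xget 0 [set F | is_fourier f F].

End operators.

Section vector_valued.
Context {R : realType} {n : nat}.
Implicit Types (f g : 'I_n -> L2 R) (V S : set ('I_n -> L2 R)).

Definition vinner f g : R[i] := \sum_(i < n) L2inner (f i) (g i).

Definition vnorm f : R := Num.sqrt (complex.Re (vinner f f)).

Definition Tn (z : 'I_n -> R[i]) f : 'I_n -> L2 R := fun i => z i *: T0 (f i).
Definition Tninv (z : 'I_n -> R[i]) f : 'I_n -> L2 R :=
  fun i => (z i)^-1 *: T0inv (f i).
Definition Un (N : nat) (s : {perm 'I_n}) f : 'I_n -> L2 R :=
  fun i => U0 N (f (s i)).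
Definition Uninv (N : nat) (s : {perm 'I_n}) f : 'I_n -> L2 R :=
  fun i => U0inv N (f ((s^-1)%g i)).

Lemma TnK (z : 'I_n -> R[i]) : (forall i, z i != 0) -> cancel (Tn z) (Tninv z).
Proof.
move=> z0 f; apply/funext => i.
by rewrite /Tninv /Tn T0invZ T0K scalerA mulVf// scale1r.
Qed.

Lemma TninvK (z : 'I_n -> R[i]) : (forall i, z i != 0) -> cancel (Tninv z) (Tn z).
Proof.
move=> z0 f; apply/funext => i.
by rewrite /Tninv /Tn T0Z T0invK scalerA divff// scale1r.
Qed.

Lemma UnK N (s : {perm 'I_n}) : (0 < N)%N -> cancel (Un N s) (Uninv N s).
Proof. by move=> N0 f; apply/funext => i; rewrite /Uninv /Un U0K// permKV. Qed.

Lemma UninvK N (s : {perm 'I_n}) : (0 < N)%N -> cancel (Uninv N s) (Un N s).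
Proof. by move=> N0 f; apply/funext => i; rewrite /Uninv /Un U0invK// permK. Qed.

(* k-th power, k in Z, of an invertible F with inverse Finv *)
Definition iterz (F Finv : ('I_n -> L2 R) -> ('I_n -> L2 R)) (k : int) f :=
  match k with Posz m => iter m F f | Negz m => iter m.+1 Finv f end.

Definition Tpow z k f := iterz (Tn z) (Tninv z) k f.
Definition Upow N s j f := iterz (Un N s) (Uninv N s) j f.

(* closure, for vnorm, of the set of finite linear combinations of S *)
Definition cspan S : set ('I_n -> L2 R) := [set f |
  forall e : R, 0 < e -> exists m (c : 'I_m -> R[i]) (v : 'I_m -> 'I_n -> L2 R),
    (forall k, S (v k)) /\ vnorm (f - \sum_(k < m) c k *: v k) < e].

Definition orth V W := forall f g, V f -> W g -> vinner f g = 0.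

(* family indexed by the subset D of I *)
Definition is_NTF (I : choiceType) (D : set I) (e : I -> 'I_n -> L2 R) V : Prop :=
  (forall i, D i -> V (e i)) /\
  forall f, V f ->
    \esum_(i in D) (normc (vinner f (e i)) ^+ 2)%:E = (vnorm f ^+ 2)%:E.

Definition NTF_generator z S V : Prop :=
  S `<=` V /\
  is_NTF [set p : int * ('I_n -> L2 R) | S p.2] (fun p => Tpow z p.1 p.2) V.

Definition wavelet_W N s z S (j : int) : set ('I_n -> L2 R) :=
  cspan [set f | exists k psi, S psi /\ f = Upow N s (- j) (Tpow z k psi)].

Definition wavelet_V N s z S (j : int) : set ('I_n -> L2 R) :=
  cspan [set f | exists m k psi,
    [/\ - j < m, S psi & f = Upow N s m (Tpow z k psi)]].

Definition semi_orthogonal_wavelet N s z S : Prop :=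
  [/\ finite_set S,
      is_NTF [set p : int * int * ('I_n -> L2 R) | S p.2]
        (fun p => Upow N s p.1.1 (Tpow z p.1.2 p.2)) setT &
      forall i j, i <> j -> orth (wavelet_W N s z S i) (wavelet_W N s z S j)].

Definition scaling_functions N s z Psi Phi : Prop :=
  NTF_generator z Phi (wavelet_V N s z Psi 0).

End vector_valued.

(* Main.v *)
(* Since the spaces [W_j] are orthogonal, the elements [U^m T^k psi] with [m >= 1]
   form a normalized tight frame of [V_0], and so do the [T^k phi]. Two normalized
   tight frames of one subspace give the same sum [sum |<t, e>|^2] for every [t] in
   the whole space, namely the squared norm of the projection of [t]. Take for [t]
   the inverse Fourier transform of the indicator of a set [E], placed in the i-th
   component. On the Fourier side a shift is a multiplication by a character, so
   when [E] lies in an interval of length [2 pi / N^M], Parseval (for [m <= M]) and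
   Bessel (for [m > M]) turn the sum over [k] into
     [2 pi * int_E |psi^_(sigma^m i)(N^m x)|^2 dx],
   exactly for [m <= M], and up to a factor at most [N^(m-M)] for [m > M]. As [E] is
   arbitrary, almost everywhere
     [sum_(m <= M) w_m <= sum_phi |phi^_i|^2 <=
      sum_(m <= M) w_m + N^-M * sum_m N^m w_m],
   where [w_m(x) = sum_psi |psi^_(sigma^m i)(N^m x)|^2]. The series [sum_m N^m w_m]
   is finite almost everywhere because its integral over an annulus
   [a <= |x| < N a] is controlled by the norms of the wavelets, and [M -> oo]
   gives the identity, up to the translation by [theta_i]. Countability of [Phi],
   needed to integrate the left-hand side termwise, holds because every nonzero
   [phi] has a nonzero inner product with one of the countably many [U^m T^k psi]
   with [m >= 1], and each of those with only countably many [phi]. *)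
Require Import Defs.
From HB Require Import structures.
From mathcomp Require Import all_boot all_order all_algebra perm finmap.
From mathcomp Require Import all_classical all_reals all_analysis.
From mathcomp Require Import measurable_realfun complex ring lra.

Import Order.TTheory GRing.Theory Num.Theory.
Import numFieldNormedType.Exports.
Import HBNNSimple.

Local Open Scope classical_set_scope.
Local Open Scope ring_scope.
Local Open Scope complex_scope.

Set Implicit Arguments.
Unset Strict Implicit.
Unset Printing Implicit Defensive.

(** A frame coefficient at level [m] is a Fourier coefficient of a function supported in [N^m E].
    Integer frequencies see that set only modulo [2 pi], so Parseval is guaranteed only while
    [N^m E] fits in one period, and no positive bound on the length of [E] ensures this for all [m].
    Hence a sandwich and a limit instead of one exact computation. The aliasing bound [N^(m-M)] is
    what dictates the weights [N^m] in the convergence argument.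

    The transform [fourier] is picked by [xget], so nothing can be said about it before a limit as
    in [is_fourier] is known to exist. This is why Parseval, Plancherel for compact support and
    completeness of [L^2] are established on the way. The transforms of [T f] and [U f] are never
    computed: both operators are moved onto the test function, where they act as modulations and
    dilations. *)

Local Notation Re := (@complex.Re _).
Local Notation Im := (@complex.Im _).
Local Notation "z ^*" := (conjc z) : ring_scope.

(** * Squared moduli of complex numbers *)

Section complex_arith.
Context {R : realType}.
Implicit Types z w : R[i].

(** The squared modulus kept polynomial in the coordinates, so that [ring] and [nra] apply; [normc]
    hides a square root. *)
Definition nsq z : R := Re z ^+ 2 + Im z ^+ 2.

Lemma normc_sq z : normc z ^+ 2 = nsq z.
Proof. by case: z => a b; rewrite /normc sqr_sqrtr// addr_ge0 ?sqr_ge0. Qed.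

Lemma nsq_ge0 z : 0 <= nsq z.
Proof. by rewrite addr_ge0 ?sqr_ge0. Qed.

Lemma nsq0 : nsq 0 = 0.
Proof. by rewrite /nsq/= expr0n addr0. Qed.

Lemma nsqM z w : nsq (z * w) = nsq z * nsq w.
Proof. by case: z w => a b [c d]; rewrite /nsq/=; ring. Qed.

Lemma nsqJ z : nsq z^* = nsq z.
Proof. by case: z => a b; rewrite /nsq/=; ring. Qed.

Lemma nsqN z : nsq (- z) = nsq z.
Proof. by case: z => a b; rewrite /nsq/=; ring. Qed.

Lemma nsqR (a : R) : nsq a%:C = a ^+ 2.
Proof. by rewrite /nsq/=; ring. Qed.

Lemma nsqE z : z * z^* = (nsq z)%:C.
Proof. by case: z => a b; rewrite /nsq; simpc; congr (_ +i* _); ring. Qed.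

Lemma nsq_parallelogram z w : nsq (z + w) + nsq (z - w) = 2 * nsq z + 2 * nsq w.
Proof. by case: z w => a b [c d]; rewrite /nsq/=; ring. Qed.

Lemma nsqD_le z w : nsq (z + w) <= 2 * nsq z + 2 * nsq w.
Proof. by rewrite -nsq_parallelogram lerDl nsq_ge0. Qed.

Lemma ReM_conj_le z w : 2 * Re (z * w^*) <= nsq z + nsq w.
Proof.
case: z w => a b [c d]; rewrite /nsq/= -subr_ge0.
rewrite (_ : _ - _ = (a - c) ^+ 2 + (b - d) ^+ 2); last by ring.
by rewrite addr_ge0 ?sqr_ge0.
Qed.

Lemma ReD z w : Re (z + w) = Re z + Re w. Proof. by case: z w => a b [c d]. Qed.
Lemma ImD z w : Im (z + w) = Im z + Im w. Proof. by case: z w => a b [c d]. Qed.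
Lemma ReN z : Re (- z) = - Re z. Proof. by case: z. Qed.
Lemma ReJ z : Re z^* = Re z. Proof. by case: z. Qed.

Lemma Re_sum I (s : seq I) (P : pred I) (F : I -> R[i]) :
  Re (\sum_(i <- s | P i) F i) = \sum_(i <- s | P i) Re (F i).
Proof. by apply: (big_morph _ ReD). Qed.

End complex_arith.

Lemma ler_addgt0_scaled (R : realType) (a b c : R) :
  0 <= c -> (forall t, 0 < t -> a <= b + t * c) -> a <= b.
Proof.
move=> c0 h; apply/ler_addgt0Pr => e e0.
have c1 : 0 < c + 1 by rewrite ltr_wpDl.
(* Dividing by [c + 1] rather than [c] covers [c = 0]. *)
apply: (le_trans (h (e / (c + 1)) (divr_gt0 e0 c1))).
by rewrite lerD2l -mulrA ler_piMr ?(ltW e0)// mulrC ler_pdivrMr// mul1r lerDl.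
Qed.

(** * Unordered sums of nonnegative reals *)

Section esum_real.
Context {R : realType} {I : choiceType}.
Implicit Types (D : set I) (a : I -> R).
Local Open Scope ereal_scope.

(** With the next two lemmas this trades an [esum] for finite sums over duplicate-free lists, the
    only form in which the frame arguments meet it. *)
Lemma esum_le_seq D a (x : \bar R) :
  (forall s : seq I, uniq s -> (forall i, i \in s -> D i) ->
    (\sum_(i <- s) a i)%:E <= x) ->
  \esum_(i in D) (a i)%:E <= x.
Proof.
move=> h; apply: ge_ereal_sup => _ [A [fA AD] <-].
rewrite fsbig_finite//= sumEFin; apply: h; first exact: fset_uniq.
by move=> i; rewrite in_fset_set// inE => /AD.
Qed.

Lemma seq_le_esum D a (s : seq I) : uniq s -> (forall i, i \in s -> D i) ->
  (\sum_(i <- s) a i)%:E <= \esum_(i in D) (a i)%:E.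
Proof.
move=> us sD; apply: ereal_sup_ubound; exists [set` s].
  by split => //; exact: finite_seq.
by rewrite -fsbig_seq// sumEFin.
Qed.

Lemma esum_gt_seq D a (x : R) : x%:E < \esum_(i in D) (a i)%:E ->
  exists s : seq I, [/\ uniq s, (forall i, i \in s -> D i) &
    (x < \sum_(i <- s) a i)%R].
Proof.
move=> /ereal_sup_gt[_ [A [fA AD] <-]] xA.
exists (fset_set A); split; first exact: fset_uniq.
  by move=> i; rewrite in_fset_set// inE => /AD.
by move: xA; rewrite fsbig_finite//= sumEFin lte_fin.
Qed.

Lemma esumZl_real D a (c : R) : (0 <= c)%R -> (forall i, 0 <= a i)%R ->
  \esum_(i in D) (c * a i)%:E = c%:E * \esum_(i in D) (a i)%:E.
Proof.
move=> c0 a0; have [->|cn0] := eqVneq c 0%R.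
  by rewrite mul0e esum1// => i _; rewrite mul0r.
have cp : (0 < c)%R by rewrite lt_def cn0.
apply/eqP; rewrite eq_le; apply/andP; split.
  apply: esum_le_seq => s us sD.
  rewrite -mulr_sumr EFinM lee_pmul2l// ?lte_fin//.
  exact: seq_le_esum.
rewrite muleC -lee_pdivlMr//.
apply: esum_le_seq => s us sD.
rewrite lee_pdivlMr// -EFinM mulrC mulr_sumr.
exact: seq_le_esum.
Qed.

End esum_real.

(** * Frames, Bessel and Parseval for a positive semi-definite form *)

Section prehilbert.
Context {R : realType} {H : lmodType R[i]} (ip : H -> H -> R[i]).
Hypothesis ipDl : forall x y z, ip (x + y) z = ip x z + ip y z.
Hypothesis ipZl : forall c x y, ip (c *: x) y = c * ip x y.
Hypothesis ipC : forall x y, ip y x = (ip x y)^*.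
Hypothesis ip_ge0 : forall x, 0 <= Re (ip x x).

(** The form [ip] stays abstract because it is instantiated both by [L2inner], on one component, and
    by [vinner], on vectors. *)
Definition nsqv x : R := Re (ip x x).

Lemma nsqv_ge0 x : 0 <= nsqv x. Proof. exact: ip_ge0. Qed.

Lemma ipDr x y z : ip x (y + z) = ip x y + ip x z.
Proof. by rewrite ipC ipDl rmorphD/= -!ipC. Qed.

Lemma ipZr c x y : ip x (c *: y) = c^* * ip x y.
Proof. by rewrite ipC ipZl rmorphM/= -ipC. Qed.

Lemma ip0l y : ip 0 y = 0.
Proof. by rewrite -[X in ip X _](scale0r (0 : H)) ipZl mul0r. Qed.

Lemma ip0r y : ip y 0 = 0.
Proof. by rewrite ipC ip0l conjc0. Qed.

Lemma ipNl x y : ip (- x) y = - ip x y.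
Proof. by rewrite -scaleN1r ipZl mulN1r. Qed.

Lemma ipBl x y z : ip (x - y) z = ip x z - ip y z.
Proof. by rewrite ipDl ipNl. Qed.

Lemma ipNr x y : ip x (- y) = - ip x y.
Proof. by rewrite ipC ipNl rmorphN/= -ipC. Qed.

Lemma ip_suml I (s : seq I) (F : I -> H) y :
  ip (\sum_(i <- s) F i) y = \sum_(i <- s) ip (F i) y.
Proof. by apply: (big_morph (ip^~ y)) => [u v|]; rewrite ?ipDl ?ip0l. Qed.

Lemma ip_sumr I (s : seq I) (F : I -> H) y :
  ip y (\sum_(i <- s) F i) = \sum_(i <- s) ip y (F i).
Proof. by apply: (big_morph (ip y)) => [u v|]; rewrite ?ipDr ?ip0r. Qed.

Lemma nsqv0 : nsqv 0 = 0. Proof. by rewrite /nsqv ip0l. Qed.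

Lemma nsqvN x : nsqv (- x) = nsqv x.
Proof. by rewrite /nsqv ipNl ipNr opprK. Qed.

Lemma nsqvD x y : nsqv (x + y) = nsqv x + nsqv y + 2 * Re (ip x y).
Proof.
rewrite /nsqv ipDl !ipDr !ReD [ip y x]ipC ReJ; ring.
Qed.

Lemma nsqvB x y : nsqv (x - y) = nsqv x + nsqv y - 2 * Re (ip x y).
Proof. by rewrite nsqvD nsqvN ipNr ReN mulrN. Qed.

Lemma nsqv_parallelogram x y :
  nsqv (x + y) + nsqv (x - y) = 2 * nsqv x + 2 * nsqv y.
Proof. rewrite nsqvD nsqvB; ring. Qed.

Lemma nsqvD_le x y : nsqv (x + y) <= 2 * nsqv x + 2 * nsqv y.
Proof. by rewrite -nsqv_parallelogram lerDl nsqv_ge0. Qed.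

Lemma nsqvZ c x : nsqv (c *: x) = nsq c * nsqv x.
Proof.
rewrite /nsqv ipZl ipZr mulrA nsqE; case: (ip x x) => a b /=; ring.
Qed.

(** Expand the squared norm of [t x - y]. The weight [t] makes the bound small when [y] has squared
    norm at most [t ^+ 2], whatever the fixed [x]. *)
Lemma Re_ip_le (t : R) x y : 0 < t -> 2 * Re (ip x y) <= t * nsqv x + nsqv y / t.
Proof.
move=> t0; have := nsqv_ge0 (t%:C *: x - y).
rewrite nsqvB nsqvZ nsqR ipZl.
have -> : Re (t%:C * ip x y) = t * Re (ip x y).
  by case: (ip x y) => a b /=; ring.
move=> h; rewrite -subr_ge0.
have -> : t * nsqv x + nsqv y / t - 2 * Re (ip x y) =
  t^-1 * (t ^+ 2 * nsqv x + nsqv y - 2 * (t * Re (ip x y))).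
  by field; rewrite gt_eqF.
by rewrite mulr_ge0// invr_ge0 ltW.
Qed.

Lemma cauchy_schwarz x y : nsq (ip x y) <= nsqv x * nsqv y.
Proof.
have key t : 0 < t -> nsq (ip x y) <= nsqv x * nsqv y + t * nsqv x.
  (* The usual multiplier [nsqv y] may vanish, so it is enlarged by [t], which then tends to 0. *)
  move=> t0; set d := nsqv y + t.
  have d0 : 0 < d by rewrite ltr_wpDl// nsqv_ge0.
  have := nsqv_ge0 (d%:C *: x - (ip x y) *: y).
  rewrite nsqvB !nsqvZ nsqR ipZl ipZr.
  have -> : Re (d%:C * ((ip x y)^* * ip x y)) = d * nsq (ip x y).
    by case: (ip x y) => a b; rewrite /nsq /=; ring.
  move=> h.
  have yd : nsqv y <= d by rewrite lerDl ltW.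
  have h2 : d * nsq (ip x y) <= d * (d * nsqv x).
    have := ler_wpM2l (nsq_ge0 (ip x y)) yd; rewrite expr2 in h; nra.
  by move: h2; rewrite ler_pM2l// /d mulrDl mulrC.
apply: (ler_addgt0_scaled (nsqv_ge0 x)); exact: key.
Qed.

Definition subspace (V : set H) :=
  [/\ V 0, forall x y, V x -> V y -> V (x + y) & forall c x, V x -> V (c *: x)].

Definition ntf (I : choiceType) (D : set I) (e : I -> H) (V : set H) :=
  (forall i, D i -> V (e i)) /\
  forall f, V f -> \esum_(i in D) (nsq (ip f (e i)))%:E = (nsqv f)%:E.

Lemma subspace_sum (V : set H) (I : eqType) (s : seq I) (F : I -> H) :
  subspace V -> (forall i, i \in s -> V (F i)) -> V (\sum_(i <- s) F i).
Proof.
by move=> [V0 VD _] h; rewrite big_seq_cond; apply: big_ind => // i /andP[/h].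
Qed.

Section one_frame.
Context {I : choiceType} (D : set I) (e : I -> H) (V : set H).
Hypotheses (subV : subspace V) (ntfe : ntf D e V).

Lemma ntf_seq_le (s : seq I) x : uniq s -> (forall i, i \in s -> D i) -> V x ->
  \sum_(i <- s) nsq (ip x (e i)) <= nsqv x.
Proof. by move=> us sD /ntfe.2; rewrite -lee_fin => <-; exact: seq_le_esum. Qed.

Lemma ntf_comb_V (s : seq I) (c : I -> R[i]) : (forall i, i \in s -> D i) ->
  V (\sum_(i <- s) c i *: e i).
Proof.
move=> sD; apply: subspace_sum => // i /sD Di.
by case: subV => _ _; apply; exact: ntfe.1.
Qed.

(** Synthesis is adjoint to analysis, which is isometric on [V], hence it is a contraction.
    Concretely, the squared norm of [x] is the real part of the sum of [c_i] times the conjugate of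
    [ip x (e i)]. Young's inequality bounds its double by the energy of [c] plus the frame energy of
    [x], and the latter is at most [nsqv x]. *)
Lemma ntf_comb_le (s : seq I) (c : I -> R[i]) :
  uniq s -> (forall i, i \in s -> D i) ->
  nsqv (\sum_(i <- s) c i *: e i) <= \sum_(i <- s) nsq (c i).
Proof.
move=> us sD; set x := (X in nsqv X).
have Vx : V x by exact: ntf_comb_V.
have xe : nsqv x = \sum_(i <- s) Re (c i * (ip x (e i))^*).
  rewrite {1}/nsqv {1}/x ip_suml Re_sum; apply: eq_bigr => i _.
  by rewrite ipZl [ip (e i) x]ipC.
have : 2 * nsqv x <= \sum_(i <- s) nsq (c i) + nsqv x.
  apply: (@le_trans _ _ (\sum_(i <- s) nsq (c i) + \sum_(i <- s) nsq (ip x (e i)))).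
    rewrite xe mulr_sumr -big_split/=.
    by apply: ler_sum => i _; exact: ReM_conj_le.
  by rewrite lerD2l; exact: ntf_seq_le.
by rewrite mulrDl mul1r lerD2r.
Qed.

Lemma ip_comb (s : seq I) x :
  ip x (\sum_(i <- s) ip x (e i) *: e i) = (\sum_(i <- s) nsq (ip x (e i)))%:C.
Proof.
rewrite ip_sumr rmorph_sum/=; apply: eq_bigr => i _.
by rewrite ipZr mulrC nsqE.
Qed.

(** The cross term of the expanded square is twice the partial frame energy, and the contraction
    property gives back at most one of the two. *)
Lemma ntf_synthesis (s : seq I) x : uniq s -> (forall i, i \in s -> D i) ->
  nsqv (x - \sum_(i <- s) ip x (e i) *: e i) <=
  nsqv x - \sum_(i <- s) nsq (ip x (e i)).
Proof.
move=> us sD; rewrite nsqvB ip_comb/=.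
have := ntf_comb_le (fun i => ip x (e i)) us sD; lra.
Qed.

End one_frame.

(* Both sums equal the squared norm of the projection of f on V; finite partial
   sums of the two frame expansions replace the projection, so that completeness
   is not needed. *)
Lemma ntf_le (I J : choiceType) (D : set I) (e : I -> H) (D' : set J) (e' : J -> H)
    (V : set H) (f : H) : subspace V -> ntf D e V -> ntf D' e' V ->
  (\esum_(i in D) (nsq (ip f (e i)))%:E <=
   \esum_(j in D') (nsq (ip f (e' j)))%:E)%E.
Proof.
move=> subV ntfe ntfe'; apply: esum_le_seq => s us sD.
set S := \sum_(i <- s) _.
have : (0 <= \esum_(j in D') (nsq (ip f (e' j)))%:E)%E.
  by apply: esum_ge0 => j _; rewrite lee_fin nsq_ge0.
case P': (\esum_(j in D') (nsq (ip f (e' j)))%:E)%E => [p| |] // _; last exact: leey.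
rewrite lee_fin.
set x := \sum_(i <- s) ip f (e i) *: e i.
have Vx : V x by exact: (ntf_comb_V subV ntfe).
have xS : nsqv x <= S by exact: (ntf_comb_le subV ntfe).
have fx : ip f x = S%:C by rewrite ip_comb.
(* In the error, [t * nsqv f] comes from the weighted Young inequality for [ip f (x - y)], and the
   last [t] from [nsqv (x - y) / t]. *)
apply: (@ler_addgt0_scaled _ _ _ (nsqv f + 1)).
  by rewrite addr_ge0// nsqv_ge0.
move=> t t0.
(* Since [x] lies in [V], finitely many elements of the second frame capture its squared norm up to
   [t ^+ 2]; the partial expansion [y] is then close to [x]. *)
have : ((nsqv x - t ^+ 2)%:E < \esum_(j in D') (nsq (ip x (e' j)))%:E)%E.
  by rewrite ntfe'.2// lte_fin ltrBlDr ltrDl exprn_gt0.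
move=> /esum_gt_seq[s' [us' sD' xs']].
set y := \sum_(j <- s') ip x (e' j) *: e' j.
have xy : nsqv (x - y) <= t ^+ 2.
  have := ntf_synthesis subV ntfe' x us' sD'; rewrite -/y; lra.
have fy : 2 * Re (ip f y) <= p + nsqv x.
  rewrite ip_sumr Re_sum mulr_sumr.
  apply: (@le_trans _ _ (\sum_(j <- s') nsq (ip f (e' j)) +
                         \sum_(j <- s') nsq (ip x (e' j)))).
    rewrite -big_split/=; apply: ler_sum => j _.
    by rewrite ipZr [X in Re X]mulrC; exact: ReM_conj_le.
  apply: lerD; last exact: (ntf_seq_le ntfe').
  by rewrite -lee_fin -P'; exact: seq_le_esum.
have fxy := Re_ip_le f (x - y) t0.
have : 2 * S = 2 * Re (ip f y) + 2 * Re (ip f (x - y)).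
  by rewrite -mulrDr -ReD -ipDr addrC subrK fx.
have : nsqv (x - y) / t <= t by rewrite ler_pdivrMr// -expr2.
move=> *; nra.
Qed.

Lemma ntf_eq (I J : choiceType) (D : set I) (e : I -> H) (D' : set J) (e' : J -> H)
    (V : set H) (f : H) : subspace V -> ntf D e V -> ntf D' e' V ->
  \esum_(i in D) (nsq (ip f (e i)))%:E = \esum_(j in D') (nsq (ip f (e' j)))%:E.
Proof.
by move=> *; apply/eqP; rewrite eq_le !(ntf_le (V := V)).
Qed.

(** Here [f] need not lie in [V]: the contraction property of synthesis and positivity of the
    squared distance to a partial expansion suffice. *)
Lemma ntf_bessel (I : choiceType) (D : set I) (e : I -> H) (V : set H) (f : H) :
  subspace V -> ntf D e V ->
  (\esum_(i in D) (nsq (ip f (e i)))%:E <= (nsqv f)%:E)%E.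
Proof.
move=> subV ntfe; apply: esum_le_seq => s us sD; rewrite lee_fin.
have := ntf_comb_le subV ntfe (fun i => ip f (e i)) us sD.
have := nsqv_ge0 (f - \sum_(i <- s) ip f (e i) *: e i).
rewrite nsqvB ip_comb/=; lra.
Qed.

Lemma orthonormal_bessel (I : choiceType) (e : I -> H) (x : H) :
  (forall i j, ip (e i) (e j) = (i == j)%:R) ->
  (\esum_(i in setT) (nsq (ip x (e i)))%:E <= (nsqv x)%:E)%E.
Proof.
move=> oe; apply: esum_le_seq => s us _; rewrite lee_fin.
have := nsqv_ge0 (x - \sum_(i <- s) ip x (e i) *: e i).
rewrite nsqvB ip_comb /= {2}/nsqv.
have -> : ip (\sum_(i <- s) ip x (e i) *: e i) (\sum_(i <- s) ip x (e i) *: e i) =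
    (\sum_(i <- s) nsq (ip x (e i)))%:C.
  rewrite ip_suml rmorph_sum/= big_seq [RHS]big_seq; apply: eq_bigr => i si.
  rewrite ipZl ip_sumr (bigD1_seq i)//= big1 ?addr0.
    by rewrite ipZr oe eqxx mulr1 nsqE.
  by move=> j ji; rewrite ipZr oe eq_sym (negbTE ji) mulr0.
rewrite /=; lra.
Qed.

(** [cspan] restated with squared distances; [cspanE] identifies the two. *)
Definition closed_span (S : set H) : set H := [set f |
  forall t : R, 0 < t -> exists m (c : 'I_m -> R[i]) (v : 'I_m -> H),
    (forall k, S (v k)) /\ nsqv (f - \sum_(k < m) c k *: v k) < t].

Lemma closed_span_sub (S : set H) : S `<=` closed_span S.
Proof.
move=> x Sx t t0; exists 1, (fun=> 1), (fun=> x); split => //.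
by rewrite big_ord1 scale1r subrr nsqv0.
Qed.

Lemma closed_span_subspace (S : set H) : subspace (closed_span S).
Proof.
split.
- move=> t t0; exists 0, (fun=> 0), (fun=> 0); split; first by case.
  by rewrite big_ord0 subrr nsqv0.
- move=> x y hx hy t t0.
  (* The parallelogram bound doubles each of the two squared errors. *)
  have t4 : 0 < t / 4 by rewrite divr_gt0.
  have [m [c [v [Sv xv]]]] := hx _ t4.
  have [m' [c' [v' [Sv' yv']]]] := hy _ t4.
  exists (m + m')%N.
  exists (fun k : 'I_(m + m') => match fintype.split k with inl i => c i | inr j => c' j end).
  exists (fun k : 'I_(m + m') => match fintype.split k with inl i => v i | inr j => v' j end).
  split; first by move=> k; case: (fintype.split k).
  rewrite big_split_ord/=.
  under eq_bigr do rewrite (unsplitK (inl _)).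
  under [X in _ - (_ + X)]eq_bigr do rewrite (unsplitK (inr _)).
  rewrite opprD addrACA; apply: (le_lt_trans (nsqvD_le _ _)); lra.
- move=> c x hx t t0.
  have k0 : 0 < nsq c + 1 by rewrite ltr_wpDl// nsq_ge0.
  have [m [d [v [Sv xv]]]] := hx _ (divr_gt0 t0 k0).
  exists m, (fun k => c * d k), v; split => //.
  under eq_bigr do rewrite -scalerA.
  rewrite -scaler_sumr -scalerBr nsqvZ.
  apply: (@le_lt_trans _ _ ((nsq c + 1) * nsqv (x - \sum_(k < m) d k *: v k))).
    by rewrite ler_wpM2r ?nsqv_ge0// lerDl.
  by rewrite mulrC -ltr_pdivlMr.
Qed.

Lemma closed_span_orth (S : set H) y : (forall v, S v -> ip v y = 0) ->
  forall x, closed_span S x -> ip x y = 0.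
Proof.
move=> h x hx.
suff : nsq (ip x y) <= 0.
  case: (ip x y) => a b; rewrite /nsq/= => ab.
  by congr (_ +i* _); nra.
apply: (ler_addgt0_scaled (nsqv_ge0 y)) => t /hx[m [c [v [Sv xv]]]].
rewrite add0r.
have -> : ip x y = ip (x - \sum_(k < m) c k *: v k) y.
  rewrite ipBl ip_suml big1 ?subr0// => k _.
  by rewrite ipZl h ?mulr0.
apply: (le_trans (cauchy_schwarz _ _)).
by rewrite ler_wpM2r ?nsqv_ge0// ltW.
Qed.

Section parseval.
Context {I : choiceType} (D : set I) (e : I -> H).
Hypothesis bessel : forall x, (\esum_(i in D) (nsq (ip x (e i)))%:E <= (nsqv x)%:E)%E.

Let S x := fine (\esum_(i in D) (nsq (ip x (e i)))%:E).

Let SE x : \esum_(i in D) (nsq (ip x (e i)))%:E = (S x)%:E.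
Proof.
rewrite fineK// ge0_fin_numE; first exact: (le_lt_trans (bessel x) (ltry _)).
by apply: esum_ge0 => i _; rewrite lee_fin nsq_ge0.
Qed.

Let S_le x : S x <= nsqv x.
Proof. by rewrite -lee_fin -SE. Qed.

Let S_parallelogram x y : S (x + y) + S (x - y) = 2 * S x + 2 * S y.
Proof.
apply: EFin_inj; rewrite -[2]/(1 + 1) !mulrDl !mul1r !EFinD -!SE.
rewrite -!esumD; try by move=> *; rewrite ?adde_ge0 ?lee_fin ?nsq_ge0.
apply: eq_esum => i _; rewrite -!EFinD; congr _%:E.
by rewrite !ipDl ipNl nsq_parallelogram; ring.
Qed.

Definition parseval_for x := \esum_(i in D) (nsq (ip x (e i)))%:E = (nsqv x)%:E.

Let parsevalE x : parseval_for x <-> nsqv x <= S x.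
Proof.
rewrite /parseval_for SE; split => [[->]//|h].
by congr _%:E; apply/eqP; rewrite eq_le h S_le.
Qed.

(** The defect [nsqv - S] is nonnegative and satisfies the parallelogram law, so if it vanishes at
    [x] and [y] it vanishes at [x + y]. *)
Lemma parsevalD x y : parseval_for x -> parseval_for y -> parseval_for (x + y).
Proof.
rewrite !parsevalE => hx hy.
have := S_parallelogram x y; have := nsqv_parallelogram x y.
have := S_le (x - y); lra.
Qed.

Lemma parsevalZ c x : parseval_for x -> parseval_for (c *: x).
Proof.
rewrite /parseval_for nsqvZ EFinM => <-.
under eq_esum do rewrite ipZl nsqM.
by rewrite esumZl_real ?nsq_ge0// => i; exact: nsq_ge0.
Qed.

Lemma parseval_sum J (s : seq J) (F : J -> H) :
  (forall j, parseval_for (F j)) -> parseval_for (\sum_(j <- s) F j).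
Proof.
move=> h; apply: big_ind => //; last exact: parsevalD.
by rewrite -[0](scale0r 0); apply: parsevalZ; rewrite /parseval_for nsqv0 esum1// => i _; rewrite ip0l nsq0.
Qed.

(** Apply the parallelogram law to [y] and [x - y], whose sum is [x]. The defect of [x] is at most
    twice that of [y], which is 0, plus twice that of [x - y], which is at most [t]; hence the
    constant 2. *)
Lemma parseval_closed x :
  (forall t, 0 < t -> exists y, parseval_for y /\ nsqv (x - y) <= t) ->
  parseval_for x.
Proof.
move=> h; apply/parsevalE; apply: (@ler_addgt0_scaled _ _ _ 2) => // t /h[y [/parsevalE py xy]].
have := S_parallelogram y (x - y); have := nsqv_parallelogram y (x - y).
rewrite [y + _]addrC subrK; have := S_le (y - (x - y)).
have : 0 <= S (x - y).
  by apply: fine_ge0; apply: esum_ge0 => i _; rewrite lee_fin nsq_ge0.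
lra.
Qed.

End parseval.
End prehilbert.

(** * Measurability and integration of complex-valued functions *)

Section complex_measurable.
Context d {T : measurableType d} {R : realType}.
Implicit Types f g : T -> R[i].

Definition cmeas f :=
  measurable_fun setT (Re \o f) /\ measurable_fun setT (Im \o f).

Lemma cmeas_real (f : T -> R) : measurable_fun setT f -> cmeas (fun x => (f x)%:C).
Proof. by move=> mf; split => //; exact: measurable_cst. Qed.

Lemma cmeas_cst (c : R[i]) : cmeas (fun=> c).
Proof. by split; exact: measurable_cst. Qed.

Lemma cmeasD f g : cmeas f -> cmeas g -> cmeas (fun x => f x + g x).
Proof.
move=> [fr fi] [gr gi]; split.
  rewrite (_ : _ \o _ = (Re \o f) \+ (Re \o g)); first exact: measurable_funD.
  by apply/funext => x /=; rewrite ReD.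
rewrite (_ : _ \o _ = (Im \o f) \+ (Im \o g)); first exact: measurable_funD.
by apply/funext => x /=; rewrite ImD.
Qed.

Lemma cmeasM f g : cmeas f -> cmeas g -> cmeas (fun x => f x * g x).
Proof.
move=> [fr fi] [gr gi]; split.
  rewrite (_ : _ \o _ = ((Re \o f) \* (Re \o g)) \- ((Im \o f) \* (Im \o g))).
    by apply: measurable_funB; exact: measurable_funM.
  by apply/funext => x /=; case: (f x) (g x) => a b [c e].
rewrite (_ : _ \o _ = ((Re \o f) \* (Im \o g)) \+ ((Im \o f) \* (Re \o g))).
  by apply: measurable_funD; exact: measurable_funM.
by apply/funext => x /=; case: (f x) (g x) => a b [c e].
Qed.

Lemma cmeasJ f : cmeas f -> cmeas (fun x => (f x)^*).
Proof.
move=> [fr fi]; split.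
  by rewrite (_ : _ \o _ = Re \o f)//; apply/funext => x /=; case: (f x).
rewrite (_ : _ \o _ = \- (Im \o f)); first exact: measurable_funN.
by apply/funext => x /=; case: (f x).
Qed.

Lemma cmeas_expi (g : T -> R) : measurable_fun setT g -> cmeas (fun x => expi (g x)).
Proof.
move=> mg; split.
  rewrite (_ : _ \o _ = cos \o g)//; apply: measurableT_comp => //.
  by apply: continuous_measurable_fun; exact: continuous_cos.
rewrite (_ : _ \o _ = sin \o g)//; apply: measurableT_comp => //.
by apply: continuous_measurable_fun; exact: continuous_sin.
Qed.

Lemma measurable_nsq f : cmeas f -> measurable_fun setT (fun x => nsq (f x)).
Proof. by move=> [fr fi]; apply: measurable_funD; exact: measurable_funX. Qed.

Lemma measurable_nsqE f : cmeas f -> measurable_fun setT (fun x => (nsq (f x))%:E).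
Proof. by move=> mf; apply/measurable_EFinP; exact: measurable_nsq. Qed.

End complex_measurable.

Lemma cmeas_comp d1 d2 (T1 : measurableType d1) (T2 : measurableType d2)
    (R : realType) (f : T2 -> R[i]) (g : T1 -> T2) :
  cmeas f -> measurable_fun setT g -> cmeas (fun x => f (g x)).
Proof.
by move=> [fr fi] mg; split; [exact: (measurableT_comp fr mg)|exact: (measurableT_comp fi mg)].
Qed.

Section expi_lemmas.
Context {R : realType}.
Implicit Types s t : R.

Lemma expiD s t : expi (s + t) = expi s * expi t.
Proof.
rewrite /expi cosD sinD; simpc; congr (_ +i* _); ring.
Qed.

Lemma expi0 : expi (0 : R) = 1.
Proof. by rewrite /expi cos0 sin0. Qed.

Lemma expiN t : expi (- t) = (expi t)^*.
Proof. by rewrite /expi cosN sinN. Qed.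

Lemma nsq_expi t : nsq (expi t) = 1.
Proof. by rewrite /nsq/= cos2Dsin2. Qed.

Lemma expiX t n : expi t ^+ n = expi (n%:R * t).
Proof.
elim: n => [|n IH]; first by rewrite expr0 mul0r expi0.
by rewrite exprS IH -expiD -natr1 mulrDl mul1r addrC.
Qed.

End expi_lemmas.

Section complex_integral.
Context {R : realType}.
Local Notation mu := (@lebesgue_measure R).
Implicit Types (f g h : R -> R[i]).

Definition cint f :=
  mu.-integrable setT (EFin \o (Re \o f)) /\ mu.-integrable setT (EFin \o (Im \o f)).

Lemma cint_cmeas f : cint f -> cmeas f.
Proof.
by move=> [/measurable_int/measurable_EFinP ? /measurable_int/measurable_EFinP ?].
Qed.

Lemma cint_le f (g : R -> R) : cmeas f -> mu.-integrable setT (EFin \o g) ->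
  (forall x, nsq (f x) <= g x ^+ 2) -> cint f.
Proof.
move=> [fr fi] ig fg; split; (apply: le_integrable ig => //; first exact/measurable_EFinP).
  move=> x _; rewrite !abse_EFin lee_fin/= -ler_sqr ?nnegrE// !real_normK ?num_real//.
  by apply: le_trans (fg x); rewrite lerDl sqr_ge0.
move=> x _; rewrite !abse_EFin lee_fin/= -ler_sqr ?nnegrE// !real_normK ?num_real//.
by apply: le_trans (fg x); rewrite lerDr sqr_ge0.
Qed.

Lemma eq_cintegral f g : f =1 g -> cintegral f = cintegral g.
Proof. by move=> /funext ->. Qed.

Lemma cintD f g : cint f -> cint g -> cint (fun x => f x + g x).
Proof.
move=> [fr fi] [gr gi]; split.
  rewrite (_ : _ \o _ = (EFin \o (Re \o f)) \+ (EFin \o (Re \o g)))%E.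
    exact: integrableD.
  by apply/funext => x /=; rewrite ReD.
rewrite (_ : _ \o _ = (EFin \o (Im \o f)) \+ (EFin \o (Im \o g)))%E.
  exact: integrableD.
by apply/funext => x /=; rewrite ImD.
Qed.

Lemma cintegralD f g : cint f -> cint g ->
  cintegral (fun x => f x + g x) = cintegral f + cintegral g.
Proof.
move=> [fr fi] [gr gi]; rewrite /cintegral; simpc; congr (_ +i* _).
  under eq_Rintegral do rewrite ReD.
  by rewrite RintegralD.
under eq_Rintegral do rewrite ImD.
by rewrite RintegralD.
Qed.

Lemma cintZ (c : R[i]) f : cint f -> cint (fun x => c * f x).
Proof.
move=> [fr fi]; case: c => a b; split.
  rewrite (_ : _ \o _ = (fun x => a%:E * (EFin \o (Re \o f)) x) \-
                        (fun x => b%:E * (EFin \o (Im \o f)) x))%E.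
    by apply: integrableB => //; exact: integrableZl.
  by apply/funext => x /=; case: (f x).
rewrite (_ : _ \o _ = (fun x => a%:E * (EFin \o (Im \o f)) x) \+
                      (fun x => b%:E * (EFin \o (Re \o f)) x))%E.
  by apply: integrableD => //; exact: integrableZl.
by apply/funext => x /=; case: (f x).
Qed.

Lemma cintegralZ (c : R[i]) f : cint f ->
  cintegral (fun x => c * f x) = c * cintegral f.
Proof.
move=> [fr fi]; case: c => a b; rewrite /cintegral; simpc; congr (_ +i* _).
  rewrite -RintegralZl// -RintegralZl// -RintegralB//; try exact: (integrableZl _ _ fr);
    try exact: (integrableZl _ _ fi).
  by apply: eq_Rintegral => x _; case: (f x).
rewrite -RintegralZl// -RintegralZl// -RintegralD//; try exact: (integrableZl _ _ fr);
  try exact: (integrableZl _ _ fi).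
by apply: eq_Rintegral => x _; case: (f x).
Qed.

Lemma cintJ f : cint f -> cint (fun x => (f x)^*).
Proof.
move=> [fr fi]; split.
  by rewrite (_ : Re \o _ = Re \o f)//; apply/funext => x /=; case: (f x).
rewrite (_ : EFin \o _ = -%E \o (EFin \o (Im \o f)))%E; first exact: integrableN.
by apply/funext => x /=; case: (f x).
Qed.

Lemma cintegralJ f : cint f -> cintegral (fun x => (f x)^*) = (cintegral f)^*.
Proof.
move=> [fr fi]; rewrite /cintegral; congr (_ +i* _).
  by apply: eq_Rintegral => x _; case: (f x).
rewrite -mulN1r -RintegralZl//.
by apply: eq_Rintegral => x _; case: (f x) => a b /=; rewrite mulN1r.
Qed.

Lemma cint0 : cint (fun=> 0).
Proof.
by split; rewrite (_ : _ \o _ = cst 0%E)//; exact: integrable0.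
Qed.

Lemma cintegral0 : cintegral (fun=> 0 : R[i]) = 0.
Proof.
by rewrite /cintegral/= !Rintegral_cst// !mul0r.
Qed.

Lemma cint_sum I (s : seq I) (F : I -> R -> R[i]) : (forall i, cint (F i)) ->
  cint (fun x => \sum_(i <- s) F i x).
Proof.
move=> h; elim: s => [|i s IH].
  by under eq_fun do rewrite big_nil; exact: cint0.
by under eq_fun do rewrite big_cons; exact: cintD.
Qed.

Lemma cintegral_sum I (s : seq I) (F : I -> R -> R[i]) : (forall i, cint (F i)) ->
  cintegral (fun x => \sum_(i <- s) F i x) = \sum_(i <- s) cintegral (F i).
Proof.
move=> h; elim: s => [|i s IH].
  by under eq_cintegral do rewrite big_nil; rewrite big_nil cintegral0.
under eq_cintegral do rewrite big_cons.
by rewrite big_cons cintegralD// ?IH//; exact: cint_sum.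
Qed.

Lemma ae_eq_cintegral f g : cmeas f -> cmeas g -> f = g %[ae mu] ->
  cintegral f = cintegral g.
Proof.
move=> [fr fi] [gr gi] fg; rewrite /cintegral; congr (_ +i* _); congr fine.
  apply: ae_eq_integral => //; try exact/measurable_EFinP.
  by apply: (filterS (F := almost_everywhere mu)) fg => x /= h _; rewrite h.
apply: ae_eq_integral => //; try exact/measurable_EFinP.
by apply: (filterS (F := almost_everywhere mu)) fg => x /= h _; rewrite h.
Qed.

Lemma ge0_integral_affine (a b : R) (g : R -> \bar R) : 0 < a ->
  measurable_fun setT g -> (forall x, 0 <= g x)%E ->
  (\int[mu]_x g (a * x + b)%R = a^-1%:E * \int[mu]_x g x)%E.
Proof.
move=> a0 mg g0.
have mX := measurable_affine a b.
have e := @ge0_integral_pushforward _ _ _ _ _ _ mX mu setT g measurableT mg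
  (fun x _ => g0 x).
rewrite preimage_setT in e.
rewrite -[LHS]/(\int[mu]_x (g \o (fun x => a * x + b)%R) x)%E -e.
have ai0 : 0 <= a^-1 by rewrite invr_ge0 ltW.
rewrite (@eq_measure_integral _ _ _ _ (mscale (NngNum ai0) mu)).
  by rewrite ge0_integral_mscale.
by move=> Y mY _; exact: lebesgue_measure_affine.
Qed.

Lemma integrable_affine (a b : R) (g : R -> \bar R) : 0 < a ->
  mu.-integrable setT g -> mu.-integrable setT (fun x => g (a * x + b)).
Proof.
move=> a0 /integrableP[mg ig]; apply/integrableP; split.
  exact: (measurableT_comp mg (measurable_affine a b)).
rewrite (ge0_integral_affine b a0 (g := fun x => `|g x|%E))//.
  by rewrite lte_mul_pinfty// lee_fin invr_ge0 ltW.
exact: measurableT_comp.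
Qed.

Lemma Rintegral_affine (a b : R) (g : R -> R) : 0 < a ->
  mu.-integrable setT (EFin \o g) ->
  \int[mu]_x g (a * x + b) = a^-1 * \int[mu]_x g x.
Proof.
move=> a0 ig.
have h (k : R -> \bar R) : mu.-integrable setT k -> (forall x, 0 <= k x)%E ->
    (\int[mu]_x k (a * x + b)%R = a^-1%:E * \int[mu]_x k x)%E.
  by move=> /measurable_int mk k0; rewrite ge0_integral_affine.
pose ga x := (EFin \o g) (a * x + b).
have hp : (\int[mu]_x ga^\+ x = a^-1%:E * \int[mu]_x (EFin \o g)^\+ x)%E.
  rewrite -(h _ (integrable_funepos measurableT ig) (fun x => funepos_ge0 _ x)).
  by apply: eq_integral => x _; rewrite !funeposE.
have hn : (\int[mu]_x ga^\- x = a^-1%:E * \int[mu]_x (EFin \o g)^\- x)%E.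
  rewrite -(h _ (integrable_funeneg measurableT ig) (fun x => funeneg_ge0 _ x)).
  by apply: eq_integral => x _; rewrite !funenegE.
have e : (\int[mu]_x ga x = a^-1%:E * \int[mu]_x (EFin \o g) x)%E.
  rewrite integralE [in RHS]integralE muleBr//; last exact: integrable_add_def.
  by congr (_ - _)%E; [exact: hp|exact: hn].
rewrite /Rintegral; transitivity (fine (a^-1%:E * \int[mu]_x (EFin \o g) x)%E).
  by congr fine; exact: e.
by rewrite fineM//; exact: integrable_fin_num.
Qed.

Lemma cint_affine (a b : R) f : 0 < a -> cint f -> cint (fun x => f (a * x + b)).
Proof.
move=> a0 [fr fi]; split; first exact: integrable_affine fr.
exact: integrable_affine fi.
Qed.

Lemma cintegral_affine (a b : R) f : 0 < a -> cint f ->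
  cintegral (fun x => f (a * x + b)) = a^-1%:C * cintegral f.
Proof.
move=> a0 [fr fi]; rewrite /cintegral.
rewrite (Rintegral_affine b a0 fr) (Rintegral_affine b a0 fi).
by simpc.
Qed.

End complex_integral.

(** * Square-integrable functions and the inner product of [L2] *)

Section square_integrable.
Context {R : realType}.
Local Notation mu := (@lebesgue_measure R).
Implicit Types (f g h : R -> R[i]) (F G : L2 R).

Definition sqI f : \bar R := (\int[mu]_x (nsq (f x))%:E)%E.

Lemma sqI_ge0 f : (0 <= sqI f)%E.
Proof. by apply: integral_ge0 => x _; rewrite lee_fin nsq_ge0. Qed.

Lemma Lfun2P (f : R -> R) :
  f \in Lfun mu 2%:E <-> measurable_fun setT f /\ (\int[mu]_x (f x ^+ 2)%:E < +oo)%E.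
Proof.
have e : (\int[mu]_x (`|(f x)%:E| `^ 2) = \int[mu]_x (f x ^+ 2)%:E)%E.
  apply: eq_integral => x _.
  by rewrite /= powR_mulrn// real_normK// num_real.
split=> [lf|[mf lf]].
  split; first by move: lf => /andP[/[!inE]].
  have /integrableP[_] := Lfun2_integrable_sqr lf.
  by under eq_integral do rewrite /= ger0_norm ?sqr_ge0//.
apply/andP; rewrite !inE; split => //.
by rewrite /= /finite_norm unlock /= poweR_lty// e.
Qed.

Lemma sqintP f : f \in sqint <-> cmeas f /\ (sqI f < +oo)%E.
Proof.
have mr (k : R -> R) : measurable_fun setT k -> measurable_fun setT (fun x => (k x ^+ 2)%:E).
  by move=> mk; apply/measurable_EFinP; exact: measurable_funX.
have e : cmeas f -> sqI f = (\int[mu]_x (Re (f x) ^+ 2)%:E + \int[mu]_x (Im (f x) ^+ 2)%:E)%E.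
  move=> [fr fi]; rewrite -ge0_integralD//.
  - by move=> x _; rewrite lee_fin sqr_ge0.
  - exact: mr fr.
  - by move=> x _; rewrite lee_fin sqr_ge0.
  - exact: mr fi.
split=> [/andP[/Lfun2P[fr ir] /Lfun2P[fi ii]]|[mf]].
  split; first by split.
  by rewrite e//; exact: lte_add_pinfty.
rewrite e//; case: mf => fr fi h.
have r0 : (0 <= \int[mu]_x (Re (f x) ^+ 2)%:E)%E.
  by apply: integral_ge0 => x _; rewrite lee_fin sqr_ge0.
have i0 : (0 <= \int[mu]_x (Im (f x) ^+ 2)%:E)%E.
  by apply: integral_ge0 => x _; rewrite lee_fin sqr_ge0.
apply/andP; split; apply/Lfun2P; split => //; apply: le_lt_trans h.
  by rewrite leeDl.
by rewrite leeDr.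
Qed.

Lemma sqint_cmeas f : f \in sqint -> cmeas f. Proof. by move=> /sqintP[]. Qed.

Lemma sqI_lty f : f \in sqint -> (sqI f < +oo)%E. Proof. by move=> /sqintP[]. Qed.

Lemma sqI_fin f : f \in sqint -> sqI f \is a fin_num.
Proof. by move=> /sqI_lty h; rewrite ge0_fin_numE// sqI_ge0. Qed.

Lemma integrable_nsq f : f \in sqint -> mu.-integrable setT (fun x => (nsq (f x))%:E).
Proof.
move=> /sqintP[mf fi]; apply/integrableP; split; first exact: measurable_nsqE.
by under eq_integral do rewrite gee0_abs ?lee_fin ?nsq_ge0//.
Qed.

Lemma sqI_le f g : cmeas f -> cmeas g -> (forall x, nsq (f x) <= nsq (g x)) ->
  (sqI f <= sqI g)%E.
Proof.
move=> mf mg fg; apply: ge0_le_integral => //; try exact: measurable_nsqE;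
  by move=> x _; rewrite lee_fin ?nsq_ge0.
Qed.

Lemma sqint_le f g : cmeas f -> g \in sqint -> (forall x, nsq (f x) <= nsq (g x)) ->
  f \in sqint.
Proof.
move=> mf gs fg; apply/sqintP; split => //.
by apply: le_lt_trans (sqI_lty gs); apply: sqI_le => //; exact: sqint_cmeas.
Qed.

Lemma sqintD f g : f \in sqint -> g \in sqint -> (fun x => f x + g x) \in sqint.
Proof. exact: (@rpredD _ (@sqint R) f g). Qed.

Lemma sqintB f g : f \in sqint -> g \in sqint -> (fun x => f x - g x) \in sqint.
Proof. exact: (@rpredB _ (@sqint R) f g). Qed.

Lemma sqintJ f : f \in sqint -> (fun x => (f x)^*) \in sqint.
Proof.
move=> fs; apply: (sqint_le (g := f)) => //; first exact/cmeasJ/sqint_cmeas.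
by move=> x; rewrite nsqJ.
Qed.

Lemma sqintMl f g : cmeas f -> (forall x, nsq (f x) <= 1) -> g \in sqint ->
  (fun x => f x * g x) \in sqint.
Proof.
move=> mf f1 gs; apply: (sqint_le (g := g)) => //.
  by apply: cmeasM => //; exact: sqint_cmeas.
by move=> x; rewrite nsqM ler_piMl// nsq_ge0.
Qed.

Lemma cint_mulJ f g : f \in sqint -> g \in sqint -> cint (fun x => f x * (g x)^*).
Proof.
move=> fs gs.
apply: (@cint_le _ _ (fun x => nsq (f x) + nsq (g x))).
- apply: cmeasM; first exact: sqint_cmeas.
  exact/cmeasJ/sqint_cmeas.
- exact: (integrableD measurableT (integrable_nsq fs) (integrable_nsq gs)).
- move=> x; rewrite nsqM nsqJ.
  have := nsq_ge0 (f x); have := nsq_ge0 (g x); nra.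
Qed.

Lemma cintegral_nsq f : f \in sqint ->
  cintegral (fun x => f x * (f x)^*) = (fine (sqI f))%:C.
Proof.
move=> fs; rewrite /cintegral.
under [X in _ +i* X]eq_Rintegral do rewrite nsqE/=.
rewrite Rintegral_cst// mul0r; congr (_ +i* _); congr fine.
by apply: eq_integral => x _; rewrite nsqE.
Qed.

Lemma L2_cmeas F : cmeas F. Proof. exact/sqint_cmeas/L2_sqint. Qed.

(** [L2inner] is defined on chosen representatives; this replaces them by explicit functions. *)
Lemma L2inner_ae F G f g : cmeas f -> cmeas g ->
  F = f %[ae mu] -> G = g %[ae mu] ->
  L2inner F G = cintegral (fun x => f x * (g x)^*).
Proof.
move=> mf mg Ff Gg; apply: ae_eq_cintegral.
- by apply: cmeasM; [|apply: cmeasJ]; exact: L2_cmeas.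
- by apply: cmeasM => //; exact: cmeasJ.
move: Ff Gg; apply: (filterS2 (F := almost_everywhere mu)) => x /= hf hg _.
by rewrite hf// hg.
Qed.

Lemma L2inner_toL2 f g : f \in sqint -> g \in sqint ->
  L2inner (toL2 f) (toL2 g) = cintegral (fun x => f x * (g x)^*).
Proof.
by move=> fs gs; apply: L2inner_ae; try exact: sqint_cmeas; exact: toL2E.
Qed.

Lemma L2_addE F G : (F + G : L2 R) = (fun x => F x + G x) %[ae mu].
Proof. exact: (repr_L2 (repr F + repr G)). Qed.

Lemma toL2D f g : f \in sqint -> g \in sqint ->
  toL2 (fun x => f x + g x) = toL2 f + toL2 g.
Proof.
move=> fs gs; rewrite -[RHS]toL2K; apply: toL2_ext; [exact: sqintD|exact: L2_sqint|].
have h := L2_addE (toL2 f) (toL2 g).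
move: h (toL2E fs) (toL2E gs).
by apply: (filterS3 (F := almost_everywhere mu)) => x /= e1 e2 e3 _; rewrite e1// e2// e3.
Qed.

Lemma toL2Z (c : R[i]) f : f \in sqint -> toL2 (fun x => c * f x) = c *: toL2 f.
Proof.
move=> fs; rewrite -[RHS]toL2K; apply: toL2_ext; [exact: sqint_scale|exact: L2_sqint|].
move: (L2_scaleE c (toL2 f)) (toL2E fs).
by apply: (filterS2 (F := almost_everywhere mu)) => x /= e1 e2 _; rewrite e1// e2.
Qed.

Lemma toL2B f g : f \in sqint -> g \in sqint ->
  toL2 (fun x => f x - g x) = toL2 f - toL2 g.
Proof.
move=> fs gs; rewrite -scaleN1r -toL2Z// -toL2D//; last exact: sqint_scale.
by congr toL2; apply/funext => x; rewrite mulN1r.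
Qed.

Lemma L2innerDl F G H : L2inner (F + G) H = L2inner F H + L2inner G H.
Proof.
have mFG : cmeas (fun x => F x + G x) by apply: cmeasD; exact: L2_cmeas.
rewrite (L2inner_ae mFG (L2_cmeas H) (L2_addE F G)); last exact: ae_eq_refl.
under eq_cintegral do rewrite mulrDl.
by rewrite cintegralD//; apply: cint_mulJ; exact: L2_sqint.
Qed.

Lemma L2innerZl c F G : L2inner (c *: F) G = c * L2inner F G.
Proof.
have mF : cmeas (fun x => c * F x) by apply: cmeasM; [exact: cmeas_cst|exact: L2_cmeas].
rewrite (L2inner_ae mF (L2_cmeas G) (L2_scaleE c F)); last exact: ae_eq_refl.
under eq_cintegral do rewrite -mulrA.
by rewrite cintegralZ//; apply: cint_mulJ; exact: L2_sqint.
Qed.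

Lemma L2innerC F G : L2inner G F = (L2inner F G)^*.
Proof.
rewrite /L2inner -cintegralJ; last by apply: cint_mulJ; exact: L2_sqint.
by apply: eq_cintegral => x; rewrite rmorphM/= conjcK mulrC.
Qed.

Lemma nsqv_L2 F : nsqv L2inner F = fine (sqI F).
Proof. by rewrite /nsqv /L2inner cintegral_nsq//; exact: L2_sqint. Qed.

Lemma nsqv_toL2 f : f \in sqint -> nsqv L2inner (toL2 f) = fine (sqI f).
Proof. by move=> fs; rewrite /nsqv L2inner_toL2// cintegral_nsq. Qed.

Lemma L2inner_ge0 F : 0 <= Re (L2inner F F).
Proof. by rewrite -/(nsqv L2inner F) nsqv_L2 fine_ge0// sqI_ge0. Qed.

Lemma L2norm_sq F : L2norm F ^+ 2 = nsqv L2inner F.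
Proof. by rewrite sqr_sqrtr// L2inner_ge0. Qed.

Lemma ae_eq_sqI f g : cmeas f -> cmeas g -> f = g %[ae mu] -> sqI f = sqI g.
Proof.
move=> mf mg fg; apply: ae_eq_integral => //; try exact: measurable_nsqE.
by apply: (filterS (F := almost_everywhere mu)) fg => x /= h _; rewrite h.
Qed.

End square_integrable.

Section vector_inner.
Context {R : realType} {n : nat}.
Implicit Types f g h : 'I_n -> L2 R.

Lemma vinnerDl f g h : vinner (f + g) h = vinner f h + vinner g h.
Proof. by rewrite /vinner -big_split; apply: eq_bigr => i _; exact: L2innerDl. Qed.

Lemma vinnerZl c f g : vinner (c *: f) g = c * vinner f g.
Proof. by rewrite /vinner mulr_sumr; apply: eq_bigr => i _; exact: L2innerZl. Qed.

Lemma vinnerC f g : vinner g f = (vinner f g)^*.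
Proof. by rewrite /vinner rmorph_sum; apply: eq_bigr => i _; exact: L2innerC. Qed.

Lemma vinner_ge0 f : 0 <= Re (vinner f f).
Proof. by rewrite /vinner Re_sum sumr_ge0// => i _; exact: L2inner_ge0. Qed.

Lemma vnorm_sq f : vnorm f ^+ 2 = nsqv vinner f.
Proof. by rewrite sqr_sqrtr// vinner_ge0. Qed.

Lemma cspanE (S : set ('I_n -> L2 R)) : cspan S = closed_span vinner S.
Proof.
apply/seteqP; split=> f hf t t0.
  have st : 0 < Num.sqrt t by rewrite sqrtr_gt0.
  have [m [c [v [Sv fv]]]] := hf _ st.
  exists m, c, v; split => //; rewrite -vnorm_sq -(sqr_sqrtr (ltW t0)).
  by rewrite ltr_pXn2r// nnegrE sqrtr_ge0.
have [m [c [v [Sv fv]]]] := hf _ (exprn_gt0 2 t0).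
exists m, c, v; split => //.
by rewrite -(@ltr_pXn2r _ 2)// ?nnegrE ?sqrtr_ge0 ?(ltW t0)// vnorm_sq.
Qed.

End vector_inner.

(** * Integrals of indicators and trigonometric functions *)

Section indicator_integrals.
Context {R : realType}.
Local Notation mu := (@lebesgue_measure R).
Implicit Types (f g b : R -> R[i]) (A : set R).

Lemma cmeas_indic A f : measurable A -> cmeas f -> cmeas (fun x => (\1_A x)%:C * f x).
Proof.
by move=> mA mf; apply: cmeasM => //; apply: cmeas_real; exact: measurable_indic.
Qed.

Lemma cint_indic A b (C : R) : measurable A -> (mu A < +oo)%E -> cmeas b ->
  (forall x, nsq (b x) <= C ^+ 2) -> cint (fun x => (\1_A x)%:C * b x).
Proof.
move=> mA fA mb bC; apply: (@cint_le _ _ (fun x => C * \1_A x)).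
- exact: cmeas_indic.
- have iA : mu.-integrable setT (fun x => (\1_A x)%:E).
    apply/integrableP; split; first by apply/measurable_EFinP; exact: measurable_indic.
    under eq_integral do rewrite gee0_abs ?lee_fin//.
    by rewrite integral_indic// setIT.
  exact: (integrableZl measurableT C iA).
- move=> x; rewrite nsqM nsqR exprMn mulrC.
  by apply: ler_wpM2r => //; exact: sqr_ge0.
Qed.

Lemma sqI_indic A : measurable A -> sqI (fun x => (\1_A x)%:C) = mu A.
Proof.
move=> mA; rewrite -[A in RHS]setIT -integral_indic//.
apply: eq_integral => x _; rewrite nsqR indicE.
by case: (x \in A); rewrite ?expr1n ?expr0n.
Qed.

Lemma sqint_indic A : measurable A -> (mu A < +oo)%E -> (fun x => (\1_A x)%:C) \in sqint.
Proof.
move=> mA fA; apply/sqintP; split; last by rewrite sqI_indic.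
by apply: cmeas_real; exact: measurable_indic.
Qed.

Lemma sqint_indicM A b : measurable A -> (mu A < +oo)%E -> cmeas b ->
  (forall x, nsq (b x) <= 1) -> (fun x => (\1_A x)%:C * b x) \in sqint.
Proof.
move=> mA fA mb b1; apply: (sqint_le (g := fun x => (\1_A x)%:C)).
- exact: cmeas_indic.
- exact: sqint_indic.
- by move=> x; rewrite nsqM ler_piMr// nsq_ge0.
Qed.

Lemma cintegral_indic A f :
  cintegral (fun x => (\1_A x)%:C * f x) =
  (\int[mu]_(x in A) Re (f x)) +i* (\int[mu]_(x in A) Im (f x)).
Proof.
rewrite /cintegral [X in _ = X +i* _]Rintegral_mkcond [X in _ = _ +i* X]Rintegral_mkcond.
congr (_ +i* _); apply: eq_Rintegral => x _; rewrite patchE indicE;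
  case: (x \in A); case: (f x) => u v /=.
- by rewrite mul1r mul0r subr0.
- by rewrite !mul0r subr0.
- by rewrite mul1r mul0r addr0.
- by rewrite !mul0r addr0.
Qed.

Lemma cintegral_real (f : R -> R) : cintegral (fun x => (f x)%:C) = (\int[mu]_x f x)%:C.
Proof. by rewrite /cintegral/= Rintegral_cst// mul0r. Qed.

Lemma expi_int (k : int) : expi (k%:~R * (2 * pi)) = 1 :> R[i].
Proof.
have h (n : nat) : expi (n%:R * (2 * pi)) = 1 :> R[i].
  rewrite -expiX (_ : expi (2 * pi) = 1) ?expr1n//.
  by rewrite mulrC mulr_natr /expi cos2pi sin2pi.
case: k => n; first by rewrite -pmulrn h.
by rewrite NegzE mulrNz mulNr expiN -pmulrn h conjc1.
Qed.

Lemma measurable_mulr (w : R) : measurable_fun setT (fun x : R => w * x).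
Proof. by apply: measurable_funM => //; exact: measurable_cst. Qed.

Lemma is_derive_mul (w x : R) : is_derive x (1 : R) (fun y : R => w * y) w.
Proof.
have := is_deriveZ w (is_derive_id x (1 : R)).
by rewrite /GRing.scale/= mulr1.
Qed.

Lemma integral_cos (w c d : R) : w != 0 -> c < d ->
  \int[mu]_(x in `]c, d]) cos (w * x) = (sin (w * d) - sin (w * c)) / w.
Proof.
move=> w0 cd.
have dF (x : R) : is_derive x (1 : R) (fun y => w^-1 * sin (w * y)) (cos (w * x)).
  have h := is_derive1_comp (is_derive_sin (w * x)) (is_derive_mul w x).
  have := is_deriveZ w^-1 h.
  by rewrite /GRing.scale/= [w * _]mulrC mulrCA mulVf// mulr1.
have cF : continuous (fun y : R => w^-1 * sin (w * y)).
  by move=> x; apply: differentiable_continuous; apply/derivable1_diffP; case: (dF x).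
have cf : continuous (fun y : R => cos (w * y)).
  move=> x; apply: (@continuous_comp _ _ _ (fun y : R => w * y) cos).
    exact: mulrl_continuous.
  exact: continuous_cos.
rewrite /Rintegral integral_itv_obnd_cbnd; last first.
  by apply/measurable_EFinP; apply: measurable_funTS; exact: continuous_measurable_fun.
rewrite (@continuous_FTC2 _ _ (fun y => w^-1 * sin (w * y)))//=.
- by rewrite mulrBl ![w^-1 * _]mulrC.
- exact: continuous_subspaceT.
- split.
  + by move=> x _; case: (dF x).
  + exact/cvg_at_right_filter/cF.
  + exact/cvg_at_left_filter/cF.
- by move=> x _; rewrite derive1E; case: (dF x).
Qed.

Lemma integral_sin (w c d : R) : w != 0 -> c < d ->
  \int[mu]_(x in `]c, d]) sin (w * x) = (cos (w * c) - cos (w * d)) / w.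
Proof.
move=> w0 cd.
have dF (x : R) : is_derive x (1 : R) (fun y => (- w^-1) * cos (w * y)) (sin (w * x)).
  have h := is_derive1_comp (is_derive_cos (w * x)) (is_derive_mul w x).
  apply: (is_derive_eq (is_deriveZ (- w^-1) h)).
  by rewrite /GRing.scale/=; field.
have cF : continuous (fun y : R => (- w^-1) * cos (w * y)).
  by move=> x; apply: differentiable_continuous; apply/derivable1_diffP; case: (dF x).
have cf : continuous (fun y : R => sin (w * y)).
  move=> x; apply: (@continuous_comp _ _ _ (fun y : R => w * y) sin).
    exact: mulrl_continuous.
  exact: continuous_sin.
rewrite /Rintegral integral_itv_obnd_cbnd; last first.
  by apply/measurable_EFinP; apply: measurable_funTS; exact: continuous_measurable_fun.
rewrite (@continuous_FTC2 _ _ (fun y => (- w^-1) * cos (w * y)))//=.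
- by field.
- exact: continuous_subspaceT.
- split.
  + by move=> x _; case: (dF x).
  + exact/cvg_at_right_filter/cF.
  + exact/cvg_at_left_filter/cF.
- by move=> x _; rewrite derive1E; case: (dF x).
Qed.

Lemma cintegral_expi_period (c : R) (k : int) : k != 0 ->
  cintegral (fun x => (\1_(`]c, c + 2 * pi]) x)%:C * expi (k%:~R * x)) = 0.
Proof.
move=> k0; have w0 : k%:~R != 0 :> R by rewrite intr_eq0.
have cd : c < c + 2 * pi by rewrite ltrDl mulr_gt0// pi_gt0.
rewrite cintegral_indic/= integral_cos// integral_sin//.
have := expiD (k%:~R * c) (k%:~R * (2 * pi)).
by rewrite -mulrDr expi_int mulr1 => -[-> ->]; rewrite !subrr !mul0r.
Qed.

End indicator_integrals.

Lemma conjM (R : realType) (z w : R[i]) : (z * w)^* = z^* * w^*.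
Proof. by rewrite rmorphM. Qed.

Lemma conjR (R : realType) (a : R) : (a%:C)^* = a%:C.
Proof. by rewrite /= oppr0. Qed.

Lemma realcM (R : realType) (a b : R) : (a * b)%:C = a%:C * b%:C.
Proof. by rewrite rmorphM. Qed.

(** * Fejer kernels and the lower Parseval bound for intervals *)

Section dirichlet.
Context {R : realType}.
Local Notation mu := (@lebesgue_measure R).

Lemma mu_itv_oc (p q : R) : p <= q -> mu `]p, q] = (q - p)%:E.
Proof.
rewrite lebesgue_measure_itv/= lte_fin le_eqVlt => /predU1P[->|->//].
by rewrite ltxx subrr.
Qed.

Lemma Rintegral_indic (A : set R) : measurable A -> \int[mu]_x \1_A x = fine (mu A).
Proof. by move=> mA; rewrite /Rintegral integral_indic// setIT. Qed.

Lemma integrable_indic_fin (A : set R) (B : R) : measurable A -> (mu A < +oo)%E ->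
  mu.-integrable setT (EFin \o (fun x => \1_A x * B)).
Proof.
move=> mA fA; suff [h _] : cint (fun x => (\1_A x)%:C * B%:C).
  rewrite (_ : (fun x => _) = Re \o (fun x => (\1_A x)%:C * B%:C))//.
  by apply/funext => x; rewrite /= mul0r subr0.
by apply: (cint_indic (C := B)) => //; [exact: cmeas_cst|move=> _; rewrite nsqR].
Qed.

Lemma Rintegral_indicZ (A : set R) (B : R) : measurable A -> (mu A < +oo)%E ->
  \int[mu]_x (\1_A x * B) = fine (mu A) * B.
Proof.
move=> mA fA; have h := integrable_indic_fin 1 mA fA.
rewrite -(Rintegral_indic mA) -RintegralZr//.
by move: h; under eq_fun do rewrite mulr1.
Qed.

(** This is [n] times the Fejer kernel. *)
Definition dirichlet_sq n (t : R) : R := nsq (\sum_(j < n) expi (j%:R * t)).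

Lemma dirichlet_sq_ge0 n t : 0 <= dirichlet_sq n t.
Proof. exact: nsq_ge0. Qed.

(* The geometric sum times [1 - e^{it}] is [1 - e^{int}], of modulus at most 2. *)
Lemma dirichlet_sq_le n t (d : R) : 0 < d -> d <= t <= 2 * pi - d ->
  dirichlet_sq n t * (2 - 2 * cos d) <= 4.
Proof.
move=> d0 /andP[dt td].
have cos_le : cos t <= cos d.
  have h (u : R) : d <= u <= pi -> cos u <= cos d.
    move=> /andP[du upi]; move: du; rewrite le_eqVlt => /predU1P[->//|du].
    have u0 := lt_trans d0 du.
    by apply/ltW; rewrite ltr_cos// in_itv/= ?(ltW u0) ?(ltW d0)//= (le_trans (ltW du)).
  have [tp|tp] := leP t pi; first by rewrite h// dt tp.
  have -> : cos t = cos (2 * pi - t).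
    have -> : 2 * pi - t = - t + pi *+ 2 by rewrite mulrC mulr_natr addrC.
    by rewrite cosD2pi cosN.
  by apply: h; apply/andP; split; lra.
have e1 : nsq (1 - expi t) = 2 - 2 * cos t.
  rewrite /nsq/=; have := cos2Dsin2 t.
  by move=> h; nra.
have e : dirichlet_sq n t * (2 - 2 * cos t) = nsq (1 - expi (n%:R * t)).
  rewrite -e1 /dirichlet_sq -nsqM.
  under eq_bigr do rewrite -expiX.
  by rewrite mulrC -nsqN -mulNr opprB -subrX1 -nsqN opprB expiX.
apply: (@le_trans _ _ (dirichlet_sq n t * (2 - 2 * cos t))).
  by apply: ler_wpM2l; [exact: dirichlet_sq_ge0|lra].
rewrite e; apply: le_trans (nsqD_le _ _) _.
have -> : nsq (1 : R[i]) = 1 by rewrite /nsq/= expr1n expr0n addr0.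
by rewrite nsqN nsq_expi; lra.
Qed.

Lemma dirichlet_sqN n t : dirichlet_sq n (- t) = dirichlet_sq n t.
Proof.
rewrite /dirichlet_sq -[RHS]nsqJ rmorph_sum; congr nsq.
by apply: eq_bigr => j _; rewrite mulrN expiN.
Qed.

Let E (p : nat * nat) (x : R) : R[i] := expi (p.1%:R * x) * (expi (p.2%:R * x))^*.

Let pairs n : seq (nat * nat) := [seq (j, l) | j <- iota 0 n, l <- iota 0 n].

(** Separating the variables in each of the [n^2] terms turns the integral of the kernel over [A]
    times [A] into a sum of squared Fourier coefficients of [\1_A]. *)
Lemma dirichlet_sq_sub n x y :
  (dirichlet_sq n (x - y))%:C = \sum_(p <- pairs n) E p x * (E p y)^*.
Proof.
rewrite /dirichlet_sq -nsqE rmorph_sum/= big_allpairs_dep/=.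
rewrite -(big_mkord xpredT (fun j : nat => expi (j%:R * (x - y)))).
rewrite -(big_mkord xpredT (fun j : nat => (expi (j%:R * (x - y)))^*)).
rewrite /index_iota subn0 mulr_suml; apply: eq_bigr => j _.
rewrite mulr_sumr; apply: eq_bigr => l _.
rewrite !mulrBr !expiD !expiN (conjM (expi (l%:R * x))) conjcK mulrACA.
rewrite -[RHS]/(expi (j%:R * x) * (expi (l%:R * x))^* * (expi (j%:R * y) * (expi (l%:R * y))^*)^*).
by rewrite (conjM (expi (j%:R * y))) conjcK.
Qed.

Let nsqEp p x : nsq (E p x) = 1.
Proof. by rewrite nsqM nsqJ !nsq_expi mulr1. Qed.

Let cmeasE p : cmeas (E p).
Proof.
apply: cmeasM; first by apply: cmeas_expi; exact: measurable_mulr.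
by apply: cmeasJ; apply: cmeas_expi; exact: measurable_mulr.
Qed.

Let E_expi p x : E p x = expi ((p.1%:Z - p.2%:Z)%:~R * x).
Proof. by rewrite /E -expiN -expiD -mulNr -mulrDl rmorphB/= -!pmulrn. Qed.

Section on_set.
Variable A : set R.
Hypotheses (mA : measurable A) (fA : (mu A < +oo)%E).

Let a p := cintegral (fun x => (\1_A x)%:C * E p x).

Let cintA p : cint (fun x => (\1_A x)%:C * E p x).
Proof. by apply: (cint_indic (C := 1)) => // x; rewrite nsqEp expr1n. Qed.

(** For [A] within a period this is [2 pi n] times the Fejer mean of [\1_A]. *)
Definition fejer_int n (x : R) := \int[mu]_y (\1_A y * dirichlet_sq n (x - y)).

Let dirE n x y : (\1_A y * dirichlet_sq n (x - y))%:C =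
  \sum_(p <- pairs n) E p x * ((\1_A y)%:C * E p y)^*.
Proof.
rewrite realcM dirichlet_sq_sub mulr_sumr; apply: eq_bigr => p _.
by rewrite (conjM (_%:C)) conjR mulrCA.
Qed.

Let cint_dir n x : cint (fun y => (\1_A y * dirichlet_sq n (x - y))%:C).
Proof.
under eq_fun do rewrite dirE.
by apply: cint_sum => p; apply: cintZ; exact: cintJ.
Qed.

Lemma integrable_fejer n x :
  mu.-integrable setT (EFin \o (fun y => \1_A y * dirichlet_sq n (x - y))).
Proof. exact: (cint_dir n x).1. Qed.

Lemma fejer_intE n x : (fejer_int n x)%:C = \sum_(p <- pairs n) E p x * (a p)^*.
Proof.
rewrite -cintegral_real; under eq_cintegral do rewrite dirE.
rewrite cintegral_sum; last by move=> p; apply: cintZ; exact: cintJ.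
by apply: eq_bigr => p _; rewrite cintegralZ ?cintegralJ//; exact: cintJ.
Qed.

Let outE n x : (\1_A x * fejer_int n x)%:C =
  \sum_(p <- pairs n) (a p)^* * ((\1_A x)%:C * E p x).
Proof.
rewrite realcM fejer_intE mulr_sumr; apply: eq_bigr => p _.
by rewrite mulrA mulrC.
Qed.

Lemma integrable_fejer_int n :
  mu.-integrable setT (EFin \o (fun x => \1_A x * fejer_int n x)).
Proof.
suff : cint (fun x => (\1_A x * fejer_int n x)%:C) by case.
under eq_fun do rewrite outE.
by apply: cint_sum => p; apply: cintZ.
Qed.

Lemma integral_fejer_int n : \int[mu]_x (\1_A x * fejer_int n x) =
  \sum_(p <- pairs n) nsq (a p).
Proof.
apply: (@complexI R); rewrite -cintegral_real.
under eq_cintegral do rewrite outE.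
rewrite cintegral_sum; last by move=> p; apply: cintZ.
rewrite rmorph_sum/=; apply: eq_bigr => p _.
by rewrite cintegralZ// mulrC nsqE.
Qed.

(** The pair [(j, l)] contributes the squared coefficient of frequency [j - l]. For fixed [j] these
    frequencies are distinct, so each of the [n] rows sums to at most [S]. *)
Lemma fejer_int_le n (S : R) :
  (\esum_(k in [set: int])
     (nsq (cintegral (fun x => (\1_A x)%:C * expi (k%:~R * x))))%:E <= S%:E)%E ->
  \int[mu]_x (\1_A x * fejer_int n x) <= n%:R * S.
Proof.
move=> hS; rewrite integral_fejer_int big_allpairs_dep/=.
have -> : n%:R * S = \sum_(j <- iota 0 n) S.
  by rewrite big_const_seq count_predT size_iota iter_addr_0 mulr_natl.
apply: ler_sum => j _.
rewrite -lee_fin; apply: le_trans hS.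
have -> : \sum_(l <- iota 0 n) nsq (a (j, l)) =
    \sum_(k <- [seq j%:Z - l%:Z | l <- iota 0 n])
      nsq (cintegral (fun x => (\1_A x)%:C * expi (k%:~R * x))).
  rewrite big_map; apply: eq_bigr => l _; congr nsq.
  by apply: eq_cintegral => x; rewrite E_expi.
apply: seq_le_esum => //; rewrite map_inj_uniq ?iota_uniq// => l l'.
by move=> /addrI/oppr_inj[].
Qed.

End on_set.

(** By orthogonality of the characters only the [n] diagonal pairs survive, each with weight
    [2 pi]. *)
Lemma fejer_int_period n (c x : R) :
  fejer_int `]c, c + 2 * pi] n x = 2 * pi * n%:R.
Proof.
have cd : c < c + 2 * pi by rewrite ltrDl mulr_gt0// pi_gt0.
have fI : (mu `]c, (c + 2 * pi)%R] < +oo)%E.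
  by rewrite mu_itv_oc ?ltry// ltW.
have ap j l : cintegral (fun y => (\1_(`]c, c + 2 * pi]) y)%:C * E (j, l) y) =
    if j == l then (2 * pi)%:C else 0.
  under eq_cintegral do rewrite E_expi/=.
  case: eqP => [->|/eqP jl].
    under eq_cintegral do rewrite subrr mul0r expi0 mulr1.
    rewrite cintegral_real Rintegral_indic// mu_itv_oc ?(ltW cd)//=.
    by rewrite [c + _]addrC addrK.
  by rewrite cintegral_expi_period// subr_eq0.
apply: (@complexI R); rewrite fejer_intE// big_allpairs_dep.
transitivity (\sum_(j <- iota 0 n) (2 * pi)%:C : R[i]).
  rewrite big_seq [RHS]big_seq; apply: eq_bigr => j jn.
  rewrite (bigD1_seq j)// ?iota_uniq// big1 ?addr0; last first.
    by move=> l lj; rewrite ap eq_sym (negbTE lj) conjc0 mulr0.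
  by rewrite ap eqxx conjR E_expi subrr mul0r expi0 mul1r Monoid.mulm1.
by rewrite big_const_seq count_predT size_iota iter_addr_0 [in RHS]mulr_natr rmorphMn.
Qed.

Lemma one_sub_cos_gt0 (d : R) : 0 < d <= pi -> 0 < 2 - 2 * cos d.
Proof.
move=> /andP[d0 dpi]; have : cos d < cos 0.
  by rewrite ltr_cos// in_itv/= ?lexx ?pi_ge0 ?(ltW d0).
by rewrite cos0; lra.
Qed.

(* For x well inside ]p, q], the Fejer kernel (D_n / n) has almost all of its
   mass within ]p, q]. *)
Lemma fejer_int_ge (c p q d x : R) n : 0 < d <= pi -> c <= p -> q <= c + 2 * pi ->
  p + d <= x <= q - d ->
  2 * pi * n%:R - 2 * pi * (4 / (2 - 2 * cos d)) <= fejer_int `]p, q] n x.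
Proof.
move=> hd cp qc /andP[px xq]; have k0 := one_sub_cos_gt0 hd.
have /andP[d0 dpi] := hd.
have cd : c < c + 2 * pi by rewrite ltrDl mulr_gt0// pi_gt0.
have fI : (mu `]c, (c + 2 * pi)%R] < +oo)%E.
  by rewrite mu_itv_oc ?ltry// ltW.
have pq : p < q by lra.
have fJ : (mu `]p, q] < +oo)%E.
  by rewrite mu_itv_oc ?ltry// ltW.
set B := 4 / _.
have iI := @integrable_fejer `]c, c + 2 * pi] (measurable_itv _) fI n x.
have iJ := @integrable_fejer `]p, q] (measurable_itv _) fJ n x.
have iB := @integrable_indic_fin `]c, c + 2 * pi] B (measurable_itv _) fI.
rewrite -(fejer_int_period n c x) lerBlDr.
have <- : \int[mu]_y (\1_(`]c, c + 2 * pi]) y * B) = 2 * pi * B.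
  by rewrite Rintegral_indicZ// mu_itv_oc ?(ltW cd)//= [c + _]addrC addrK.
rewrite -RintegralD//; apply: le_Rintegral => //.
  exact: (integrableD measurableT iJ iB).
have B0 : 0 <= B by rewrite divr_ge0// ltW.
move=> y _; rewrite !indicE !mem_setE !in_itv/=.
have D0 := dirichlet_sq_ge0 n (x - y).
case: (boolP (c < y <= c + 2 * pi)) => [/andP[cy yc]|yI]; last first.
  rewrite mul0r mul0r addr0; apply: mulr_ge0 => //.
case: (boolP (p < y <= q)) => [_|yJ]; first by rewrite !mul1r lerDl.
rewrite mul0r add0r !mul1r ler_pdivlMr//.
have [yp|py] := leP y p.
  by apply: dirichlet_sq_le => //; apply/andP; split; lra.
have qy : q < y by move: yJ; rewrite py/= -ltNge.
rewrite -dirichlet_sqN; apply: dirichlet_sq_le => //.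
by apply/andP; split; lra.
Qed.

(** The half of Parseval that Bessel does not give. The Fejer mean is bounded below on the interval
    shrunk by [d] at both ends, while its integral over the whole interval is at most [n S]; divide
    by [n], let [n] grow, then let [d] tend to 0. *)
Lemma esum_fourier_indic_itv (c p q S : R) : c <= p -> p < q -> q <= c + 2 * pi ->
  (\esum_(k in [set: int])
     (nsq (cintegral (fun x => (\1_(`]p, q]) x)%:C * expi (k%:~R * x))))%:E <= S%:E)%E ->
  2 * pi * (q - p) <= S.
Proof.
move=> cp pq qc hS.
have fJ : (mu `]p, q] < +oo)%E by rewrite mu_itv_oc ?ltry// ltW.
have pi0 := pi_gt0 R.
have main n d : 0 < d <= pi -> d < (q - p) / 2 ->
    (q - p - 2 * d) * (2 * pi * n%:R - 2 * pi * (4 / (2 - 2 * cos d))) <= n%:R * S.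
  move=> hd dpq; have /andP[d0 _] := hd.
  have pq' : p + d <= q - d by lra.
  have fJ' : (mu `](p + d)%R, (q - d)%R] < +oo)%E by rewrite mu_itv_oc ?ltry.
  apply: le_trans (fejer_int_le (measurable_itv _) fJ n hS).
  set B := 2 * pi * n%:R - _.
  have -> : (q - p - 2 * d) * B = \int[mu]_x (\1_(`]p + d, q - d]) x * B).
    by rewrite Rintegral_indicZ// mu_itv_oc//=; congr (_ * _); ring.
  apply: le_Rintegral => //.
  - exact: integrable_indic_fin.
  - exact: integrable_fejer_int.
  move=> x _; rewrite !indicE !mem_setE !in_itv/=.
  case: (boolP (p + d < x <= q - d)) => [/andP[px xq]|_]; last first.
    rewrite mul0r mulr_ge0//; apply: Rintegral_ge0 => y _.
    by rewrite mulr_ge0// dirichlet_sq_ge0.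
  have -> : p < x <= q by apply/andP; split; lra.
  by rewrite !mul1r (@fejer_int_ge c)// (ltW px).
(* Shrinking by [d <= t] costs [4 pi t]; the kernel mass outside the interval, [B <= t n], costs
   [2 pi (q - p) t] after division by [n]. *)
apply: (@ler_addgt0_scaled _ _ _ (4 * pi + 2 * pi * (q - p))).
  by rewrite addr_ge0// !mulr_ge0// ?subr_ge0 ltW.
move=> t t0.
pose d := Num.min t (Num.min pi ((q - p) / 4)).
have d0 : 0 < d by rewrite !lt_min t0 pi0/= divr_gt0// subr_gt0.
have dt : d <= t by rewrite ge_min lexx.
have dpi : d <= pi by rewrite !ge_min lexx orbT.
have dq : d <= (q - p) / 4 by rewrite !ge_min lexx !orbT.
have hd : 0 < d <= pi by rewrite d0.
have k0 := one_sub_cos_gt0 hd.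
have /(main (Num.bound (4 / (2 - 2 * cos d) / t)).+1 d hd) : d < (q - p) / 2 by lra.
set B := 4 / _; set n := (Num.bound _).+1.
have B0 : 0 <= B by rewrite divr_ge0// ltW.
have n0 : 0 < n%:R :> R by rewrite ltr0n.
have Bn : B <= t * n%:R.
  rewrite mulrC -ler_pdivrMr//; apply/ltW/(lt_le_trans (archi_boundP _)).
    by rewrite divr_ge0// ltW.
  by rewrite ler_nat.
move=> h; rewrite -(ler_pM2l n0).
have e1 : 0 <= (q - p) * pi * (t * n%:R - B).
  by rewrite !mulr_ge0 ?subr_ge0// ltW.
have e2 : 0 <= pi * n%:R * (t - d) by rewrite !mulr_ge0 ?subr_ge0// ltW.
have e3 : 0 <= d * pi * B by rewrite !mulr_ge0// ltW.
nra.
Qed.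

End dirichlet.

(** * Fourier series on one period: Parseval for all square-integrable functions *)

Section sqI_convergence.
Context {R : realType}.
Local Notation mu := (@lebesgue_measure R).

Lemma sqI_dominated (u : nat -> R -> R[i]) (f : R -> R[i]) : f \in sqint ->
  (forall m, cmeas (u m)) -> (forall m x, nsq (u m x) <= nsq (f x)) ->
  (forall x, nsq (u m x) @[m --> \oo] --> (0 : R)) ->
  (sqI (u m) @[m --> \oo] --> 0)%E.
Proof.
move=> fs mu_ uf u0.
have h1 : {ae mu, forall x, setT x ->
    ((nsq (u m x))%:E @[m --> \oo] --> (cst 0%E : R -> \bar R) x)}.
  by apply: aeW => x _; apply: cvg_EFin; [exact: nearW|exact: u0].
have h2 : {ae mu, forall x, forall m, setT x -> (`|(nsq (u m x))%:E| <= (nsq (f x))%:E)%E}.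
  by apply: aeW => x m _; rewrite gee0_abs ?lee_fin ?nsq_ge0.
have [_ _] := @dominated_convergence _ _ _ mu setT measurableT
  (fun m x => (nsq (u m x))%:E) (cst 0%E) (fun x => (nsq (f x))%:E) (fun m => measurable_nsqE (mu_ m)) (measurable_cst _) h1 (integrable_nsq fs) h2.
by rewrite integral_cst// mul0e.
Qed.

Lemma sqI_cvg0_ex (u : nat -> R -> R[i]) (t : R) : 0 < t ->
  (sqI (u m) @[m --> \oo] --> 0)%E -> exists m, fine (sqI (u m)) <= t.
Proof.
move=> t0 /fine_cvgP[_ /cvgrPdist_le/(_ t t0)[m _ /(_ m (leqnn m))]].
by rewrite sub0r normrN /= ger0_norm ?fine_ge0 ?sqI_ge0// => h; exists m.
Qed.

Lemma toL2_sum I (s : seq I) (F : I -> R -> R[i]) : (forall i, F i \in sqint) ->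
  toL2 (fun x => \sum_(i <- s) F i x) = \sum_(i <- s) toL2 (F i) /\
  (fun x => \sum_(i <- s) F i x) \in sqint.
Proof.
move=> Fs; elim: s => [|i s [IH1 IH2]].
  split; last first.
    by under eq_fun do rewrite big_nil; exact: (@rpred0 _ (@sqint R)).
  under eq_fun do rewrite big_nil.
  rewrite big_nil -[RHS](scale0r (toL2 (fun=> 0))) -toL2Z.
    by congr toL2; apply/funext => x; rewrite mul0r.
  exact: (@rpred0 _ (@sqint R)).
have e : (fun x => \sum_(i <- i :: s) F i x) = (fun x => F i x + \sum_(i <- s) F i x).
  by apply/funext => x; rewrite big_cons.
by rewrite e toL2D// big_cons IH1; split => //; exact: sqintD.
Qed.

End sqI_convergence.

Section fourier_series.
Context {R : realType}.
Local Notation mu := (@lebesgue_measure R).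
Variable c : R.

Let I : set R := `]c, c + 2 * pi].

Let mI : measurable I. Proof. exact: measurable_itv. Qed.

Let muI : mu I = (2 * pi)%:E.
Proof. by rewrite mu_itv_oc ?lerDl ?mulr_ge0 ?pi_ge0// [c + _]addrC addrK. Qed.

Let fI : (mu I < +oo)%E. Proof. by rewrite muI ltry. Qed.

Let fIS A : measurable A -> (mu (A `&` I) < +oo)%E.
Proof.
move=> mA; apply: le_lt_trans fI; apply: le_measure; rewrite ?inE//.
exact: measurableI.
Qed.

Let s : R := (Num.sqrt (2 * pi))^-1.

Let s2 : s ^+ 2 = (2 * pi)^-1.
Proof. by rewrite exprVn sqr_sqrtr// mulr_ge0 ?pi_ge0. Qed.

(** The exponent carries a minus sign so that pairing with [basis k] integrates [f x] against
    [expi (k x)]. *)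
Let basis (k : int) (x : R) : R[i] := s%:C * ((\1_I x)%:C * expi (- (k%:~R * x))).

Let basis_sqint k : basis k \in sqint.
Proof.
apply: sqint_scale; apply: sqint_indicM => //.
  under eq_fun do rewrite -mulNr.
  by apply: cmeas_expi; exact: measurable_mulr.
by move=> x; rewrite nsq_expi.
Qed.

Let e k : L2 R := toL2 (basis k).

Let cmeas_ex (k : int) : cmeas (fun x : R => expi (k%:~R * x)).
Proof. by apply: cmeas_expi; exact: measurable_mulr. Qed.

Let basisJ k x : (basis k x)^* = s%:C * ((\1_I x)%:C * expi (k%:~R * x)).
Proof. by rewrite /basis !conjM !conjR expiN conjcK. Qed.

Let cint_fI (f : R -> R[i]) k : f \in sqint ->
  cint (fun x => f x * ((\1_I x)%:C * expi (k%:~R * x))).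
Proof.
move=> fs; have h : (fun x => (\1_I x)%:C * expi (- (k%:~R * x))) \in sqint.
  apply: sqint_indicM => //; last by move=> x; rewrite nsq_expi.
  under eq_fun do rewrite -mulNr.
  by apply: cmeas_expi; exact: measurable_mulr.
have := cint_mulJ fs h.
by under eq_fun do rewrite conjM conjR expiN conjcK.
Qed.

Let ip_e f k : f \in sqint -> L2inner (toL2 f) (e k) =
  s%:C * cintegral (fun x => f x * ((\1_I x)%:C * expi (k%:~R * x))).
Proof.
move=> fs; rewrite L2inner_toL2// -cintegralZ; last exact: cint_fI.
by apply: eq_cintegral => x; rewrite basisJ mulrCA.
Qed.

Let indI x : (\1_I x)%:C * (\1_I x)%:C = (\1_I x)%:C :> R[i].
Proof. by rewrite -realcM indicE; case: (_ \in _); rewrite ?mulr1 ?mulr0. Qed.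

Let ortho k l : L2inner (e k) (e l) = (k == l)%:R.
Proof.
rewrite ip_e//.
have -> : cintegral (fun x => basis k x * ((\1_I x)%:C * expi (l%:~R * x))) =
    s%:C * cintegral (fun x => (\1_I x)%:C * expi ((l - k)%:~R * x)).
  rewrite -cintegralZ; last first.
    by apply: (cint_indic (C := 1)) => // x; rewrite nsq_expi expr1n.
  apply: eq_cintegral => x; rewrite /basis -mulrA; congr (_ * _).
  rewrite mulrACA indI -expiD; congr (_ * expi _).
  by rewrite rmorphB/= mulrBl addrC.
have [->|kl] := eqVneq k l.
  under eq_cintegral do rewrite subrr mul0r expi0 mulr1.
  rewrite cintegral_real Rintegral_indic// muI/= mulrA -!realcM -expr2 s2 mulVf//.
  by rewrite mulf_neq0// gt_eqF// pi_gt0.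
by rewrite cintegral_expi_period ?mulr0// subr_eq0 eq_sym.
Qed.

Let bessel x : (\esum_(k in setT) (nsq (L2inner x (e k)))%:E <= (nsqv L2inner x)%:E)%E.
Proof.
exact: (orthonormal_bessel L2innerDl L2innerZl L2innerC L2inner_ge0).
Qed.

Let parseval f := parseval_for L2inner setT e (toL2 f).

Let pD f g : f \in sqint -> g \in sqint -> parseval f -> parseval g ->
  parseval (fun x => f x + g x).
Proof.
move=> fs gs pf pg; rewrite /parseval toL2D//.
exact: (parsevalD L2innerDl L2innerZl L2innerC bessel).
Qed.

Let pZ (a : R[i]) f : f \in sqint -> parseval f -> parseval (fun x => a * f x).
Proof.
move=> fs pf; rewrite /parseval toL2Z//.
exact: (parsevalZ L2innerZl L2innerC).
Qed.

Let p_closed f : f \in sqint ->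
  (forall t, 0 < t -> exists g, [/\ g \in sqint, parseval g &
     fine (sqI (fun x => f x - g x)) <= t]) -> parseval f.
Proof.
move=> fs h.
apply: (parseval_closed L2innerDl L2innerZl L2innerC bessel).
move=> t /h[g [gs pg fg]]; exists (toL2 g); split => //.
by rewrite -toL2B// nsqv_toL2//; exact: sqintB.
Qed.

Let p0 : parseval (fun=> 0).
Proof.
have [h _] := @toL2_sum R void [::] (fun _ _ => 0) (fun i => match i with end).
rewrite /parseval (_ : (fun=> 0 : R[i]) = fun x : R => \sum_(i <- ([::] : seq void)) 0); last first.
  by apply/funext => x; rewrite big_nil.
by rewrite h; apply: (parseval_sum L2innerDl L2innerZl L2innerC bessel); case.
Qed.

Let ind (A : set R) x : R[i] := (\1_(A `&` I) x)%:C.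

Let ind_sqint A : measurable A -> ind A \in sqint.
Proof. by move=> mA; apply: sqint_indic; [exact: measurableI|exact: fIS]. Qed.

Let sqI_ind A : measurable A -> sqI (ind A) = mu (A `&` I).
Proof. by move=> mA; rewrite sqI_indic//; exact: measurableI. Qed.

(** Base case: the interval is first clipped to the period, then Bessel gives one inequality and the
    Fejer estimate the other. *)
Let p_itv a b : parseval (ind `]a, b]).
Proof.
have -> : ind `]a, b] = (fun x => (\1_(`]Num.max a c, Num.min b (c + 2 * pi)]) x)%:C).
  apply/funext => x; rewrite /ind /I !indicE in_setI !mem_setE !in_itv/=.
  by congr (_%:R%:C); rewrite gt_max le_min andbACA.
have [h|pq] := leP (Num.min b (c + 2 * pi)) (Num.max a c).
  rewrite set_itv_ge ?bnd_simp -?leNgt//.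
  under eq_fun do rewrite indicE in_set0.
  exact: p0.
set p := Num.max a c in pq *; set q := Num.min b _ in pq *.
have cp : c <= p by rewrite le_max lexx orbT.
have qc : q <= c + 2 * pi by rewrite ge_min lexx orbT.
have mJ : measurable (`]p, q] : set R) by exact: measurable_itv.
have fJ : (mu `]p, q] < +oo)%E by rewrite mu_itv_oc ?ltry// ltW.
have Js := sqint_indic mJ fJ.
apply/eqP; rewrite eq_le bessel/= nsqv_toL2// sqI_indic// mu_itv_oc ?(ltW pq)//=.
set T := (X in (_ <= X)%E).
have T0 : (0 <= T)%E by apply: esum_ge0 => k _; rewrite lee_fin nsq_ge0.
have Tfin : T \is a fin_num.
  by rewrite ge0_fin_numE//; apply: le_lt_trans (bessel _) (ltry _).
rewrite -(fineK Tfin) lee_fin -(@ler_pM2l _ (2 * pi)); last by rewrite mulr_gt0// pi_gt0.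
apply: (@esum_fourier_indic_itv _ c) => //.
rewrite EFinM fineK// -esumZl_real; last 2 first.
  by rewrite mulr_ge0// pi_ge0.
  by move=> k; exact: nsq_ge0.
apply: le_esum => k _; rewrite lee_fin ip_e// nsqM nsqR s2 mulrA divff ?mul1r.
  rewrite (_ : (fun x => _ * (_ * _)) = (fun x => (\1_(`]p, q]) x)%:C * expi (k%:~R * x)))//.
  apply/funext => x; rewrite mulrA -realcM; congr (_%:C * _).
  rewrite !indicE !mem_setE !in_itv/=.
  case: (boolP (p < x <= q)) => [/andP[px xq]|_]; last by rewrite mul0r.
  by rewrite (le_lt_trans cp px) (le_trans xq qc) mul1r.
by rewrite mulf_neq0// gt_eqF// pi_gt0.
Qed.

Let indU A B : A `&` B = set0 -> ind (A `|` B) = (fun x => ind A x + ind B x).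
Proof.
move=> AB; apply/funext => x; rewrite /ind -rmorphD/= !indicE !in_setI in_setU.
congr (_%:C); case: (boolP (x \in A)); case: (boolP (x \in B)); case: (x \in I) => //=;
  rewrite ?addr0 ?add0r// !inE => Bx Ax.
by have : (A `&` B) x by []; rewrite AB.
Qed.

Let p_indC A : measurable A -> parseval (ind A) -> parseval (ind (~` A)).
Proof.
move=> mA pA; have mAC := measurableC mA.
have pT : parseval (ind setT).
  rewrite (_ : ind setT = ind `]c, c + 2 * pi]); first exact: p_itv.
  by rewrite /ind setTI setIid.
have e1 : ind (~` A) = (fun x => ind setT x + (-1) * ind A x).
  by apply/funext => x; rewrite -(setUv A) indU ?setICr// mulN1r addrC addrA addNr add0r.
rewrite e1; apply: pD => //; first exact: ind_sqint.
  by apply: sqint_scale; exact: ind_sqint.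
by apply: pZ => //; exact: ind_sqint.
Qed.

(** The tails of the disjoint union have measure tending to 0 inside the period, so the finite
    partial sums converge in square mean. *)
Let p_ind_bigcup (F : nat -> set R) : (forall n, measurable (F n)) ->
  trivIset setT F -> (forall n, parseval (ind (F n))) ->
  parseval (ind (\bigcup_n F n)).
Proof.
move=> mF tF pF.
pose B m := \bigcup_(k in [set k | (m <= k)%N]) F k.
have mB m : measurable (B m) by apply: bigcup_measurable => k _.
have BS m : B m = F m `|` B m.+1.
  apply/seteqP; split => x.
    move=> [k /= mk Fkx]; move: mk; rewrite leq_eqVlt => /predU1P[->|mk]; first by left.
    by right; exists k.
  by move=> [Fx|[k /= mk Fkx]]; [exists m => /=|exists k => //=; exact: ltnW].
have FB m : F m `&` B m.+1 = set0.
  rewrite -subset0 => x [Fx [k /= mk Fkx]].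
  have : m = k by apply: tF => //; exists x.
  by move=> mk'; move: mk; rewrite mk' ltnn.
have -> : \bigcup_n F n = B 0.
  by apply/seteqP; split => x [k _ Fx]; exists k.
pose P m x : R[i] := \sum_(k <- iota 0 m) ind (F k) x.
have BP m : ind (B 0) = (fun x => P m x + ind (B m) x).
  elim: m => [|m IH]; first by apply/funext => x; rewrite /P big_nil add0r.
  apply/funext => x; rewrite IH BS indU// /P -addn1 iotaD big_cat/= big_seq1 add0n.
  by rewrite addn1 addrA.
have indF k : ind (F k) \in sqint by exact: ind_sqint.
have muB0 : (mu (B m `&` I) @[m --> \oo] --> 0)%E.
  rewrite -(measure0 mu) (_ : set0 = \bigcap_m (B m `&` I)).
    apply: nonincreasing_cvg_mu.
    - exact: fIS.
    - by move=> m; apply: measurableI; [exact: mB|exact: mI].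
    - by apply: bigcap_measurable => [|m _]; [by exists 0%N|apply: measurableI; [exact: mB|exact: mI]].
    - apply/nonincreasing_seqP => m; apply/subsetPset => x [[k /= mk Fkx] Ix].
      by split => //; exists k => //=; exact: ltnW.
  apply/esym; rewrite -subset0 => x xB.
  have [[k _ Fkx] _] := xB 0%N Logic.I.
  have [[l /= kl Flx] _] := xB k.+1 Logic.I.
  have : k = l by apply: tF => //; exists x.
  by move=> kl'; move: kl; rewrite kl' ltnn.
apply: p_closed; first exact: ind_sqint.
move=> t t0; have cvgB : (sqI (ind (B m)) @[m --> \oo] --> 0)%E.
  by under eq_fun do rewrite sqI_ind//.
have [m hm] := sqI_cvg0_ex t0 cvgB.
exists (P m); have [h1 h2] := toL2_sum (iota 0 m) indF; split => //.
  by rewrite /parseval h1; exact: (parseval_sum L2innerDl L2innerZl L2innerC bessel).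
rewrite (_ : (fun x => _) = ind (B m))//.
by apply/funext => x; rewrite (BP m) addrC addKr.
Qed.

(** Dynkin's theorem: half-open intervals form a generating pi-system, and the sets for which
    Parseval holds are closed under complements and countable disjoint unions. *)
Let p_ind A : measurable A -> parseval (ind A).
Proof.
move=> mA; apply: (@dynkin_induction _ _ (@ocitv R) (fun A => parseval (ind A)) _ _ _ _ _ _ A) => //.
- exact: ocitvI.
- rewrite (_ : ind setT = ind `]c, c + 2 * pi]); first exact: p_itv.
  by rewrite /ind setTI setIid.
- by move=> _ [[a b] _ <-]; exact: p_itv.
Qed.

Let p_nnsfun (g : {nnsfun R >-> R}) :
  parseval (fun x => (\1_I x * g x)%:C) /\ (fun x => (\1_I x * g x)%:C) \in sqint.
Proof.
have mg y : measurable (g @^-1` [set y]) by exact: measurable_sfunP.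
have e1 : (fun x => (\1_I x * g x)%:C) =
    (fun x => \sum_(y <- fset_set (range g)) y%:C * ind (g @^-1` [set y]) x).
  apply/funext => x; rewrite (fimfunE g) fsbig_finite//= mulr_sumr rmorph_sum/=.
  apply: eq_bigr => y _; rewrite /ind -realcM; congr (_%:C).
  by rewrite mulrCA; congr (_ * _); rewrite !indicE in_setI -natrM mulnb andbC.
have hs (y : R) : (fun x => y%:C * ind (g @^-1` [set y]) x) \in sqint.
  by apply: sqint_scale; exact: ind_sqint.
have [h1 h2] := toL2_sum (fset_set (range g)) hs.
rewrite e1; split => //; rewrite /parseval h1.
apply: (parseval_sum L2innerDl L2innerZl L2innerC bessel) => y.
by apply: pZ; [exact: ind_sqint|exact: p_ind].
Qed.

(** Increasing simple functions, cut off outside the period, converge in square mean by dominated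
    convergence: the differences lie between 0 and [f]. *)
Let p_nonneg (f : R -> R) : (fun x => (f x)%:C) \in sqint -> (forall x, 0 <= f x) ->
  (forall x, ~ I x -> f x = 0) -> parseval (fun x => (f x)%:C).
Proof.
move=> fs f0 fI0; have [mf _] := sqint_cmeas fs.
have mfE : measurable_fun setT (EFin \o f) by exact/measurable_EFinP.
have [g [ndg cvg_g]] := approximation measurableT mfE (fun x _ => f0 x).
have gcvg x : (g m : R -> R) x @[m --> \oo] --> f x.
  by have /fine_cvg := cvg_g x Logic.I.
have gf m x : g m x <= f x.
  rewrite -(cvg_lim _ (gcvg x))//; apply: nondecreasing_cvgn_le.
    by move=> i j ij; have /lefP := ndg _ _ ij; exact.
  by apply/cvg_ex; exists (f x); exact: gcvg.
pose u m x : R[i] := (f x - \1_I x * g m x)%:C.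
have cvg0 : (sqI (u m) @[m --> \oo] --> 0)%E.
  apply: (sqI_dominated fs).
  - move=> m; apply: cmeas_real; apply: measurable_funB => //.
    by apply: measurable_funM => //; exact: measurable_indic.
  - move=> m x; rewrite !nsqR ler_sqr ?nnegrE//.
      by rewrite lerBlDr lerDl mulr_ge0.
    rewrite subr_ge0 indicE; case: (_ \in _); by rewrite ?mul1r ?mul0r.
  - move=> x; under eq_fun do rewrite nsqR.
    rewrite (_ : 0 = (f x - \1_I x * f x) ^+ 2 :> R); last first.
      rewrite indicE; case: (boolP (x \in I)) => [_|]; first by rewrite mul1r subrr expr0n.
      by rewrite notin_setE => /fI0 ->; rewrite mulr0 subr0 expr0n.
    apply: (@cvg_comp _ _ _ (fun m => f x - \1_I x * g m x) (fun y => y ^+ 2) _ (nbhs (f x - \1_I x * f x))).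
      apply: cvgB; first exact: cvg_cst.
      by apply: cvgM; [exact: cvg_cst|exact: gcvg].
    exact: exprn_continuous.
apply: p_closed => // t t0; have [m hm] := sqI_cvg0_ex t0 cvg0.
have [h1 h2] := p_nnsfun (g m).
exists (fun x => (\1_I x * g m x)%:C); split => //.
by move: hm; rewrite /u; under eq_fun do rewrite rmorphB.
Qed.

Let p_real (f : R -> R) : (fun x => (f x)%:C) \in sqint ->
  (forall x, ~ I x -> f x = 0) -> parseval (fun x => (f x)%:C).
Proof.
move=> fs fI0; have [mf _] := sqint_cmeas fs.
have mp (h : R -> R) : measurable_fun setT h -> measurable_fun setT (fun x => Num.max (h x) 0).
  by move=> mh; apply: measurable_maxr => //; exact: measurable_cst.
have mf' : measurable_fun setT (fun x => - f x) by exact: measurable_funN.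
have sp : (fun x => (Num.max (f x) 0)%:C) \in sqint.
  apply: (sqint_le _ fs); first by apply: cmeas_real; exact: mp.
  by move=> x; rewrite !nsqR; case: (leP (f x) 0); rewrite ?expr0n ?sqr_ge0.
have sn : (fun x => (Num.max (- f x) 0)%:C) \in sqint.
  apply: (sqint_le _ fs); first by apply: cmeas_real; exact: mp.
  by move=> x; rewrite !nsqR; case: (leP (- f x) 0); rewrite ?expr0n ?sqr_ge0 ?sqrrN.
have e1 : (fun x => (f x)%:C) =
    (fun x => (Num.max (f x) 0)%:C + (-1) * (Num.max (- f x) 0)%:C) :> (R -> R[i]).
  apply/funext => x; rewrite mulN1r -rmorphB/=; congr (_%:C).
  by case: (leP (f x) 0); case: (leP (- f x) 0); lra.
rewrite e1; apply: pD => //; first exact: sqint_scale.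
  by apply: p_nonneg => // x; [rewrite le_max lexx orbT|move=> /fI0 ->; rewrite maxxx].
apply: pZ => //; apply: p_nonneg => // x; first by rewrite le_max lexx orbT.
by move=> /fI0 ->; rewrite oppr0 maxxx.
Qed.

Let p_all f : f \in sqint -> (forall x, ~ I x -> f x = 0) -> parseval f.
Proof.
move=> fs fI0; have [mr mi] := sqint_cmeas fs.
have sr : (fun x => (Re (f x))%:C) \in sqint.
  apply: (sqint_le _ fs); first exact: cmeas_real mr.
  by move=> x; rewrite nsqR lerDl sqr_ge0.
have si : (fun x => (Im (f x))%:C) \in sqint.
  apply: (sqint_le _ fs); first exact: cmeas_real mi.
  by move=> x; rewrite nsqR lerDr sqr_ge0.
have e1 : f = (fun x => (Re (f x))%:C + (0 +i* 1) * (Im (f x))%:C).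
  by apply/funext => x; case: (f x) => a b; simpc.
rewrite e1; apply: pD => //; first exact: sqint_scale.
  by apply: p_real => // x /fI0 ->.
by apply: pZ => //; apply: p_real => // x /fI0 ->.
Qed.

Theorem fourier_parseval f : f \in sqint ->
  (forall x, ~ (c < x <= c + 2 * pi) -> f x = 0) ->
  \esum_(k in [set: int]) (nsq (cintegral (fun x => f x * expi (k%:~R * x))))%:E =
  ((2 * pi)%:E * sqI f)%E.
Proof.
move=> fs fI0.
have fI0' x : ~ I x -> f x = 0 by rewrite /I/= in_itv/= => /fI0.
have := p_all fs fI0'; rewrite /parseval/parseval_for nsqv_toL2// fineK ?sqI_fin// => <-.
rewrite -esumZl_real; last 2 first.
  by rewrite mulr_ge0// pi_ge0.
  by move=> k; exact: nsq_ge0.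
apply: eq_esum => k _; rewrite ip_e// nsqM nsqR s2 mulrA divff ?mul1r; last first.
  by rewrite mulf_neq0// gt_eqF// pi_gt0.
congr (nsq _)%:E; apply: eq_cintegral => x; rewrite mulrA; congr (_ * _).
have [xI|xI] := pselect (I x); last by rewrite fI0'// mul0r.
by rewrite indicE mem_set// mulr1.
Qed.

End fourier_series.

(** * Exchanging countable sums and integrals *)

Section esum_integral.
Context {R : realType} d (T : measurableType d) (mu : {measure set T -> \bar R}).
Local Open Scope ereal_scope.

Lemma countable_set_bij (I : choiceType) (D : set I) : countable D -> D !=set0 ->
  exists (P : set nat) (e : nat -> I), set_bij P D e.
Proof.
move=> /countable_bijP[P DP] [i0 _].
pose I' : pointedType := HB.pack I (isPointed.Build I i0).
have /card_set_bijP[e be] : (P #= (D : set I'))%card by rewrite card_eq_sym.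
by exists P, e.
Qed.

Lemma esum_nneseries (I : choiceType) (P : set nat) (D : set I) (e : nat -> I)
  (a : I -> \bar R) : set_bij P D e -> (forall i, 0 <= a i) ->
  \esum_(i in D) a i = \sum_(n <oo) (if n \in P then a (e n) else 0).
Proof.
move=> be a0; rewrite (reindex_esum P D e)// -eseries_mkcond nneseries_esum//.
by congr esum; apply/seteqP; split => n /=; rewrite inE.
Qed.

(** Monotone convergence along an enumeration of [D]. Countability of [D] is essential: an
    uncountable supremum need not even be measurable. *)
Lemma integral_esum (I : choiceType) (D : set I) (f : I -> T -> \bar R) :
  countable D -> (forall i, measurable_fun setT (f i)) -> (forall i x, 0 <= f i x) ->
  measurable_fun setT (fun x => \esum_(i in D) f i x) /\
  \int[mu]_x (\esum_(i in D) f i x) = \esum_(i in D) \int[mu]_x f i x.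
Proof.
move=> cD mf f0; have [D0|/set0P/(countable_set_bij cD)[P [e be]]] := eqVneq D set0.
  have z (a : I -> \bar R) : \esum_(i in D) a i = 0 by rewrite D0 esum_set0.
  rewrite (_ : (fun x => _) = cst 0); last by apply/funext => x; exact: z.
  by rewrite z integral_cst// mul0e; split => //; exact: measurable_cst.
have mh n : measurable_fun setT (fun x => if n \in P then f (e n) x else 0).
  by case: (n \in P) => //; exact: measurable_cst.
have h0 n x : 0 <= (if n \in P then f (e n) x else 0) by case: (n \in P).
rewrite (_ : (fun x => \esum_(i in D) f i x) =
    fun x => \sum_(n <oo) (if n \in P then f (e n) x else 0)); last first.
  by apply/funext => x; rewrite (esum_nneseries be).
rewrite (esum_nneseries be); last by move=> i; exact: integral_ge0.
split.
  have := @ge0_emeasurable_sum _ _ _ setT (fun n x => if n \in P then f (e n) x else 0) xpredT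
    (fun k x _ _ => h0 k x) (fun k _ => mh k).
  exact.
rewrite integral_nneseries//; apply: eq_eseriesr => n _.
by case: (n \in P) => //; rewrite integral0.
Qed.

Lemma esum_one (I : choiceType) (i0 : I) (a : I -> \bar R) : 0 <= a i0 ->
  (forall i, i != i0 -> a i = 0) -> \esum_(i in [set: I]) a i = a i0.
Proof.
move=> a0 ai; rewrite -[RHS](esum_set1 a0) [RHS]esum_mkcond.
apply: eq_esum => i _; case: ifPn => //; rewrite notin_setE => /eqP; exact: ai.
Qed.

End esum_integral.

(** * Parseval and Bessel on intervals of other lengths *)

Section interval_lengths.
Context {R : realType}.
Local Notation mu := (@lebesgue_measure R).

Definition supp_in (a b : R) (f : R -> R[i]) := forall x, ~ (a < x <= b) -> f x = 0.

Lemma cint_supp a b f : f \in sqint -> supp_in a b f -> cint f.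
Proof.
move=> fs f0; have [ba|ab] := leP b a.
  rewrite (_ : f = fun=> 0); first exact: cint0.
  by apply/funext => x; apply: f0 => /andP[h1 h2]; lra.
have mI : measurable (`]a, b] : set R) by exact: measurable_itv.
have fI : (mu `]a, b] < +oo)%E by rewrite mu_itv_oc ?ltry// ltW.
have := cint_mulJ fs (sqint_indic mI fI).
rewrite (_ : (fun x => _) = f)//; apply/funext => x; rewrite conjR indicE mem_setE in_itv/=.
by case: (boolP (a < x <= b)) => [_|/negP/f0 ->]; rewrite ?mulr1 ?mul0r.
Qed.

Lemma sqint_expi (w : R) f : f \in sqint -> (fun x => f x * expi (w * x)) \in sqint.
Proof.
move=> fs; under eq_fun do rewrite mulrC; apply: sqintMl => //.
  by apply: cmeas_expi; exact: measurable_mulr.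
by move=> x; rewrite nsq_expi.
Qed.

Lemma supp_expi (w : R) a b f : supp_in a b f -> supp_in a b (fun x => f x * expi (w * x)).
Proof. by move=> f0 x /f0 ->; rewrite mul0r. Qed.

Lemma sqI_expi (w : R) f : sqI (fun x => f x * expi (w * x)) = sqI f.
Proof. by apply: eq_integral => x _; rewrite nsqM nsq_expi mulr1. Qed.

Lemma sqI_scale (w : R) (f : R -> R[i]) : 0 < w -> cmeas f ->
  (sqI (fun x => f (w * x)%R) = w^-1%:E * sqI f)%E.
Proof.
move=> w0 mf; rewrite /sqI -(ge0_integral_affine 0 w0 (g := fun x => (nsq (f x))%:E)).
- by under [in RHS]eq_integral do rewrite addr0.
- exact: measurable_nsqE.
- by move=> x; rewrite lee_fin nsq_ge0.
Qed.

Lemma fourier_parseval_scaled (c Q : R) f : 0 < Q -> f \in sqint ->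
  supp_in c (c + 2 * pi * Q) f ->
  \esum_(k in [set: int]) (nsq (cintegral (fun x => f x * expi (k%:~R / Q * x))))%:E =
  ((2 * pi * Q)%:E * sqI f)%E.
Proof.
move=> Q0 fs f0; have Qn0 : Q != 0 by rewrite gt_eqF.
have cf (k : int) : cint (fun x => f x * expi (k%:~R / Q * x)).
  exact: (cint_supp (sqint_expi (k%:~R / Q) fs) (supp_expi (k%:~R / Q) f0)).
have gs : (fun x => f (Q * x)) \in sqint.
  by have := sqint_affine 0 Q0 fs; under eq_fun do rewrite addr0.
have g0 x : ~ (c / Q < x <= c / Q + 2 * pi) -> f (Q * x) = 0.
  move=> h; apply: f0 => /andP[h1 h2]; apply: h; apply/andP; split.
    by rewrite ltr_pdivrMr// mulrC.
  rewrite -(ler_pM2l Q0) mulrDr mulrCA divff// mulr1; lra.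
have := fourier_parseval gs g0.
rewrite sqI_scale//; last exact: sqint_cmeas.
have e1 k : cintegral (fun x => f (Q * x) * expi (k%:~R * x)) =
    Q^-1%:C * cintegral (fun x => f x * expi (k%:~R / Q * x)).
  rewrite -(cintegral_affine 0 Q0 (cf k)); apply: eq_cintegral => x.
  by rewrite addr0 mulrA divfK.
under eq_esum do rewrite e1 nsqM nsqR.
rewrite esumZl_real ?sqr_ge0//; last by move=> k; exact: nsq_ge0.
move=> /(congr1 (fun x => (Q ^+ 2)%:E * x)%E).
rewrite muleA -EFinM exprVn divff ?expf_neq0// mul1e => ->.
by rewrite !muleA -!EFinM; congr (_%:E * _)%E; field.
Qed.

(** On an interval of length [2 pi Q] Parseval holds for the frequencies [k / Q]. The integers are
    the multiples of [Q] among the numerators, and dropping the other frequencies leaves an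
    inequality. *)
Lemma fourier_bessel_multi (c : R) (Q : nat) f : (0 < Q)%N -> f \in sqint ->
  supp_in c (c + 2 * pi * Q%:R) f ->
  (\esum_(k in [set: int]) (nsq (cintegral (fun x => f x * expi (k%:~R * x))))%:E <=
   (2 * pi * Q%:R)%:E * sqI f)%E.
Proof.
move=> Q0 fs f0; have Qp : 0 < Q%:R :> R by rewrite ltr0n.
rewrite -(fourier_parseval_scaled Qp fs f0).
set a := fun k : int => (nsq (cintegral (fun x => f x * expi (k%:~R / Q%:R * x))))%:E.
have -> : \esum_(k in [set: int]) (nsq (cintegral (fun x => f x * expi (k%:~R * x))))%:E =
    \esum_(k in [set: int]) a (k * Q%:Z).
  apply: eq_esum => k _; rewrite /a rmorphM/= -pmulrn mulfK//.
  by rewrite gt_eqF.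
rewrite -(esum_image setT (fun k : int => k * Q%:Z) a); last first.
  move=> k l _ _; apply: mulIf.
  by rewrite eqz_nat -lt0n.
rewrite esum_mkcond; apply: le_esum => k _.
by case: ifPn => // _; rewrite lee_fin nsq_ge0.
Qed.

End interval_lengths.

(** * Plancherel for functions of bounded support *)

Section fourier_bounded.
Context {R : realType}.
Local Notation mu := (@lebesgue_measure R).
Implicit Types (f g h : R -> R[i]).

Let s : R := (Num.sqrt (2 * pi))^-1.

Let s2 : s ^+ 2 = (2 * pi)^-1.
Proof. by rewrite exprVn sqr_sqrtr// mulr_ge0 ?pi_ge0. Qed.

(** Domination makes the integral continuous in the parameter. *)
Lemma measurable_param_integral (f : R -> R -> R) (g : R -> R) :
  (forall l, mu.-integrable setT (EFin \o f l)) ->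
  (forall x, continuous (f^~ x)) ->
  mu.-integrable setT (EFin \o g) ->
  (forall l x, `|f l x| <= g x) ->
  measurable_fun setT (fun l => \int[mu]_x f l x).
Proof.
move=> fi cf gi fg; apply: continuous_measurable_fun => l.
have := @continuity_under_integral R _ _ mu f setT measurableT (l - 1) (l + 1)
  (fun l _ => fi l) _ g gi _ l.
apply.
- by apply: aeW => x _ y _; exact: cf.
- by move=> x _; apply: aeW => y _; exact: fg.
- by rewrite inE/= in_itv/= ltrBlDr !ltrDl ltr01.
Qed.

Lemma cint_mul_expi f (w : R) : cint f -> cint (fun x => f x * expi (w * x)).
Proof.
move=> cf; have [fr fi] := cf; have [mr mi] := cint_cmeas cf.
have mex : cmeas (fun x : R => expi (w * x)) by apply: cmeas_expi; exact: measurable_mulr.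
apply: (@cint_le _ _ (fun x => `|Re (f x)| + `|Im (f x)|)).
- by apply: cmeasM => //; exact: cint_cmeas.
- have /= := integrableD measurableT (integrable_norm fr) (integrable_norm fi).
  exact.
- move=> x; rewrite nsqM nsq_expi mulr1 /nsq sqrrD !real_normK ?num_real//.
  by rewrite -addrA [_ *+ 2 + _]addrC addrA lerDl mulrn_wge0// mulr_ge0.
Qed.

Lemma cmeas_fourierL1 f : cint f -> cmeas (fourierL1 f).
Proof.
move=> cf; have [fr fi] := cf.
apply: cmeasM; first exact: cmeas_cst.
have g_int : mu.-integrable setT (EFin \o (fun x => `|Re (f x)| + `|Im (f x)|)).
  by have /= := integrableD measurableT (integrable_norm fr) (integrable_norm fi).
have fe l : cint (fun x => f x * expi (- (l * x))).
  by under eq_fun do rewrite -mulNr; exact: cint_mul_expi.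
have ccos x : continuous (fun l : R => cos (- (l * x))).
  move=> l; apply: (@continuous_comp _ _ _ (fun l : R => - (l * x)) cos).
    by apply: continuousN; exact: mulrr_continuous.
  exact: continuous_cos.
have csin x : continuous (fun l : R => sin (- (l * x))).
  move=> l; apply: (@continuous_comp _ _ _ (fun l : R => - (l * x)) sin).
    by apply: continuousN; exact: mulrr_continuous.
  exact: continuous_sin.
split.
- apply: (@measurable_param_integral (fun l x => Re (f x * expi (- (l * x)))) _ _ _ g_int).
  + by move=> l; case: (fe l).
  + move=> x l; rewrite (_ : (fun l => _) =
      fun l => Re (f x) * cos (- (l * x)) - Im (f x) * sin (- (l * x))); last first.
      by apply/funext => y; case: (f x).
    by apply: cvgB; apply: cvgM; try exact: cvg_cst; [exact: ccos|exact: csin].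
  + move=> l x; case: (f x) => a b /=.
    apply: (le_trans (ler_normB _ _)); rewrite !normrM; apply: lerD; apply: ler_piMr => //.
      exact: cos_max.
    exact: sin_max.
- apply: (@measurable_param_integral (fun l x => Im (f x * expi (- (l * x)))) _ _ _ g_int).
  + by move=> l; case: (fe l).
  + move=> x l; rewrite (_ : (fun l => _) =
      fun l => Re (f x) * sin (- (l * x)) + Im (f x) * cos (- (l * x))); last first.
      by apply/funext => y; case: (f x).
    by apply: cvgD; apply: cvgM; try exact: cvg_cst; [exact: csin|exact: ccos].
  + move=> l x; case: (f x) => a b /=.
    apply: (le_trans (ler_normD _ _)); rewrite !normrM; apply: lerD; apply: ler_piMr => //.
      exact: sin_max.
    exact: cos_max.
Qed.

Lemma fourierL1_shift f (w xi : R) :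
  fourierL1 f (xi - w) = fourierL1 (fun x => f x * expi (w * x)) xi.
Proof.
congr (_ * _); apply: eq_cintegral => x.
by rewrite mulrBl opprB expiD mulrA.
Qed.

(* Cutting the line into the intervals [ ]-k/Q, (1-k)/Q] ] reduces Plancherel to
   Parseval on a period [2 pi Q], integrated over one such interval. *)
Lemma plancherel_supp (c : R) (Q : nat) f : (0 < Q)%N -> f \in sqint ->
  supp_in c (c + 2 * pi * Q%:R) f -> sqI (fourierL1 f) = sqI f.
Proof.
move=> Q0 fs f0; have Qp : 0 < Q%:R :> R by rewrite ltr0n.
have Qn0 : Q%:R != 0 :> R by rewrite gt_eqF.
have cf := cint_supp fs f0.
pose G (xi : R) := nsq (fourierL1 f xi).
have mG : measurable_fun setT (EFin \o G) by exact: measurable_nsqE (cmeas_fourierL1 cf).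
have G0 xi : 0 <= G xi by exact: nsq_ge0.
pose A : set R := `]0, Q%:R^-1]%classic.
have mA : measurable A by exact: measurable_itv.
pose sh (k : int) (xi : R) : R := 1 * xi + - (k%:~R / Q%:R).
have msh k : measurable_fun setT (sh k) by exact: measurable_affine.
have mindA : measurable_fun setT (fun x : R => \1_A x : R) by exact: measurable_indic.
pose a1 (k : int) (xi : R) : \bar R := (\1_A (1 * xi + (k%:~R / Q%:R)) * G xi)%:E.
pose a2 (k : int) (xi : R) : \bar R := (\1_A xi * G (sh k xi))%:E.
have ma1 k : measurable_fun setT (a1 k).
  apply/measurable_EFinP; apply: measurable_funM.
    exact: (measurableT_comp mindA (measurable_affine 1 (k%:~R / Q%:R))).
  exact/measurable_EFinP.
have ma2 k : measurable_fun setT (a2 k).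
  apply/measurable_EFinP; apply: measurable_funM => //.
  by apply/measurable_EFinP; exact: (measurableT_comp mG (msh k)).
have a10 k xi : (0 <= a1 k xi)%E by rewrite lee_fin mulr_ge0.
have a20 k xi : (0 <= a2 k xi)%E by rewrite lee_fin mulr_ge0.
have a12 k : (\int[mu]_xi a1 k xi = \int[mu]_xi a2 k xi)%E.
  have := ge0_integral_affine (- (k%:~R / Q%:R)) (@ltr01 R) (ma1 k) (a10 k).
  rewrite invr1 mul1e => <-; apply: eq_integral => xi _.
  by rewrite /a1 /a2 /sh !mul1r subrK.
have cZ : countable [set: int] by exact: countableP.
have e1 : sqI (fourierL1 f) = (\int[mu]_xi (\esum_(k in [set: int]) a1 k xi))%E.
  apply: eq_integral => xi _.
  (* The translates of [A] tile the line: exactly this [k] puts [xi + k / Q] into the half-open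
     interval [A]. *)
  pose k0 : int := 1 - Num.ceil (Q%:R * xi).
  have h0 (k : int) : (\1_A (1 * xi + k%:~R / Q%:R) : R) = (k == k0)%:R.
    rewrite indicE mem_setE in_itv/= mul1r; congr (_%:R); congr nat_of_bool.
    rewrite -(ltr_pM2l Qp) -[X in _ && X](ler_pM2l Qp) mulr0 mulfV// mulrDr mulrCA mulfV// mulr1.
    apply/idP/eqP => [/andP[h1 h2]|->].
      apply/eqP; rewrite /k0 eq_sym subr_eq addrC -subr_eq eq_sym; apply/eqP.
      by apply: ceil_def; rewrite !rmorphB/=; apply/andP; split; lra.
    rewrite /k0 rmorphB/=; have /andP[h1 h2] := ceil_itv (Q%:R * xi).
    by rewrite rmorphB/= in h1; apply/andP; split; lra.
  rewrite (esum_one (i0 := k0))//.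
    by rewrite /a1 h0 eqxx mul1r.
  by move=> k kk0; rewrite /a1 h0 (negbTE kk0) mul0r.
(* Evaluating the transform at [xi - k / Q] gives, up to normalisation, the k-th coefficient of [f]
   modulated by [- xi], and modulation preserves the squared norm. *)
have e2 xi : (\esum_(k in [set: int]) a2 k xi = (\1_A xi * Q%:R)%:E * sqI f)%E.
  have hs := sqint_expi (- xi) fs.
  have := fourier_parseval_scaled Qp hs (supp_expi (- xi) f0).
  rewrite sqI_expi => h.
  have -> : (\esum_(k in [set: int]) a2 k xi = \esum_(k in [set: int])
      ((\1_A xi * (2 * pi)^-1) * nsq (cintegral (fun x => f x * expi (- xi * x) * expi (k%:~R / Q%:R * x))))%:E)%E.
    apply: eq_esum => k _; rewrite /a2 /sh /G mul1r fourierL1_shift nsqM nsqR s2 mulrA.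
    congr (_ * nsq _)%:E; apply: eq_cintegral => x; rewrite -mulrA [expi _ * _]mulrC mulrA.
    by rewrite mulNr.
  rewrite esumZl_real; last 2 first.
    by rewrite mulr_ge0// invr_ge0 mulr_ge0// pi_ge0.
    by move=> k; exact: nsq_ge0.
  rewrite h muleA -EFinM; congr (_%:E * _)%E.
  have pn0 : 2 * pi != 0 :> R by rewrite mulf_neq0// gt_eqF// pi_gt0.
  by rewrite -[LHS]mulrA; congr (_ * _); rewrite mulKf.
have [_] := integral_esum mu cZ ma1 a10; rewrite -e1 => ->.
under eq_esum do rewrite a12.
have [_ <-] := integral_esum mu cZ ma2 a20.
under eq_integral do rewrite e2.
have Ifin := sqI_fin fs.
have mAQ : measurable_fun setT (fun x : R => (\1_A x * Q%:R)%:E : \bar R).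
  by apply/measurable_EFinP; apply: measurable_funM => //; exact: measurable_cst.
have AQ0 (x : R) : setT x -> (0 <= (\1_A x * Q%:R)%:E :> \bar R)%E.
  by move=> _; rewrite lee_fin mulr_ge0.
rewrite (ge0_integralZr mu measurableT mAQ AQ0 (sqI_ge0 f)).
have -> : (\int[mu]_x (\1_A x * Q%:R)%:E = 1)%E.
  under eq_integral do rewrite mulrC EFinM.
  rewrite ge0_integralZl//; last exact/measurable_EFinP.
  have muA : mu A = (Q%:R^-1)%:E.
    by rewrite [LHS]mu_itv_oc ?subr0// invr_ge0 ltW.
  by rewrite integral_indic// setIT -[RHS](_ : Q%:R%:E * mu A = 1)%E// muA -EFinM mulfV.
by rewrite mul1e.
Qed.

End fourier_bounded.

(** * Completeness of the square-integrable functions *)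

Section riesz_fischer.
Context {R : realType}.
Local Notation mu := (@lebesgue_measure R).
Implicit Types (u : nat -> R -> R[i]).

Lemma ImN (z : R[i]) : Im (- z) = - Im z. Proof. by case: z. Qed.

Lemma cmeasB (f g : R -> R[i]) : cmeas f -> cmeas g -> cmeas (fun x => f x - g x).
Proof.
move=> mf mg; under eq_fun do rewrite -mulN1r.
by apply: cmeasD => //; apply: cmeasM => //; exact: cmeas_cst.
Qed.

(** The weights turn square summability of the increments into absolute summability: twice an
    increment is at most [2^-j] plus [2^j] times its square. Summed and halved, this gives the bound
    [1 + C / 2]. *)
Lemma cvg_of_weighted_sqr (v : nat -> R) (d : nat -> R) (C : R) :
  (forall j, (v j.+1 - v j) ^+ 2 <= d j) ->
  (forall J, \sum_(0 <= j < J) 2 ^+ j * d j <= C) ->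
  cvgn v.
Proof.
move=> vd dC.
have -> : v = (fun n => v 0%N + series (telescope v) n).
  by apply/funext => n; rewrite -eq_sum_telescope.
apply: is_cvgD; first exact: is_cvg_cst.
apply: normed_cvg; apply: nondecreasing_is_cvgn.
  by apply: nondecreasing_series => n _ _; exact: normr_ge0.
exists (1 + C / 2) => _ [J _ <-].
have geo K : \sum_(0 <= j < K) (2 ^+ j)^-1 <= 2 :> R.
  have -> : \sum_(0 <= j < K) (2 ^+ j)^-1 = 2 - 2 * (2 ^+ K)^-1 :> R.
    elim: K => [|K IH]; first by rewrite big_nil expr0 invr1 mulr1 subrr.
    rewrite big_nat_recr//= IH exprS invfM; field.
    by rewrite expf_neq0.
  by rewrite gerBl mulr_ge0// invr_ge0 exprn_ge0.
have /= := dC J.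
rewrite /series/=.
have h j : `|telescope v j| <= (2 ^+ j)^-1 / 2 + 2 ^+ j * d j / 2.
  have p0 : 0 < 2 ^+ j :> R by rewrite exprn_gt0.
  have := vd j; rewrite /telescope -(real_normK (num_real (v j.+1 - v j))).
  set y := `|_| => yd.
  have h1 : 0 <= (2 ^+ j)^-1 * (1 - 2 ^+ j * y) ^+ 2.
    by rewrite mulr_ge0 ?sqr_ge0// invr_ge0 ltW.
  have e1 : (2 ^+ j)^-1 * (1 - 2 ^+ j * y) ^+ 2 = (2 ^+ j)^-1 - 2 * y + 2 ^+ j * y ^+ 2.
    by field; rewrite gt_eqF.
  have := ler_wpM2l (ltW p0) yd; lra.
move=> hC; apply: (@le_trans _ _ (\sum_(0 <= j < J) ((2 ^+ j)^-1 / 2 + 2 ^+ j * d j / 2))).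
  by apply: ler_sum => j _; exact: h.
rewrite big_split/= -!mulr_suml; have := geo J; lra.
Qed.

(** Fatou's lemma; a bound from index [J] on is enough, since the lower limit ignores the first
    terms. *)
Lemma sqI_limn_le (f : R -> R[i]) (w : nat -> R -> R[i]) (t : R) (J : nat) :
  (forall j, cmeas (w j)) ->
  (forall x, nsq (w j x) @[j --> \oo] --> nsq (f x)) ->
  (forall j, (J <= j)%N -> (sqI (w j) <= t%:E)%E) ->
  (sqI f <= t%:E)%E.
Proof.
move=> mw wf wt.
have := fatou mu measurableT (fun j => measurable_nsqE (mw j))
  (fun j x _ => (_ : (0 <= (nsq (w j x))%:E)%E)).
have e1 : (\int[mu]_x limn_einf (fun j => (nsq (w j x))%:E) = sqI f)%E.
  apply: eq_integral => x _.
  have h : (nsq (w j x))%:E @[j --> \oo] --> (nsq (f x))%:E.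
    by apply: cvg_EFin; [exact: nearW|exact: wf].
  by have [-> _] := cvg_limn_einf_sup h.
rewrite e1 => h; apply: le_trans (h _) _.
  by move=> j x; rewrite lee_fin nsq_ge0.
rewrite limn_einf_lim; apply: lime_le; first exact: is_cvg_einfs.
apply: nearW => k; apply: (@le_trans _ _ (sqI (w (maxn k J)))).
  by apply: ereal_inf_lbound; exists (maxn k J) => //=; exact: leq_maxl.
by apply: wt; exact: leq_maxr.
Qed.

(** Riesz-Fischer: a fast subsequence converges almost everywhere, and Fatou applied to [u m - v j]
    as [j] grows upgrades this to convergence of the whole sequence in square mean. *)
Theorem sqint_complete u : (forall m, u m \in sqint) ->
  (forall t, 0 < t -> exists M, forall m l, (M <= m)%N -> (M <= l)%N ->
     (sqI (fun x => u m x - u l x)%R <= t%:E)%E) ->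
  exists F, F \in sqint /\ (sqI (fun x => u m x - F x)%R @[m --> \oo] --> 0)%E.
Proof.
move=> us uC.
(* The first factor cancels the weight [2^j]; the second is the summable sequence of
   [epsilon_trick0]. *)
pose e j : R := (2 ^+ j)^-1 * (1 / (2 ^ j.+1)%:R).
have e0 j : 0 < e j.
  by rewrite mulr_gt0// ?invr_gt0 ?exprn_gt0// divr_gt0// ltr0n expn_gt0.
have /choice[M HM] j := uC _ (e0 j).
(* The maximum dominates all earlier thresholds and makes [n] monotone; adding [j] ensures
   [n j >= j]. *)
pose n j := (j + \max_(i < j.+1) M i)%N.
have Mn j : (M j <= n j)%N.
  apply: leq_trans (leq_addl _ _).
  by rewrite big_ord_recr/= leq_maxr.
have nS j : (n j <= n j.+1)%N.
  by rewrite /n [in leqRHS]big_ord_recr/= leq_add// leq_maxl.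
have nM J j : (J <= j)%N -> (M J <= n j)%N.
  move=> /subnK <-; elim: (j - J)%N => [|k IH]; first exact: Mn.
  by rewrite addSn (leq_trans IH).
pose v j := u (n j).
have vs j : v j \in sqint by exact: us.
pose d j x := nsq (v j.+1 x - v j x).
have md j : measurable_fun setT (fun x => (2 ^+ j * d j x)%:E : \bar R).
  apply/measurable_EFinP; apply: measurable_funM; first exact: measurable_cst.
  by apply: measurable_nsq; apply: sqint_cmeas; exact: sqintB.
have d0 j x : (0 <= (2 ^+ j * d j x)%:E :> \bar R)%E.
  by rewrite lee_fin mulr_ge0 ?exprn_ge0 ?nsq_ge0.
pose S x : \bar R := (\sum_(j <oo) (2 ^+ j * d j x)%:E)%E.
have S0 x : (0 <= S x)%E by apply: nneseries_ge0 => j _ _; exact: d0.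
have mS : measurable_fun setT S.
  exact: (@ge0_emeasurable_sum _ _ _ setT (fun j x => (2 ^+ j * d j x)%:E) xpredT
    (fun k x _ _ => d0 k x) (fun k _ => md k)).
have iS : mu.-integrable setT S.
  apply/integrableP; split => //.
  under eq_integral do rewrite gee0_abs//.
  rewrite /S integral_nneseries//.
  apply: (@le_lt_trans _ _ (1%:E : \bar R)%E); last exact: ltry.
  apply: le_trans (epsilon_trick0 xpredT (ler01 : (0 <= 1 :> R)%R)).
  apply: lee_nneseries => [j _ _|j _]; first by apply: integral_ge0 => x _; exact: d0.
  have -> : (\int[mu]_x (2 ^+ j * d j x)%:E = (2 ^+ j)%:E * sqI (fun x => v j.+1 x - v j x)%R)%E.
    have md' : measurable_fun setT (fun x => (d j x)%:E).
      by apply: measurable_nsqE; apply: sqint_cmeas; exact: sqintB.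
    have p0 : (0 <= (2 ^+ j)%:E :> \bar R)%E by rewrite lee_fin exprn_ge0.
    by rewrite /sqI -(ge0_integralZl mu measurableT md')// => x _; rewrite lee_fin nsq_ge0.
  have p0 : 0 < 2 ^+ j :> R by rewrite exprn_gt0.
  apply: (@le_trans _ _ ((2 ^+ j)%:E * (e j)%:E)%E).
    by apply: lee_wpmul2l; [rewrite lee_fin ltW|apply: HM; rewrite ?nM// (leq_trans (Mn j))].
  by rewrite -EFinM /e mulVKf// gt_eqF.
have [N [mN N0 SN]] := integrable_ae measurableT iS.
(* Setting the subsequence to 0 on the null set [N] makes it converge everywhere, so that its limit
   [F] is measurable. *)
pose w j x := (\1_(~` N) x)%:C * v j x.
have mw j : cmeas (w j).
  by apply: cmeas_indic; [exact: measurableC|exact: sqint_cmeas].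
have wv : {ae mu, forall x, forall j, w j x = v j x}.
  exists N; split => // x /= h; apply: contrapT => Nx; apply: h => j.
  by rewrite /w indicE mem_set// mul1r.
have cvg_w x : cvgn (fun j => Re (w j x)) /\ cvgn (fun j => Im (w j x)).
  have [Nx|Nx] := pselect (N x).
    have w0 j : w j x = 0 by rewrite /w indicE memNset ?mul0r//; exact.
    by split; under eq_fun do rewrite w0; exact: is_cvg_cst.
  have Sfin : S x \is a fin_num by apply: contrapT => h; apply: Nx; apply: SN => /(_ Logic.I).
  have wE j : w j x = v j x by rewrite /w indicE mem_set// mul1r.
  have bound J : \sum_(0 <= j < J) 2 ^+ j * d j x <= fine (S x).
    rewrite -lee_fin fineK// -sumEFin; apply: nneseries_lim_ge => j _ _; exact: d0.
  split; apply: (@cvg_of_weighted_sqr _ (d^~ x) (fine (S x))) => // j; rewrite !wE /d /nsq.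
    by rewrite ReD ReN lerDl sqr_ge0.
  by case: (v j.+1 x) (v j x) => a b [a' b'] /=; rewrite lerDr sqr_ge0.
pose F x : R[i] := limn (fun j => Re (w j x)) +i* limn (fun j => Im (w j x)).
have mF : cmeas F.
  by split; [apply: (measurable_fun_cvg (fun j => (mw j).1))|
             apply: (measurable_fun_cvg (fun j => (mw j).2))] => x _;
     [exact: (cvg_w x).1|exact: (cvg_w x).2].
have key t : 0 < t -> exists M, forall m, (M <= m)%N -> (sqI (fun x => u m x - F x)%R <= t%:E)%E.
  move=> t0; have [M' HM'] := uC _ t0.
  exists M' => m Mm.
  apply: (@sqI_limn_le _ (fun j x => u m x - w j x) _ M').
  - by move=> j; apply: cmeasB; [exact: sqint_cmeas (us m)|exact: mw].
  - move=> x; rewrite /nsq.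
    have cr : Re (u m x - w j x) @[j --> \oo] --> Re (u m x - F x).
      under eq_fun do rewrite ReD ReN; rewrite ReD ReN.
      by apply: cvgB; [exact: cvg_cst|exact: (cvg_w x).1].
    have ci : Im (u m x - w j x) @[j --> \oo] --> Im (u m x - F x).
      under eq_fun do rewrite ImD ImN; rewrite ImD ImN.
      by apply: cvgB; [exact: cvg_cst|exact: (cvg_w x).2].
    by rewrite !expr2; under eq_fun do rewrite !expr2; apply: cvgD; apply: cvgM.
  - move=> j Mj; have nM' : (M' <= n j)%N by apply: leq_trans Mj _; exact: leq_addr.
    apply: le_trans (HM' m (n j) Mm nM').
    rewrite (@ae_eq_sqI _ _ (fun x => u m x - v j x))//.
    + by apply: cmeasB; [exact: sqint_cmeas (us m)|exact: mw].
    + by apply: cmeasB; [exact: sqint_cmeas (us m)|exact: sqint_cmeas (vs j)].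
    + by apply: (filterS (F := almost_everywhere mu)) wv => x /= h _; rewrite h.
have mD m : cmeas (fun x => u m x - F x).
  by apply: cmeasB; [exact: sqint_cmeas (us m)|exact: mF].
have Fs : F \in sqint.
  have [m /(_ m (leqnn m)) hm] := key 1 ltr01.
  have h : (fun x => u m x - F x) \in sqint.
    by apply/sqintP; split => //; exact: le_lt_trans hm (ltry _).
  rewrite (_ : F = fun x => u m x - (u m x - F x)); first exact: sqintB.
  by apply/funext => x; rewrite opprB addrC subrK.
exists F; split => //; apply/fine_cvgP; split.
  by apply: nearW => m; apply: sqI_fin; exact: sqintB.
apply/cvgrPdist_le => t t0; have [m Hm] := key t t0.
exists m => // k /= mk; rewrite sub0r normrN ger0_norm ?fine_ge0 ?sqI_ge0//.
by rewrite -lee_fin fineK ?Hm//; apply: sqI_fin; exact: sqintB.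
Qed.

End riesz_fischer.

(** * Existence of the Fourier transform on [L2] *)

Section fourier_existence.
Context {R : realType}.
Local Notation mu := (@lebesgue_measure R).
Implicit Types (f g h : R -> R[i]) (phi : L2 R).

Lemma sqID_le f g : cmeas f -> cmeas g ->
  (sqI (fun x => f x + g x)%R <= 2%:E * sqI f + 2%:E * sqI g)%E.
Proof.
move=> mf mg.
have m2 h : cmeas h -> measurable_fun setT (fun x => (2 * nsq (h x))%:E : \bar R).
  by move=> mh; apply/measurable_EFinP; apply: measurable_funM => //; exact: measurable_nsq.
have p2 h x : (0 <= (2 * nsq (h x))%:E :> \bar R)%E by rewrite lee_fin mulr_ge0 ?nsq_ge0.
have e2 h : cmeas h -> (2%:E * sqI h = \int[mu]_x (2 * nsq (h x))%:E)%E.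
  move=> mh; rewrite /sqI -(ge0_integralZl mu measurableT (measurable_nsqE mh))//.
  by move=> x _; rewrite lee_fin nsq_ge0.
rewrite !e2// -ge0_integralD//; [|exact: m2|exact: m2].
apply: ge0_le_integral => //.
- by move=> x _; rewrite lee_fin nsq_ge0.
- by apply: measurable_nsqE; exact: cmeasD.
- by apply: emeasurable_funD; exact: m2.
- by move=> x _; rewrite -EFinD lee_fin nsqD_le.
Qed.

Lemma supp_in_sub (a b a' b' : R) f : a' <= a -> b <= b' -> supp_in a b f -> supp_in a' b' f.
Proof.
move=> aa bb f0 x h; apply: f0 => /andP[h1 h2]; apply: h.
by rewrite (le_lt_trans aa h1) (le_trans h2 bb).
Qed.

Lemma fourierL1B f g xi : cint f -> cint g ->
  fourierL1 (fun x => f x - g x) xi = fourierL1 f xi - fourierL1 g xi.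
Proof.
move=> cf cg; rewrite /fourierL1 -mulrBr; congr (_ * _).
have ce k : cint k -> cint (fun x => k x * expi (- (xi * x))).
  by move=> ck; under eq_fun do rewrite -mulNr; exact: cint_mul_expi.
rewrite -[X in _ = _ + X]mulN1r -(cintegralZ _ (ce _ cg)).
rewrite -(cintegralD (ce _ cf) (cintZ _ (ce _ cg))).
by apply: eq_cintegral => x; rewrite mulrBl mulN1r.
Qed.

Lemma fourierL1_ae f g xi : cmeas f -> cmeas g -> f = g %[ae mu] ->
  fourierL1 f xi = fourierL1 g xi.
Proof.
move=> mf mg fg; congr (_ * _).
have mex : cmeas (fun x : R => expi (- (xi * x))).
  by under eq_fun do rewrite -mulNr; apply: cmeas_expi; exact: measurable_mulr.
apply: ae_eq_cintegral; [exact: cmeasM|exact: cmeasM|].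
by apply: (filterS (F := almost_everywhere mu)) fg => x /= e _; rewrite e.
Qed.

Lemma ae_eq_cint f g : cmeas f -> cint g -> f = g %[ae mu] -> cint f.
Proof.
move=> [fr fi] cg fg; have [gr gi] := cg; have [mgr mgi] := cint_cmeas cg.
split; apply/integrableP; split; try exact/measurable_EFinP.
  have /integrableP[_] := gr; apply: le_lt_trans; rewrite le_eqVlt; apply/orP; left; apply/eqP.
  apply: ae_eq_integral => //; try (apply: measurableT_comp => //; exact/measurable_EFinP).
  by apply: (filterS (F := almost_everywhere mu)) fg => x /= e _; rewrite e.
have /integrableP[_] := gi; apply: le_lt_trans; rewrite le_eqVlt; apply/orP; left; apply/eqP.
apply: ae_eq_integral => //; try (apply: measurableT_comp => //; exact/measurable_EFinP).
by apply: (filterS (F := almost_everywhere mu)) fg => x /= e _; rewrite e.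
Qed.

Lemma normc_le (z : R[i]) : normc z <= `|Re z| + `|Im z|.
Proof.
rewrite -(@ler_pXn2r _ 2)// ?nnegrE ?addr_ge0 ?sqrtr_ge0//; last by case: z => a b; exact: sqrtr_ge0.
rewrite normc_sq sqrrD /nsq !real_normK ?num_real//.
by rewrite -addrA [_ *+ 2 + _]addrC addrA lerDl mulrn_wge0// mulr_ge0.
Qed.

Lemma normc_ge0' (z : R[i]) : 0 <= normc z.
Proof. by case: z => a b; exact: sqrtr_ge0. Qed.

Lemma measurable_normc f : cmeas f -> measurable_fun setT (fun x => normc (f x)).
Proof.
move=> mf; rewrite (_ : (fun x => _) = Num.sqrt \o (fun x => nsq (f x))).
  apply: measurableT_comp; last exact: measurable_nsq.
  by apply: continuous_measurable_fun; exact: sqrt_continuous.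
by apply/funext => x /=; rewrite -normc_sq sqrtr_sqr ger0_norm// normc_ge0'.
Qed.

Lemma cint_normc f : cmeas f ->
  cint f <-> mu.-integrable setT (fun x => (normc (f x))%:E).
Proof.
move=> mf; split => [[fr fi]|fn].
  have h := integrableD measurableT (integrable_norm fr) (integrable_norm fi).
  apply: (le_integrable measurableT _ _ h).
    by apply/measurable_EFinP; exact: measurable_normc.
  move=> x _ /=; rewrite lee_fin [leLHS]ger0_norm ?normc_ge0'// [leRHS]ger0_norm ?addr_ge0//.
  exact: normc_le.
apply: (cint_le mf fn) => x.
by rewrite normc_sq.
Qed.

Lemma L2norm_toL2B f g : f \in sqint -> g \in sqint ->
  L2norm (toL2 f - toL2 g) = Num.sqrt (fine (sqI (fun x => f x - g x))).
Proof.
move=> fs gs; rewrite -toL2B// -nsqv_toL2; last exact: sqintB.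
by rewrite -L2norm_sq sqrtr_sqr ger0_norm// sqrtr_ge0.
Qed.

Lemma L2norm_cvg0 (u : nat -> R -> R[i]) f : (forall m, u m \in sqint) -> f \in sqint ->
  (sqI (fun x => u m x - f x)%R @[m --> \oo] --> 0)%E ->
  L2norm (toL2 (u m) - toL2 f) @[m --> \oo] --> 0.
Proof.
move=> us fs /fine_cvgP[_ h]; under eq_fun do rewrite L2norm_toL2B//.
rewrite -(@sqrtr0 R); apply: (@cvg_comp _ _ _ _ Num.sqrt _ (nbhs (0 : R))); first exact: h.
exact: sqrt_continuous.
Qed.

(** The cut-off interval has length [2 pi (m + 1)], the integer multiple of [2 pi] that Plancherel
    for bounded support expects. *)
Let tr f (m : nat) (x : R) : R[i] :=
  (\1_(`]- (pi * m.+1%:R), pi * m.+1%:R]) x)%:C * f x.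

Let tr_sqint f m : f \in sqint -> tr f m \in sqint.
Proof.
move=> fs; apply: sqintMl => //.
  by apply: cmeas_real; exact: measurable_indic.
by move=> x; rewrite nsqR indicE; case: (_ \in _); rewrite ?expr1n ?expr0n.
Qed.

Let tr_supp f m k : (m <= k)%N ->
  supp_in (- (pi * k.+1%:R)) (- (pi * k.+1%:R) + 2 * pi * k.+1%:R) (tr f m).
Proof.
move=> mk; have h : pi * m.+1%:R <= pi * k.+1%:R :> R.
  by rewrite ler_pM2l ?pi_gt0// ler_nat.
apply: (@supp_in_sub (- (pi * m.+1%:R)) (pi * m.+1%:R)); [lra|lra|].
by move=> x /negP hx; rewrite /tr indicE mem_setE in_itv/= (negbTE hx) mul0r.
Qed.

Let tr_cint f m : f \in sqint -> cint (tr f m).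
Proof. by move=> fs; exact: (cint_supp (tr_sqint m fs) (tr_supp f (leqnn m))). Qed.

Let tr_cvg f : f \in sqint -> (sqI (fun x => tr f m x - f x)%R @[m --> \oo] --> 0)%E.
Proof.
move=> fs; apply: (sqI_dominated fs).
- by move=> m; apply: cmeasB; apply: sqint_cmeas => //; exact: tr_sqint.
- move=> m x; rewrite /tr indicE; case: (_ \in _).
    by rewrite mul1r subrr nsq0 nsq_ge0.
  by rewrite mul0r sub0r nsqN.
- move=> x; apply: cvg_near_cst; exists (Num.bound (`|x| / pi)) => // m /= mx.
  have : `|x| < pi * m.+1%:R.
    rewrite mulrC -ltr_pdivrMr ?pi_gt0//; apply: lt_trans (archi_boundP _) _.
      by rewrite divr_ge0// pi_ge0.
    by rewrite ltr_nat ltnS.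
  rewrite ltr_norml => /andP[h1 h2].
  by rewrite /tr indicE mem_setE in_itv/= h1 (ltW h2) mul1r subrr nsq0.
Qed.

Lemma sqint_fourierL1 a b f : f \in sqint -> supp_in a b f -> fourierL1 f \in sqint.
Proof.
move=> fs f0; apply/sqintP; split; first exact/cmeas_fourierL1/(cint_supp fs f0).
pose Q := (Num.bound (Num.max (- a) b)).+1.
have h : Num.max (- a) b <= pi * Q%:R.
  have [h|h] := leP (Num.max (- a) b) 0; first by rewrite (le_trans h)// mulr_ge0 ?pi_ge0.
  apply: (@le_trans _ _ Q%:R); last first.
    rewrite ler_peMl//; have := pi_ge2 R; lra.
  by apply/ltW/(lt_trans (archi_boundP (ltW h))); rewrite ltr_nat.
rewrite (@plancherel_supp _ (- (pi * Q%:R)) Q)//; first exact: sqI_lty.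
move: h; rewrite ge_max => /andP[h1 h2].
by apply: supp_in_sub f0; lra.
Qed.

(** By Plancherel the transforms of the truncations are as close to each other as the truncations
    themselves, hence Cauchy; completeness supplies the limit. *)
Theorem fourier_exists phi : exists F, is_fourier phi F.
Proof.
have fs := L2_sqint phi; set f : R -> R[i] := phi in fs *.
pose u m := fourierL1 (tr f m).
have us m : u m \in sqint.
  exact: (sqint_fourierL1 (tr_sqint m fs) (tr_supp f (leqnn m))).
have uB m l : sqI (fun x => u m x - u l x) = sqI (fun x => tr f m x - tr f l x).
  rewrite -[RHS](@plancherel_supp _ (- (pi * (maxn m l).+1%:R)) (maxn m l).+1)//.
  - by apply: eq_integral => x _; rewrite /u fourierL1B//; exact: tr_cint.
  - by apply: sqintB; exact: tr_sqint.
  - move=> x hx; rewrite (tr_supp f (leq_maxl m l) hx) (tr_supp f (leq_maxr m l) hx).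
    by rewrite subrr.
have uC t : 0 < t -> exists M, forall m l, (M <= m)%N -> (M <= l)%N ->
    (sqI (fun x => u m x - u l x)%R <= t%:E)%E.
  (* [sqID_le] doubles each of the two errors. *)
  move=> t0; have t4 : 0 < t / 4 by rewrite divr_gt0.
  have /fine_cvgP[_ /cvgrPdist_le/(_ _ t4)[M _ HM]] := tr_cvg fs.
  have H m : (M <= m)%N -> (sqI (fun x => tr f m x - f x)%R <= (t / 4)%:E)%E.
    move=> /HM /=; rewrite sub0r normrN ger0_norm ?fine_ge0 ?sqI_ge0//.
    by rewrite -lee_fin fineK//; apply: sqI_fin; apply: sqintB => //; exact: tr_sqint.
  exists M => m l /H hm /H hl; rewrite uB.
  rewrite (_ : (fun x => _) = fun x => (tr f m x - f x) + (-1) * (tr f l x - f x)); last first.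
    by apply/funext => x; rewrite mulN1r opprB addrA subrK.
  have sB k : (fun x => tr f k x - f x) \in sqint by apply: sqintB => //; exact: tr_sqint.
  apply: le_trans (sqID_le (sqint_cmeas (sB m)) (sqint_cmeas (sqint_scale (-1) (sB l)))) _.
  have -> : sqI (fun x => -1 * (tr f l x - f x)) = sqI (fun x => tr f l x - f x).
    by apply: eq_integral => x _; rewrite mulN1r nsqN.
  apply: (@le_trans _ _ (2%:E * (t / 4)%:E + 2%:E * (t / 4)%:E)%E).
    by apply: leeD; apply: lee_wpmul2l.
  by rewrite -!EFinM -EFinD lee_fin; lra.
have [F [Fs uF]] := sqint_complete us uC.
exists (toL2 F), (fun m => toL2 (tr f m)), (fun m => toL2 (u m)); split.
- move=> m; apply/(cint_normc (L2_cmeas _)).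
  by apply: ae_eq_cint (tr_cint m fs) (toL2E (tr_sqint m fs)); exact: L2_cmeas.
- move=> m; have h := toL2E (us m).
  apply: (filterS (F := almost_everywhere mu)) h => x /= e _; rewrite e//.
  apply: fourierL1_ae; [exact/sqint_cmeas/tr_sqint|exact: L2_cmeas|].
  by apply: ae_eq_sym; exact: toL2E (tr_sqint m fs).
- have := L2norm_cvg0 (fun m => tr_sqint m fs) fs (tr_cvg fs).
  by rewrite /f toL2K.
- exact: L2norm_cvg0.
Qed.

Lemma fourierP phi : is_fourier phi (fourier phi).
Proof. by have [F hF] := fourier_exists phi; rewrite /fourier; case: xgetP => [G _ //|/(_ F)]. Qed.

End fourier_existence.

(** * Pairing with inverse transforms of test functions *)

Section pairing.
Context {R : realType}.
Local Notation mu := (@lebesgue_measure R).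
Implicit Types (f g h : R -> R[i]) (phi : L2 R).

Lemma cintegral_fubini (K : R * R -> R[i]) :
  (mu \x mu)%E.-integrable setT (EFin \o (Re \o K)) ->
  (mu \x mu)%E.-integrable setT (EFin \o (Im \o K)) ->
  (forall x, cint (fun y => K (x, y))) -> (forall y, cint (fun x => K (x, y))) ->
  cintegral (fun x => cintegral (fun y => K (x, y))) =
  cintegral (fun y => cintegral (fun x => K (x, y))).
Proof.
move=> iRe iIm c1 c2; rewrite /cintegral; congr (_ +i* _).
  rewrite /Rintegral; congr fine.
  transitivity (\int[mu]_x \int[mu]_y (EFin \o (Re \o K)) (x, y))%E.
    by apply: eq_integral => x _; rewrite fineK//; apply: integrable_fin_num (c1 x).1.
  rewrite (Fubini iRe); apply: eq_integral => y _.
  by rewrite fineK//; apply: integrable_fin_num (c2 y).1.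
rewrite /Rintegral; congr fine.
transitivity (\int[mu]_x \int[mu]_y (EFin \o (Im \o K)) (x, y))%E.
  by apply: eq_integral => x _; rewrite fineK//; apply: integrable_fin_num (c1 x).2.
rewrite (Fubini iIm); apply: eq_integral => y _.
by rewrite fineK//; apply: integrable_fin_num (c2 y).2.
Qed.

Lemma integrable_prod (a b : R -> R) :
  mu.-integrable setT (EFin \o a) -> mu.-integrable setT (EFin \o b) ->
  (forall x, 0 <= a x) -> (forall x, 0 <= b x) ->
  (mu \x mu)%E.-integrable setT (fun p : R * R => (a p.1 * b p.2)%:E).
Proof.
move=> ia ib a0 b0.
have ma : measurable_fun setT a by apply/measurable_EFinP; exact: measurable_int ia.
have mb : measurable_fun setT b by apply/measurable_EFinP; exact: measurable_int ib.
have mab : measurable_fun setT (fun p : R * R => (a p.1 * b p.2)%:E : \bar R).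
  apply/measurable_EFinP; apply: measurable_funM.
    exact: (measurableT_comp ma measurable_fst).
  exact: (measurableT_comp mb measurable_snd).
apply/(integrable12ltyP mu mu mab).
have e1 x : (\int[mu]_y `|(a x * b y)%:E| = (a x)%:E * \int[mu]_y (b y)%:E)%E.
  rewrite -ge0_integralZl//.
  - by apply: eq_integral => y _; rewrite gee0_abs ?EFinM// lee_fin mulr_ge0.
  - exact/measurable_EFinP.
  - by move=> y _; rewrite lee_fin.
  - by rewrite lee_fin.
under eq_integral do rewrite e1.
have fb : (\int[mu]_y (b y)%:E)%E \is a fin_num by exact: integrable_fin_num ib.
rewrite -(fineK fb) ge0_integralZr//.
- have fa : (\int[mu]_y (a y)%:E)%E \is a fin_num by exact: integrable_fin_num ia.
  by rewrite -(fineK fa) -EFinM ltry.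
- exact/measurable_EFinP.
- by move=> y _; rewrite lee_fin.
- by rewrite lee_fin fine_ge0// integral_ge0// => y _; rewrite lee_fin.
Qed.

(** The inverse transform, written through [fourierL1] so that square integrability is inherited;
    [ifourierE] gives the usual formula. *)
Definition ifourier h (x : R) : R[i] := (fourierL1 (fun y => (h y)^*) x)^*.

Lemma ifourierE h x : cint h ->
  ifourier h x = ((Num.sqrt (2 * pi))^-1)%:C * cintegral (fun y => h y * expi (x * y)).
Proof.
move=> ch; rewrite /ifourier /fourierL1 conjM conjR -cintegralJ; last first.
  by under eq_fun do rewrite -mulNr; apply: cint_mul_expi; exact: cintJ.
by congr (_ * _); apply: eq_cintegral => y; rewrite conjM conjcK expiN conjcK.
Qed.

Lemma cint_dom f : cint f -> mu.-integrable setT (EFin \o (fun x => `|Re (f x)| + `|Im (f x)|)).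
Proof.
move=> [fr fi].
have /= h := integrableD measurableT (integrable_norm fr) (integrable_norm fi).
exact: h.
Qed.

Lemma cintegral_exchange h g : cint h -> cint g ->
  cintegral (fun x => cintegral (fun y => (g x)^* * (h y * expi (x * y)))) =
  cintegral (fun y => cintegral (fun x => (g x)^* * (h y * expi (x * y)))).
Proof.
move=> ch cg; have mh := cint_cmeas ch; have mg := cint_cmeas cg.
pose K (p : R * R) : R[i] := (g p.1)^* * (h p.2 * expi (p.1 * p.2)).
have mK : cmeas K.
  apply: cmeasM; first exact: (cmeasJ (cmeas_comp mg measurable_fst)).
  apply: cmeasM; first exact: (cmeas_comp mh measurable_snd).
  apply: cmeas_expi; apply: measurable_funM; [exact: measurable_fst|exact: measurable_snd].
have dom := integrable_prod (cint_dom cg) (cint_dom ch)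
  (fun x => addr_ge0 (normr_ge0 _) (normr_ge0 _)) (fun x => addr_ge0 (normr_ge0 _) (normr_ge0 _)).
have nle (z : R[i]) : nsq z <= (`|Re z| + `|Im z|) ^+ 2.
  by rewrite -normc_sq ler_pXn2r// ?nnegrE ?addr_ge0 ?normc_ge0' ?normc_le.
have Kle p : nsq (K p) <= ((`|Re (g p.1)| + `|Im (g p.1)|) * (`|Re (h p.2)| + `|Im (h p.2)|)) ^+ 2.
  by rewrite !nsqM nsqJ nsq_expi mulr1 exprMn ler_pM// ?nsq_ge0.
have Dge p : 0 <= (`|Re (g p.1)| + `|Im (g p.1)|) * (`|Re (h p.2)| + `|Im (h p.2)|) :> R.
  by rewrite mulr_ge0 ?addr_ge0.
have iRe : (mu \x mu)%E.-integrable setT (EFin \o (Re \o K)).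
  apply: (le_integrable measurableT _ _ dom); first by apply/measurable_EFinP; exact: mK.1.
  move=> p _ /=; rewrite lee_fin [leRHS]ger0_norm// -ler_sqr ?nnegrE// real_normK ?num_real//.
  by apply: le_trans (Kle p); rewrite lerDl sqr_ge0.
have iIm : (mu \x mu)%E.-integrable setT (EFin \o (Im \o K)).
  apply: (le_integrable measurableT _ _ dom); first by apply/measurable_EFinP; exact: mK.2.
  move=> p _ /=; rewrite lee_fin [leRHS]ger0_norm// -ler_sqr ?nnegrE// real_normK ?num_real//.
  by apply: le_trans (Kle p); rewrite lerDr sqr_ge0.
apply: (cintegral_fubini iRe iIm) => [x|y].
  rewrite -[X in cint X]/(fun y => (g x)^* * (h y * expi (x * y))).
  exact: (cintZ _ (cint_mul_expi x ch)).
rewrite -[X in cint X]/(fun x => (g x)^* * (h y * expi (x * y))).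
rewrite (_ : (fun x => _) = fun x => h y * ((g x)^* * expi (y * x))).
  exact: (cintZ _ (cint_mul_expi y (cintJ cg))).
by apply/funext => x; rewrite mulrCA [x * y]mulrC.
Qed.

Lemma ifourier_fubini h g : cint h -> cint g ->
  cintegral (fun x => ifourier h x * (g x)^*) =
  cintegral (fun xi => h xi * (fourierL1 g xi)^*).
Proof.
move=> ch cg; pose s : R[i] := ((Num.sqrt (2 * pi))^-1)%:C.
have csh : cint (fun y => s * h y) by exact: cintZ.
transitivity (cintegral (fun x => cintegral (fun y => (g x)^* * (s * h y * expi (x * y))))).
  apply: eq_cintegral => x; rewrite cintegralZ; last exact: cint_mul_expi.
  rewrite mulrC; congr (_ * _); rewrite ifourierE// -cintegralZ; last exact: cint_mul_expi.
  by apply: eq_cintegral => y; rewrite mulrA.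
rewrite cintegral_exchange//; apply: eq_cintegral => y.
have cy : cint (fun x => g x * expi (- (y * x))).
  by under eq_fun do rewrite -mulNr; exact: cint_mul_expi.
rewrite /fourierL1 conjM conjR -cintegralJ// mulrA [h y * _]mulrC -cintegralZ; last exact: cintJ.
apply: eq_cintegral => x; rewrite conjM expiN conjcK mulrCA.
by rewrite [x * y]mulrC.
Qed.

Lemma sqint_ifourier a b h : h \in sqint -> supp_in a b h -> ifourier h \in sqint.
Proof.
move=> hs h0; apply: sqintJ; apply: (sqint_fourierL1 (sqintJ hs)) => x /h0 ->.
exact: conjc0.
Qed.

Let vanish (z w : R[i]) (C : R) (a b : nat -> R) : 
  (forall k, nsq (z - w) <= C * (a k ^+ 2 + b k ^+ 2)) ->
  a k @[k --> \oo] --> 0 -> b k @[k --> \oo] --> 0 -> z = w.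
Proof.
move=> h a0 b0; have : C * (a k ^+ 2 + b k ^+ 2) @[k --> \oo] --> C * (0 * 0 + 0 * 0).
  apply: cvgM; first exact: cvg_cst.
  by under eq_fun do rewrite !expr2; apply: cvgD; apply: cvgM.
rewrite mulr0 addr0 mulr0 => hc.
have /eqP : nsq (z - w) = 0.
  apply/eqP; rewrite eq_le nsq_ge0 andbT.
  rewrite -(cvg_lim _ hc)//; apply: limr_ge; first by apply/cvg_ex; exists 0.
  by apply: nearW => k; exact: h.
rewrite paddr_eq0 ?sqr_ge0// !sqrf_eq0 => /andP[/eqP hr /eqP hi].
by apply/eqP; rewrite -subr_eq0; apply/eqP; case: (z - w) hr hi => u v /= -> ->.
Qed.

(** For the integrable approximants [g k] this is Fubini. Both sides pass to the limit by
    Cauchy-Schwarz, because [g k] tends to [phi] and [G k] to its transform. *)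
Theorem pairing_fourier a b h phi : h \in sqint -> supp_in a b h ->
  L2inner (toL2 (ifourier h)) phi = cintegral (fun xi => h xi * (fourier phi xi)^*).
Proof.
move=> hs h0; have ihs := sqint_ifourier hs h0; have ch := cint_supp hs h0.
have [g [G [ig gG gphi GF]]] := fourierP phi.
have cg k : cint (g k) by apply/(cint_normc (L2_cmeas _)); exact: ig.
have RHSe : cintegral (fun xi => h xi * (fourier phi xi)^*) = L2inner (toL2 h) (fourier phi).
  by rewrite (L2inner_ae (sqint_cmeas hs) (L2_cmeas _) (toL2E hs) (ae_eq_refl _ _ _)).
have e k : L2inner (toL2 (ifourier h)) (g k) = L2inner (toL2 h) (G k).
  rewrite (L2inner_ae (sqint_cmeas ihs) (L2_cmeas _) (toL2E ihs) (ae_eq_refl _ _ _)).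
  rewrite ifourier_fubini//.
  by rewrite (L2inner_ae (sqint_cmeas hs) (cmeas_fourierL1 (cg k)) (toL2E hs) (gG k)).
rewrite RHSe; set H' := toL2 (ifourier h); set H := toL2 h.
pose C := 2 * (nsqv L2inner H' + nsqv L2inner H).
have CS := cauchy_schwarz (@L2innerDl R) (@L2innerZl R) (@L2innerC R) (@L2inner_ge0 R).
have Br := ipDr (@L2innerDl R) (@L2innerC R).
have Nr := ipNr (@L2innerZl R) (@L2innerC R).
apply: (@vanish _ _ C _ _ _ gphi GF) => k.
have -> : L2inner H' phi - L2inner H (fourier phi) =
    - L2inner H' (g k - phi) + L2inner H (G k - fourier phi).
  by rewrite !Br !Nr e; ring.
apply: le_trans (nsqD_le _ _) _; rewrite nsqN !L2norm_sq /C.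
have := CS H' (g k - phi); have := CS H (G k - fourier phi).
have := nsqv_ge0 (@L2inner_ge0 R) H; have := nsqv_ge0 (@L2inner_ge0 R) H'.
have := nsqv_ge0 (@L2inner_ge0 R) (g k - phi); have := nsqv_ge0 (@L2inner_ge0 R) (G k - fourier phi).
move=> *; nra.
Qed.

Lemma ifourier_shift h x w : cint h ->
  ifourier h (x + w) = ifourier (fun y => h y * expi (w * y)) x.
Proof.
move=> ch; rewrite !ifourierE//; last exact: cint_mul_expi.
congr (_ * _); apply: eq_cintegral => y.
by rewrite mulrDl expiD [expi (x * y) * _]mulrC mulrA.
Qed.

Lemma ifourier_scale h x (N : R) : 0 < N -> cint h ->
  ifourier h (N * x) = N^-1%:C * ifourier (fun y => h (N^-1 * y)) x.
Proof.
move=> N0 ch; have Ni : 0 < N^-1 by rewrite invr_gt0.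
have ch' : cint (fun y => h (N^-1 * y)).
  by have := cint_affine 0 Ni ch; under eq_fun do rewrite addr0.
rewrite !ifourierE// mulrCA; congr (_ * _).
have c1 : cint (fun y => h y * expi (N * x * y)) by exact: cint_mul_expi.
have := cintegral_affine 0 Ni c1; rewrite invrK => /(congr1 (fun z => N^-1%:C * z)).
rewrite mulrA -realcM mulVf ?gt_eqF// mul1r => <-; congr (_ * _).
apply: eq_cintegral => y; rewrite addr0; congr (_ * expi _).
by field; rewrite gt_eqF.
Qed.

(** Here and in the next two lemmas a change of variables moves the operator onto the test function:
    shifts become modulations, and dilation becomes the inverse dilation on the frequency side. *)
Lemma L2inner_T0 a b h phi : h \in sqint -> supp_in a b h ->
  L2inner (toL2 (ifourier h)) (T0 phi) =
  L2inner (toL2 (ifourier (fun y => h y * expi (1 * y)))) phi.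
Proof.
move=> hs h0; have ihs := sqint_ifourier hs h0; have ch := cint_supp hs h0.
have hs' := sqint_expi 1 hs.
have ihs' := sqint_ifourier hs' (supp_expi 1 h0).
have mT : cmeas (fun x : R => phi (x - 1)) by exact: sqint_cmeas (sqint_T0 phi).
rewrite (L2inner_ae (sqint_cmeas ihs) mT (toL2E ihs) (toL2E (sqint_T0 phi))).
rewrite (L2inner_ae (sqint_cmeas ihs') (L2_cmeas _) (toL2E ihs') (ae_eq_refl _ _ _)).
have ci : cint (fun x => ifourier h x * (phi (x - 1))^*).
  exact: cint_mulJ ihs (sqint_T0 phi).
have := cintegral_affine 1 (@ltr01 R) ci; rewrite invr1 mul1r => <-.
by apply: eq_cintegral => x; rewrite mul1r addrK ifourier_shift.
Qed.

Lemma L2inner_T0inv a b h phi : h \in sqint -> supp_in a b h ->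
  L2inner (toL2 (ifourier h)) (T0inv phi) =
  L2inner (toL2 (ifourier (fun y => h y * expi (-1 * y)))) phi.
Proof.
move=> hs h0; have ihs := sqint_ifourier hs h0; have ch := cint_supp hs h0.
have hs' := sqint_expi (-1) hs.
have ihs' := sqint_ifourier hs' (supp_expi (-1) h0).
have mT : cmeas (fun x : R => phi (x + 1)) by exact: sqint_cmeas (sqint_T0inv phi).
rewrite (L2inner_ae (sqint_cmeas ihs) mT (toL2E ihs) (toL2E (sqint_T0inv phi))).
rewrite (L2inner_ae (sqint_cmeas ihs') (L2_cmeas _) (toL2E ihs') (ae_eq_refl _ _ _)).
have ci : cint (fun x => ifourier h x * (phi (x + 1))^*).
  exact: cint_mulJ ihs (sqint_T0inv phi).
have := cintegral_affine (-1) (@ltr01 R) ci; rewrite invr1 mul1r => <-.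
by apply: eq_cintegral => x; rewrite mul1r subrK ifourier_shift.
Qed.

Lemma L2inner_U0 a b h phi N : (0 < N)%N -> h \in sqint -> supp_in a b h ->
  L2inner (toL2 (ifourier h)) (U0 N phi) =
  L2inner (toL2 (ifourier (fun y => ((Num.sqrt N%:R)^-1)%:C * h (N%:R^-1 * y)))) phi.
Proof.
move=> N0 hs h0; have ihs := sqint_ifourier hs h0; have ch := cint_supp hs h0.
have Np : 0 < N%:R :> R by rewrite ltr0n.
have Ni : 0 < N%:R^-1 :> R by rewrite invr_gt0.
set r : R := (Num.sqrt N%:R)^-1.
have hNs : (fun y => h (N%:R^-1 * y)) \in sqint.
  by have := sqint_affine 0 Ni hs; under eq_fun do rewrite addr0.
have hs' : (fun y => r%:C * h (N%:R^-1 * y)) \in sqint by exact: sqint_scale.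
have h0N : supp_in (N%:R * a) (N%:R * b) (fun y => h (N%:R^-1 * y)).
  move=> y hy; apply: h0 => /andP[h1 h2]; apply: hy.
  by rewrite -(ltr_pM2l Ni) -[X in _ && X](ler_pM2l Ni) !mulKf ?gt_eqF// h1 h2.
have h0' : supp_in (N%:R * a) (N%:R * b) (fun y => r%:C * h (N%:R^-1 * y)).
  by move=> y /h0N ->; rewrite mulr0.
have ihs' := sqint_ifourier hs' h0'.
have Us := sqint_U0 phi N0.
rewrite (L2inner_ae (sqint_cmeas ihs) (sqint_cmeas Us) (toL2E ihs) (toL2E Us)).
rewrite (L2inner_ae (sqint_cmeas ihs') (L2_cmeas _) (toL2E ihs') (ae_eq_refl _ _ _)).
have ci := cint_mulJ ihs Us.
set f := (fun x : R => _) in ci *.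
have nn : (N%:R : R)%:C * (N%:R^-1)%:C = 1 :> R[i] by rewrite -realcM mulfV// gt_eqF.
have ci' := cint_affine 0 Np ci.
rewrite -[LHS](mul1r) -nn -mulrA -(cintegral_affine 0 Np ci) -cintegralZ//.
apply: eq_cintegral => x; rewrite /f addr0 [N%:R * x / N%:R]mulrC mulKf ?gt_eqF// ifourier_scale//.
have -> : ifourier (fun y => r%:C * h (N%:R^-1 * y)) x = r%:C * ifourier (fun y => h (N%:R^-1 * y)) x.
  have cN := cint_supp hNs h0N.
  rewrite !ifourierE//; last exact: cintZ.
  rewrite mulrCA; congr (_ * _); rewrite -cintegralZ; last exact: cint_mul_expi.
  by apply: eq_cintegral => y; rewrite mulrA.
rewrite conjM conjR !mulrA nn mul1r -!mulrA mulrCA; congr (_ * _).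
Qed.

End pairing.

(** For each [n] only finitely many terms can exceed [1 / (n + 1)]. *)
Lemma countable_esum_support (R : realType) (I : choiceType) (D : set I) (a : I -> R) :
  (forall i, 0 <= a i) -> (\esum_(i in D) (a i)%:E < +oo)%E ->
  countable [set i | D i /\ a i != 0].
Proof.
move=> a0 fin; pose A n := [set i | D i /\ n.+1%:R^-1 < a i].
have fA n : finite_set (A n).
  apply: contrapT => infA.
  have : (0 <= \esum_(i in D) (a i)%:E)%E by apply: esum_ge0 => i _; rewrite lee_fin.
  case E : (\esum_(i in D) (a i)%:E)%E fin => [r| |] // _; rewrite lee_fin => r0.
  have [B BA cB] := infinite_set_fset (Num.bound (n.+1%:R * r)).+1 infA.
  have : ((\sum_(i <- B) a i)%:E <= r%:E)%E.
    by rewrite -E; apply: seq_le_esum; [exact: fset_uniq|move=> i /BA[]].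
  rewrite lee_fin leNgt => /negP; apply.
  have n0 : 0 < n.+1%:R :> R by rewrite ltr0n.
  apply: (@lt_le_trans _ _ (\sum_(i <- B) n.+1%:R^-1)).
    rewrite big_const_seq count_predT iter_addr_0 -[ltRHS]mulr_natl ltr_pdivlMr// mulrC.
    apply: lt_le_trans (archi_boundP _) _; first by rewrite mulr_ge0.
    by rewrite ler_nat ltnW.
  by rewrite big_seq [leRHS]big_seq; apply: ler_sum => i /BA[_ /ltW].
have -> : [set i | D i /\ a i != 0] = \bigcup_n A n.
  apply/seteqP; split => i.
    move=> [Di ai0]; have ai : 0 < a i by rewrite lt_def ai0 a0.
    exists (Num.bound (a i)^-1) => //; split => //.
    rewrite -[ltRHS]invrK ltf_pV2 ?posrE ?invr_gt0 ?ltr0n//.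
    apply: lt_trans (archi_boundP _) _; first by rewrite invr_ge0.
    by rewrite ltr_nat.
  move=> [n _ [Di ai]]; split => //; rewrite gt_eqF//.
  by apply: lt_trans ai; rewrite invr_gt0 ltr0n.
by apply: bigcup_countable => // n _; exact: finite_set_countable.
Qed.

(** * Almost everywhere statements from integrals *)

Section ae_lemmas.
Context {R : realType}.
Local Notation mu := (@lebesgue_measure R).

Lemma ae_forall_countType (T : countType) (P : T -> R -> Prop) :
  (forall t, {ae mu, forall x, P t x}) -> {ae mu, forall x, forall t, P t x}.
Proof.
move=> h.
have : {ae mu, forall x : R, forall n : nat,
    if choice.unpickle n is Some t then P t x else True}.
  by apply: ae_foralln => n; case: (choice.unpickle n) => [t|]; [exact: h|exact: aeW].
apply: (filterS (F := almost_everywhere mu)) => x hx t.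
by have := hx (choice.pickle t); rewrite choice.pickleK.
Qed.

(** On the part of [J] where [g < f], the hypothesis forces [f] and [g] to have equal integrals over
    every measurable subset. As [f] is integrable there, they agree almost everywhere on it, so that
    part is null. *)
Lemma ae_le_of_integral (J : set R) (f g : R -> \bar R) : measurable J ->
  measurable_fun setT f -> measurable_fun setT g ->
  (forall x, 0 <= f x)%E -> (forall x, 0 <= g x)%E ->
  (\int[mu]_x ((\1_J x)%:E * f x) < +oo)%E ->
  (forall E, measurable E -> E `<=` J ->
     (\int[mu]_x ((\1_E x)%:E * f x) <= \int[mu]_x ((\1_E x)%:E * g x))%E) ->
  {ae mu, forall x, J x -> (f x <= g x)%E}.
Proof.
move=> mJ mf mg f0 g0 fin h.
pose E := J `&` [set x | (g x < f x)%E].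
have mlt : measurable [set x | (g x < f x)%E].
  by rewrite -[X in measurable X]setTI; exact: (measurable_lte measurableT mg mf).
have mE : measurable E by exact: measurableI.
have mi A (k : R -> \bar R) : measurable A -> measurable_fun setT k ->
    measurable_fun setT (fun x => (\1_A x)%:E * k x)%E.
  move=> mA mk; apply: emeasurable_funM => //.
  by apply/measurable_EFinP; exact: measurable_indic.
have i0 A (k : R -> \bar R) x : (forall x, 0 <= k x)%E -> (0 <= (\1_A x)%:E * k x)%E.
  by move=> k0; rewrite mule_ge0// lee_fin.
have sub A B (k : R -> \bar R) : A `<=` B -> (forall x, 0 <= k x)%E ->
    forall x, ((\1_A x)%:E * k x <= (\1_B x)%:E * k x)%E.
  move=> AB k0 x; apply: lee_wpmul2r => //; rewrite lee_fin !indicE.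
  case: (boolP (x \in A)) => [|_]; last by [].
  by rewrite inE => /AB xB; rewrite mem_set.
have ifE : mu.-integrable setT (fun x => (\1_E x)%:E * f x)%E.
  apply/integrableP; split; first exact: mi.
  under eq_integral do rewrite gee0_abs ?i0//.
  apply: le_lt_trans fin; apply: ge0_le_integral => //.
  - by move=> x _; exact: i0.
  - exact: mi.
  - exact: mi.
  - by move=> x _; apply: sub => //; exact: subIsetl.
have : ae_eq mu setT (fun x => (\1_E x)%:E * f x)%E (fun x => (\1_E x)%:E * g x)%E.
  apply: (integral_ae_eq measurableT ifE (mi _ _ mE mg)) => A _ mA.
  have mEA : measurable (E `&` A) by exact: measurableI.
  have e (k : R -> \bar R) : (\int[mu]_(x in A) ((\1_E x)%:E * k x) =
      \int[mu]_x ((\1_(E `&` A) x)%:E * k x))%E.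
    rewrite integral_mkcond; apply: eq_integral => x _.
    rewrite patchE !indicE in_setI; case: (x \in A); rewrite ?andbT// andbF.
    by rewrite mul0e.
  rewrite !e; apply/eqP; rewrite eq_le; apply/andP; split.
    by apply: h => // x [[]].
  apply: ge0_le_integral => //.
  - by move=> x _; exact: i0.
  - exact: mi.
  - exact: mi.
  - move=> x _; rewrite indicE; case: (boolP (x \in _)) => [|_]; last by rewrite !mul0e.
    by rewrite inE => -[[_ /= /ltW gf] _]; rewrite !mul1e.
apply: (filterS (F := almost_everywhere mu)) => x /= e Jx.
rewrite leNgt; apply/negP => gf.
have xE : E x by [].
by have := e Logic.I; rewrite indicE mem_set// !mul1e => fg; rewrite fg ltxx in gf.
Qed.

Lemma sqI0_ae (f : R -> R[i]) : cmeas f -> sqI f = 0%E -> f = (fun=> 0) %[ae mu].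
Proof.
move=> mf f0.
have : (\int[mu]_x `|(nsq (f x))%:E| = 0)%E.
  by under eq_integral do rewrite gee0_abs ?lee_fin ?nsq_ge0//.
move=> /(ae_eq_integral_abs mu measurableT (measurable_nsqE mf)).
apply: (filterS (F := almost_everywhere mu)) => x /= h _; have [] := h Logic.I.
case: (f x) => a b; rewrite /nsq/= => /eqP; rewrite paddr_eq0 ?sqr_ge0// !sqrf_eq0.
by move=> /andP[/eqP -> /eqP ->].
Qed.

Lemma nsqv_L2_eq0 (F : L2 R) : nsqv L2inner F = 0 -> F = 0.
Proof.
rewrite nsqv_L2 => /eqP; rewrite fine_eq0 ?sqI_fin ?L2_sqint// => /eqP h.
have F0 := sqI0_ae (L2_cmeas F) h.
rewrite -[LHS]toL2K -[RHS]toL2K; apply: toL2_ext; [exact: L2_sqint|exact: L2_sqint|].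
have z : (0 : L2 R) = (fun x => 0 * F x) %[ae mu].
  by rewrite -(scale0r F); exact: L2_scaleE.
move: F0 z; apply: (filterS2 (F := almost_everywhere mu)) => x /= e1 e2 _.
by rewrite e1// e2// mul0r.
Qed.

Lemma nsqv_vinner_eq0 n (f : 'I_n -> L2 R) : nsqv vinner f = 0 -> f = 0.
Proof.
rewrite /nsqv /vinner Re_sum => h; apply/funext => i; apply: nsqv_L2_eq0.
exact: (psumr_eq0P (fun i _ => L2inner_ge0 (f i)) h).
Qed.

End ae_lemmas.

(** * Frame coefficients of band-limited test vectors *)

Section band_limited_tests.
Context {R : realType} {n : nat}.
Local Notation mu := (@lebesgue_measure R).
Implicit Types (h : R -> R[i]) (f : 'I_n -> L2 R).

(** Each shift multiplies [h] by one more character and the inner product by a unimodular scalar,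
    which the squared modulus removes. *)
Lemma nsq_ip_Tpow (z : 'I_n -> R[i]) (k : int) h (a b : R) f (i : 'I_n) :
  nsq (z i) = 1 -> h \in sqint -> supp_in a b h ->
  nsq (L2inner (toL2 (ifourier h)) (Tpow z k f i)) =
  nsq (L2inner (toL2 (ifourier (fun y => h y * expi (k%:~R * y)))) (f i)).
Proof.
move=> zi; have zVi : nsq (z i)^-1 = 1.
  have z0 : z i != 0 by apply/eqP => z0; move: zi; rewrite z0 nsq0 => /eqP; rewrite eq_sym oner_eq0.
  have : nsq ((z i)^-1 * z i) = 1 by rewrite mulVf// /nsq/= expr1n expr0n addr0.
  by rewrite nsqM zi mulr1.
have Zr := ipZr (@L2innerZl R) (@L2innerC R).
have add h' s t : (fun y => h' y * expi (s * y) * expi (t * y)) = (fun y : R => h' y * expi ((s + t) * y)).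
  by apply/funext => y; rewrite mulrDl expiD mulrA.
case: k => m; rewrite /Tpow /iterz.
  elim: m h => [|m IH] h hs h0.
    rewrite [X in _ = nsq (L2inner (toL2 (ifourier X)) _)](_ : _ = h)//.
    by apply/funext => y; rewrite mul0r expi0 mulr1.
  rewrite iterS {1}/Tn Zr nsqM nsqJ zi mul1r (L2inner_T0 _ hs h0) IH; last 2 first.
  - exact: sqint_expi.
  - exact: supp_expi.
  rewrite add (_ : 1 + (Posz m)%:~R = (Posz m.+1)%:~R :> R)//.
  by rewrite -!pmulrn -natr1 addrC.
have T h' : h' \in sqint -> supp_in a b h' -> forall f', 
    nsq (L2inner (toL2 (ifourier h')) (Tninv z f' i)) =
    nsq (L2inner (toL2 (ifourier (fun y => h' y * expi (-1 * y)))) (f' i)).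
  by move=> hs h0 f'; rewrite {1}/Tninv Zr nsqM nsqJ zVi mul1r (L2inner_T0inv _ hs h0).
elim: m h => [|m IH] h hs h0; first by rewrite iterS T.
rewrite iterS T// IH; last 2 first.
- exact: sqint_expi.
- exact: supp_expi.
rewrite add (_ : -1 + (Negz m)%:~R = (Negz m.+1)%:~R :> R)//.
by rewrite !NegzE !mulrNz -!pmulrn -[m.+2%:R]natr1 opprD addrC.
Qed.

Lemma sqint_supp_dilate (N m : nat) h (a b : R) : (0 < N)%N -> h \in sqint -> supp_in a b h ->
  (fun y => ((Num.sqrt N%:R)^-1 ^+ m)%:C * h (N%:R^-1 ^+ m * y)) \in sqint /\
  supp_in (N%:R ^+ m * a) (N%:R ^+ m * b)
    (fun y => ((Num.sqrt N%:R)^-1 ^+ m)%:C * h (N%:R^-1 ^+ m * y)).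
Proof.
move=> N0 hs h0; have Np : 0 < N%:R :> R by rewrite ltr0n.
have Nmp : 0 < (N%:R^-1 : R) ^+ m by rewrite exprn_gt0// invr_gt0.
split.
  apply: sqint_scale; have := sqint_affine 0 Nmp hs.
  by under eq_fun do rewrite addr0.
move=> y hy; rewrite (h0 _ _) ?mulr0// => /andP[h1 h2]; apply: hy.
have Nm0 : N%:R ^+ m != 0 :> R by rewrite expf_neq0// gt_eqF.
by rewrite -(ltr_pM2l Nmp) -[X in _ && X](ler_pM2l Nmp) exprVn !mulKf// -exprVn h1 h2.
Qed.

Lemma ip_iter_Un (N m : nat) (s : {perm 'I_n}) h (a b : R) f (i : 'I_n) :
  (0 < N)%N -> h \in sqint -> supp_in a b h ->
  L2inner (toL2 (ifourier h)) (iter m (Un N s) f i) =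
  L2inner (toL2 (ifourier
    (fun y => ((Num.sqrt N%:R)^-1 ^+ m)%:C * h (N%:R^-1 ^+ m * y)))) (f (iter m s i)).
Proof.
move=> N0; elim: m h a b i => [|m IH] h a b i hs h0.
  rewrite [X in _ = L2inner (toL2 (ifourier X)) _](_ : _ = h)//.
  by apply/funext => y; rewrite !expr0 !mul1r.
have [hs1 h01] := sqint_supp_dilate 1 N0 hs h0; rewrite !expr1 in hs1 h01.
apply: etrans (L2inner_U0 (iter m (Un N s) f (s i)) N0 hs h0) _.
apply: etrans (IH _ _ _ (s i) hs1 h01) _; rewrite iterSr.
rewrite [X in L2inner (toL2 (ifourier X)) _ = _](_ : _ =
  fun y => ((Num.sqrt N%:R)^-1 ^+ m.+1)%:C * h (N%:R^-1 ^+ m.+1 * y))//.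
by apply/funext => y; rewrite mulrA -realcM -exprSr mulrA -exprS.
Qed.

Definition test_at (i : 'I_n) h : 'I_n -> L2 R := fun j => if j == i then toL2 (ifourier h) else 0.

Lemma vinner_test i h f : vinner (test_at i h) f = L2inner (toL2 (ifourier h)) (f i).
Proof.
rewrite /vinner (bigD1 i)//= /test_at eqxx big1 ?addr0// => j ji.
by rewrite (negbTE ji) (ip0l (@L2innerZl R)).
Qed.

Lemma nsq_vinner_test (N m : nat) (s : {perm 'I_n}) (z : 'I_n -> R[i]) (k : int)
    h (a b : R) f (i : 'I_n) :
  (0 < N)%N -> (forall i, nsq (z i) = 1) -> h \in sqint -> supp_in a b h ->
  nsq (vinner (test_at i h) (iter m (Un N s) (Tpow z k f))) =
  nsq (cintegral (fun y =>
    ((Num.sqrt N%:R)^-1 ^+ m)%:C * h (N%:R^-1 ^+ m * y) * (fourier (f (iter m s i)) y)^* *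
      expi (k%:~R * y))).
Proof.
move=> N0 z1 hs h0; rewrite vinner_test (ip_iter_Un _ _ _ _ N0 hs h0).
have [hs1 h01] := sqint_supp_dilate m N0 hs h0.
rewrite (nsq_ip_Tpow _ _ _ hs1 h01)//.
rewrite (pairing_fourier _ (sqint_expi _ hs1) (supp_expi _ h01)).
by congr nsq; apply: eq_cintegral => y; rewrite mulrAC.
Qed.

Section dilated_indicator.
Variables (N : nat) (N0 : (0 < N)%N) (E : set R) (mE : measurable E).
Variables (phi : L2 R) (m : nat).

Let ind : R -> R[i] := fun y => (\1_E y)%:C.

(** Its Fourier coefficients are, up to unimodular factors, the level-[m] frame coefficients of the
    test vector built from [E]. *)
Definition dilated_product (y : R) : R[i] :=
  ((Num.sqrt N%:R)^-1 ^+ m)%:C * ind (N%:R^-1 ^+ m * y) * (fourier phi y)^*.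

Lemma sqint_dilated_product : dilated_product \in sqint.
Proof.
have Fs : (fun y => (fourier phi y)^*) \in sqint by exact: sqintJ (L2_sqint _).
have Np : 0 < N%:R :> R by rewrite ltr0n.
have mI : cmeas (fun y : R => ind (N%:R^-1 ^+ m * y)).
  apply: (@cmeas_comp _ _ _ _ _ ind); last exact: measurable_mulr.
  by apply: cmeas_real; exact: measurable_indic.
have h : (fun y => ind (N%:R^-1 ^+ m * y) * (fourier phi y)^*) \in sqint.
  apply: sqintMl => // y; rewrite nsqR indicE; case: (_ \in _); by rewrite ?expr1n ?expr0n.
have := sqint_scale ((Num.sqrt N%:R)^-1 ^+ m)%:C h.
by under eq_fun do rewrite mulrA.
Qed.

(** The squared amplitude [N^-m] of the dilation cancels the Jacobian [N^m] of the substitution. *)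
Lemma sqI_dilated_product : sqI dilated_product =
  (\int[mu]_xi (\1_E xi * nsq (fourier phi (N%:R ^+ m * xi)))%:E)%E.
Proof.
have Np : 0 < N%:R :> R by rewrite ltr0n.
have Nmp : 0 < (N%:R : R) ^+ m by rewrite exprn_gt0.
have mf : measurable_fun setT (fun y => (nsq (dilated_product y))%:E).
  exact/measurable_nsqE/sqint_cmeas/sqint_dilated_product.
have f0 y : (0 <= (nsq (dilated_product y))%:E)%E by rewrite lee_fin nsq_ge0.
have := ge0_integral_affine 0 Nmp mf f0.
move=> /(congr1 (fun x => (N%:R ^+ m)%:E * x)%E).
rewrite muleA -EFinM mulfV ?gt_eqF// mul1e /sqI => <-.
have mf' : measurable_fun setT (fun y : R => (nsq (dilated_product (N%:R ^+ m * y + 0)))%:E).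
  exact: (measurableT_comp mf (measurable_affine (N%:R ^+ m) 0)).
rewrite -(ge0_integralZl mu measurableT mf' (fun y _ => f0 _)); last by rewrite lee_fin ltW.
apply: eq_integral => y _; rewrite addr0 -EFinM /dilated_product; congr (_%:E).
have -> : N%:R^-1 ^+ m * (N%:R ^+ m * y) = y by rewrite exprVn mulKf// gt_eqF.
have e2 : ((Num.sqrt N%:R)^-1 ^+ m) ^+ 2 = (N%:R ^+ m)^-1 :> R.
  by rewrite -exprM mulnC exprM exprVn sqr_sqrtr ?exprVn// ltW.
rewrite 2!nsqM nsqJ nsqR e2 /ind nsqR 2!mulrA mulfV ?gt_eqF// mul1r indicE.
by case: (_ \in _); rewrite ?expr1n ?expr0n.
Qed.

End dilated_indicator.

(* The dilated test function is supported in an interval of length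
   [2 pi N^(m - M)]: Parseval applies for m <= M, and Bessel with multiplicity
   [N ^ (m - M)] beyond. *)
Lemma shift_sum_test (N m M : nat) (s : {perm 'I_n}) (z : 'I_n -> R[i]) (c : R)
    (E : set R) f (i : 'I_n) :
  (0 < N)%N -> (forall i, nsq (z i) = 1) -> measurable E ->
  E `<=` [set x | c < x <= c + 2 * pi / N%:R ^+ M] ->
  let I := (\int[mu]_xi (\1_E xi * nsq (fourier (f (iter m s i)) (N%:R ^+ m * xi)))%:E)%E in
  let S := \esum_(k in [set: int])
    (nsq (vinner (test_at i (fun x => (\1_E x)%:C)) (iter m (Un N s) (Tpow z k f))))%:E in
  ((m <= M)%N -> S = ((2 * pi)%:E * I)%E) /\
  (S <= (2 * pi * (N ^ (m - M))%:R)%:E * I)%E.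
Proof.
move=> N0 z1 mE EJ I S.
have Np : 0 < N%:R :> R by rewrite ltr0n.
have N1 : 1 <= N%:R :> R by rewrite ler1n.
have pi0 := pi_gt0 R.
have d0 : 0 <= 2 * pi / N%:R ^+ M :> R by rewrite divr_ge0 ?mulr_ge0 ?exprn_ge0 ?ltW.
have fE : (mu E < +oo)%E.
  apply: (@le_lt_trans _ _ (mu `]c, (c + 2 * pi / N%:R ^+ M)%R])).
    by apply: le_measure; rewrite ?inE.
  have cc : c <= c + 2 * pi / N%:R ^+ M by rewrite lerDl.
  by rewrite [X in (X < _)%E](mu_itv_oc cc) ltry.
have hs := sqint_indic mE fE.
have h0 : supp_in c (c + 2 * pi / N%:R ^+ M) (fun x => (\1_E x)%:C).
  by move=> x hx; rewrite indicE memNset// => /EJ.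
have SE : S = \esum_(k in [set: int])
    (nsq (cintegral (fun y => dilated_product N E (f (iter m s i)) m y * expi (k%:~R * y))))%:E.
  by apply: eq_esum => k _; rewrite (nsq_vinner_test _ _ _ _ _ N0 z1 hs h0).
have Ds := sqint_dilated_product N0 mE (f (iter m s i)) m.
have [_ h1] := sqint_supp_dilate m N0 hs h0.
have D0 : supp_in (N%:R ^+ m * c) (N%:R ^+ m * c + 2 * pi * (N%:R ^+ m / N%:R ^+ M))
    (dilated_product N E (f (iter m s i)) m).
  move=> y hy; rewrite /dilated_product h1 ?mul0r//.
  by rewrite mulrDr [X in _ + X](_ : _ = 2 * pi * (N%:R ^+ m / N%:R ^+ M))//; ring.
rewrite /I -(sqI_dilated_product N0 mE) SE; split.
  move=> mM; apply: (@fourier_parseval _ (N%:R ^+ m * c) _ Ds) => y hy; apply: D0 => /andP[h2 h3]; apply: hy.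
  have le1 : N%:R ^+ m / N%:R ^+ M <= 1 :> R.
    by rewrite ler_pdivrMr ?exprn_gt0// mul1r ler_weXn2l.
  rewrite h2 (le_trans h3)// lerD2l; apply: ler_piMr => //.
  by rewrite mulr_ge0// ltW.
apply: (fourier_bessel_multi (c := N%:R ^+ m * c)) => //; first by rewrite expn_gt0 N0.
(* Truncated subtraction makes the multiplicity 1 when [m <= M]; in all cases [m <= M + (m - M)]. *)
apply: supp_in_sub D0 => //; rewrite lerD2l ler_pM2l ?mulr_gt0//.
rewrite ler_pdivrMr ?exprn_gt0// natrX -exprD ler_weXn2l//.
by rewrite addnC -leq_subLR.
Qed.

End band_limited_tests.

(** * Weighted sums and the limit of the sandwich *)

Section weighted_sums.
Context {R : realType} {J : choiceType}.
Local Notation mu := (@lebesgue_measure R).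
Variables (D : set J) (v : J -> R -> R).
Hypotheses (cD : countable D) (mv : forall j, measurable_fun setT (v j)).
Hypothesis v0 : forall j x, 0 <= v j x.

(** The weight is a parameter because the two sandwich bounds and the convergent majorant differ
    only in it. *)
Definition wsum (w : J -> R) (x : R) : \bar R := \esum_(j in D) (w j * v j x)%:E.

Lemma wsum_ge0 w x : (forall j, 0 <= w j) -> (0 <= wsum w x)%E.
Proof. by move=> w0; apply: esum_ge0 => j _; rewrite lee_fin mulr_ge0. Qed.

Lemma measurable_wsum w : (forall j, 0 <= w j) -> measurable_fun setT (wsum w).
Proof.
move=> w0; have [] := @integral_esum R _ _ mu _ D (fun j x => (w j * v j x)%:E) cD _ _ => //.
- by move=> j; apply/measurable_EFinP; apply: measurable_funM; [exact: measurable_cst|exact: mv].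
- by move=> j x; rewrite lee_fin mulr_ge0.
Qed.

Lemma integral_wsum w (E : set R) : (forall j, 0 <= w j) -> measurable E ->
  (\int[mu]_x ((\1_E x)%:E * wsum w x) =
   \esum_(j in D) ((w j)%:E * \int[mu]_x (\1_E x * v j x)%:E))%E.
Proof.
move=> w0 mE.
have mEv j : measurable_fun setT (fun x : R => (\1_E x * v j x)%:E : \bar R).
  apply/measurable_EFinP; apply: measurable_funM => //; exact: measurable_indic.
have f0 j x : (0 <= (w j)%:E * (\1_E x * v j x)%:E)%E by rewrite mule_ge0// lee_fin ?mulr_ge0.
have mf j : measurable_fun setT (fun x : R => (w j)%:E * (\1_E x * v j x)%:E)%E.
  exact: measurable_funeM.
have [_ h] := @integral_esum R _ _ mu _ D (fun j x => (w j)%:E * (\1_E x * v j x)%:E)%E cD mf f0.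
transitivity (\int[mu]_x (\esum_(j in D) ((w j)%:E * (\1_E x * v j x)%:E)))%E.
  apply: eq_integral => x _; rewrite /wsum -esumZl_real//; last by move=> j; rewrite mulr_ge0.
  by apply: eq_esum => j _; rewrite -EFinM mulrCA.
rewrite h; apply: eq_esum => j _; rewrite (ge0_integralZl mu measurableT (mEv j))//.
- by move=> x _; rewrite lee_fin mulr_ge0.
- by rewrite lee_fin.
Qed.

End weighted_sums.

Section squeeze.
Context {R : realType} {J : choiceType}.
Variables (D : set J) (deg : J -> nat) (u : J -> R) (N : nat).
Hypotheses (N2 : (2 <= N)%N) (u0 : forall j, 0 <= u j).

(** A finite partial sum has a largest degree, so some lower bound contains it. For the upper bound,
    [N^(deg - M)] is at most [1 + N^-M N^deg]: it is 1 up to degree [M] and the second term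
    afterwards. The last sum is finite, so its share vanishes as [M] grows. *)
Lemma esum_squeeze (A : \bar R) :
  (forall M, \esum_(j in D) ((deg j <= M)%N%:R * u j)%:E <= A)%E ->
  (forall M, A <= \esum_(j in D) ((N ^ (deg j - M))%:R * u j)%:E)%E ->
  (\esum_(j in D) ((N ^ deg j)%:R * u j)%:E < +oo)%E ->
  A = \esum_(j in D) (u j)%:E.
Proof.
move=> lo hi fin; apply/eqP; rewrite eq_le; apply/andP; split; last first.
  apply: esum_le_seq => s us sD.
  apply: le_trans (lo (\max_(j <- s) deg j)).
  rewrite (_ : \sum_(j <- s) u j = \sum_(j <- s) (deg j <= \max_(j <- s) deg j)%N%:R * u j).
    exact: seq_le_esum.
  by rewrite big_seq [RHS]big_seq; apply: eq_bigr => j js; rewrite leq_bigmax_seq// mul1r.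
have : (0 <= \esum_(j in D) (u j)%:E)%E by apply: esum_ge0 => j _; rewrite lee_fin.
case W : (\esum_(j in D) (u j)%:E)%E => [w| |] // _; last exact: leey.
have : (0 <= \esum_(j in D) ((N ^ deg j)%:R * u j)%:E)%E.
  by apply: esum_ge0 => j _; rewrite lee_fin mulr_ge0.
case E : (\esum_(j in D) ((N ^ deg j)%:R * u j)%:E)%E fin => [r| |] // _; rewrite lee_fin => r0.
have Np (a : nat) : 0 < (N ^ a)%:R :> R by rewrite ltr0n expn_gt0 (ltnW N2).
have key M : (A <= (w + (N ^ M)%:R^-1 * r)%:E)%E.
  apply: le_trans (hi M) _; rewrite EFinD EFinM -W -E.
  rewrite -esumZl_real ?invr_ge0//; last by move=> j; rewrite mulr_ge0.
  rewrite -esumD; [|by move=> j _; rewrite lee_fin|by move=> j _; rewrite lee_fin !mulr_ge0 ?invr_ge0].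
  apply: le_esum => j _; rewrite -EFinD lee_fin mulrA -[X in _ <= X + _]mul1r -mulrDl.
  apply: ler_wpM2r => //; have [jM|Mj] := leqP (deg j) M.
    by rewrite (eqP jM) expn0 lerDl mulr_ge0// invr_ge0.
  rewrite ler_wpDl// mulrC ler_pdivlMr// -natrM ler_nat -expnD subnK//.
  exact: ltnW.
case: A lo hi key => [a| |] lo hi key; last by rewrite leNye.
  rewrite lee_fin; apply: (@ler_addgt0_scaled _ _ _ r) => // t t0.
  have := key (Num.bound t^-1); rewrite lee_fin => /le_trans; apply.
  rewrite lerD2l ler_wpM2r// -[leRHS]invrK lef_pV2 ?posrE ?invr_gt0//.
  apply/ltW/(lt_trans (archi_boundP _)); first by rewrite invr_ge0 ltW.
  by rewrite ltr_nat ltn_expl.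
by have := key 0%N; rewrite leNgt ltry.
Qed.

End squeeze.

(** * Almost everywhere summability of the weighted dilates *)

Section dilates_summable.
Context {R : realType} {n : nat}.
Local Notation mu := (@lebesgue_measure R).
Variables (N : nat) (N2 : (2 <= N)%N) (s : {perm 'I_n}) (i : 'I_n).

(** Indexing by pairs lets the terms of [Phi], with exponent 0, and those of [Psi], with positive
    exponents, share one formula. *)
Definition dilate_sq (j : ('I_n -> L2 R) * nat) (x : R) : R :=
  nsq (fourier (j.1 (iter j.2 s i)) (N%:R ^+ j.2 * x)).

(** A fundamental domain for multiplication by [N] on the nonzero reals, half-open so that its
    dilates are disjoint. *)
Definition annulus (a : R) : set R := (`]- (N%:R * a), - a] `|` `[a, N%:R * a[)%classic.

Let Np : 0 < N%:R :> R. Proof. by rewrite ltr0n ltnW. Qed.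

Lemma annulusP a x : 0 < a -> annulus a x <-> a <= `|x| < N%:R * a.
Proof.
move=> a0; rewrite /annulus /= !in_itv/=; split.
  move=> [] /andP[h1 h2].
    by rewrite ltr0_norm; [apply/andP; split; lra|lra].
  by rewrite gtr0_norm ?h1//; lra.
have [x0|x0] := leP 0 x; first by rewrite ger0_norm// => h; right.
by rewrite ltr0_norm// => /andP[h1 h2]; left; apply/andP; split; lra.
Qed.

Lemma measurable_annulus a : measurable (annulus a).
Proof. by apply: measurableU; exact: measurable_itv. Qed.

Lemma annulus_disjoint (a x : R) (m l : nat) : 0 < a ->
  annulus a (N%:R^-1 ^+ m * x) -> annulus a (N%:R^-1 ^+ l * x) -> m = l.
Proof.
move=> a0 /(annulusP _ a0) + /(annulusP _ a0).
have e (k : nat) : `|N%:R^-1 ^+ k * x| = `|x| / N%:R ^+ k.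
  by rewrite normrM ger0_norm ?exprn_ge0 ?invr_ge0 ?ltW// exprVn mulrC.
rewrite !e => /andP[m1 m2] /andP[l1 l2].
have P (k : nat) : 0 < N%:R ^+ k :> R by rewrite exprn_gt0.
wlog ml : m l m1 m2 l1 l2 / (m < l)%N.
  by move=> H; case: (ltngtP m l) => // ml; [exact: H|apply/esym; exact: H].
rewrite ler_pdivlMr// in l1; rewrite ltr_pdivrMr// in m2.
have : N%:R * a * N%:R ^+ m <= a * N%:R ^+ l.
  rewrite [N%:R * a]mulrC -mulrA -exprS; apply: ler_wpM2l; first exact: ltW.
  by rewrite ler_weXn2l// ler1n ltnW.
by move=> h; have := lt_le_trans m2 (le_trans h l1); rewrite ltxx.
Qed.

Lemma measurable_dilate_sq j : measurable_fun setT (dilate_sq j).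
Proof.
apply: (measurableT_comp (measurable_nsq (L2_cmeas (fourier (j.1 (iter j.2 s i)))))).
exact: measurable_mulr.
Qed.

(** The component [sigma^m(i)] changes with [m]; summing over all components gives a majorant
    independent of [m]. *)
Let G (psi : 'I_n -> L2 R) (x : R) : R := \sum_(l < n) nsq (fourier (psi l) x).

Let G_ge0 psi x : 0 <= G psi x.
Proof. by rewrite sumr_ge0// => l _; exact: nsq_ge0. Qed.

Let mG psi : measurable_fun setT (G psi).
Proof. by apply: measurable_sum => l; exact: measurable_nsq (L2_cmeas _). Qed.

Let integral_G_lty psi : (\int[mu]_x (G psi x)%:E < +oo)%E.
Proof.
under eq_integral do rewrite /G -sumEFin.
rewrite ge0_integral_sum//.
- apply: lte_sum_pinfty => l _; exact: sqI_lty (L2_sqint _).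
- by move=> l; exact: measurable_nsqE (L2_cmeas _).
- by move=> l x _; rewrite lee_fin nsq_ge0.
Qed.

(* The annuli [N^m a <= |y| < N^(m+1) a] are disjoint, so after substituting
   [y = N^m x] the weights [N ^ m] cancel and the total is at most the sum of the
   squared norms of the Fourier transforms. *)
Lemma integral_dilates_annulus (Psi : set ('I_n -> L2 R)) (a : R) : 0 < a -> finite_set Psi ->
  (\esum_(j in [set j | Psi j.1 /\ (1 <= j.2)%N])
    ((N ^ j.2)%:R%:E * \int[mu]_x (\1_(annulus a) x * dilate_sq j x)%:E) < +oo)%E.
Proof.
move=> a0 fPsi; have mA := measurable_annulus a.
pose g (psi : 'I_n -> L2 R) (m : nat) (y : R) : \bar R :=
  (\1_(annulus a) (N%:R^-1 ^+ m * y) * G psi y)%:E.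
have mI m : measurable_fun setT (fun y : R => \1_(annulus a) (N%:R^-1 ^+ m * y) : R).
  exact: (measurableT_comp (measurable_indic mA) (measurable_mulr _)).
have mg psi m : measurable_fun setT (g psi m).
  by apply/measurable_EFinP; exact: measurable_funM.
have g0 psi m y : (0 <= g psi m y)%E by rewrite lee_fin mulr_ge0.
have step j : ((N ^ j.2)%:R%:E * \int[mu]_x (\1_(annulus a) x * dilate_sq j x)%:E <=
    \int[mu]_y g j.1 j.2 y)%E.
  case: j => psi m /=; have Nm : 0 < N%:R ^+ m :> R by rewrite exprn_gt0.
  pose k (y : R) : \bar R :=
    (\1_(annulus a) (N%:R^-1 ^+ m * y) * nsq (fourier (psi (iter m s i)) y))%:E.
  have mk : measurable_fun setT k.
    apply/measurable_EFinP; apply: measurable_funM => //.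
    exact: measurable_nsq (L2_cmeas _).
  have k0 y : (0 <= k y)%E by rewrite lee_fin mulr_ge0 ?nsq_ge0.
  have := ge0_integral_affine 0 Nm mk k0 => /(congr1 (fun x => (N%:R ^+ m)%:E * x)%E).
  rewrite muleA -EFinM mulfV ?gt_eqF// mul1e => e.
  apply: (@le_trans _ _ (\int[mu]_y k y)%E).
    rewrite -e natrX le_eqVlt; apply/orP; left; apply/eqP; congr (_ * _)%E.
    apply: eq_integral => x _; rewrite /k addr0 exprVn mulKf ?gt_eqF//.
  apply: ge0_le_integral => //.
    exact: mg.
  move=> y _; rewrite lee_fin ler_wpM2l// /G (bigD1 (iter m s i))//= lerDl.
  by rewrite sumr_ge0// => l _; exact: nsq_ge0.
apply: (@le_lt_trans _ _ (\esum_(j in Psi `*`` (fun=> [set m | (1 <= m)%N]))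
    \int[mu]_y g j.1 j.2 y)%E).
  by apply: le_esum => j _; exact: step.
rewrite -(esum_esum (a := fun psi m => \int[mu]_y g psi m y)%E); last first.
  by move=> psi m _ _; exact: integral_ge0.
have inner psi : (\esum_(m in [set m | (1 <= m)%N]) \int[mu]_y g psi m y < +oo)%E.
  have [ms <-] := @integral_esum R _ _ mu _ [set m | (1 <= m)%N] (g psi) (countableP _) (mg psi) (g0 psi).
  apply: le_lt_trans (integral_G_lty psi); apply: ge0_le_integral => //.
  - by move=> y _; apply: esum_ge0 => m _; exact: g0.
  - by apply/measurable_EFinP; exact: mG.
  - move=> y _; rewrite /g; under eq_esum do rewrite mulrC.
    rewrite esumZl_real//; apply: (@le_trans _ _ ((G psi y)%:E * 1%:E)%E); last by rewrite mule1.
    apply: lee_wpmul2l; first by rewrite lee_fin.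
    apply: esum_le_seq => t ut _; rewrite lee_fin.
    (* At most one scale in the list puts [y] into the annulus, so the sum of indicators is 0 or
       1. *)
    have [/hasP[m mt /= Am]|/hasPn h] := boolP (has (fun m => N%:R^-1 ^+ m * y \in annulus a) t).
      rewrite (bigD1_seq m)//= big1 ?addr0; first by rewrite indicE Am.
      move=> l lm; rewrite indicE; case: (boolP (_ \in _)) => // Al.
      rewrite !inE in Al Am; move: lm; by rewrite (annulus_disjoint a0 Al Am) eqxx.
    rewrite big_seq big1// => m mt; rewrite indicE.
    by rewrite (negbTE (h m mt)).
rewrite esum_fset//; last by move=> psi _; apply: esum_ge0 => m _; exact: integral_ge0.
rewrite fsbig_finite//=; apply: lte_sum_pinfty => psi _; exact: inner.
Qed.

End dilates_summable.

(** * Two frames of [V_0] and countability of the scaling functions *)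

Section scaling_space.
Context {R : realType} {n : nat}.
Variables (N : nat) (s : {perm 'I_n}) (z : 'I_n -> R[i]).
Variables (Psi Phi : set ('I_n -> L2 R)).
Hypotheses (hPsi : semi_orthogonal_wavelet N s z Psi).
Hypotheses (hPhi : scaling_functions N s z Psi Phi).

Local Notation V0 := (wavelet_V N s z Psi 0).
Local Notation affine := (fun p : int * int * ('I_n -> L2 R) => Upow N s p.1.1 (Tpow z p.1.2 p.2)).

Definition positive_scales : set (int * int * ('I_n -> L2 R)) :=
  [set p | Psi p.2 /\ (0 < p.1.1)%R].

Lemma wavelet_V0_subspace : subspace V0.
Proof.
by rewrite /wavelet_V cspanE; exact: (closed_span_subspace (@vinnerDl R n)
  (@vinnerZl R n) (@vinnerC R n) (@vinner_ge0 R n)).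
Qed.

Lemma wavelet_V0_orth (g : 'I_n -> L2 R) :
  (forall p, positive_scales p -> vinner (affine p) g = 0) ->
  forall f, V0 f -> vinner f g = 0.
Proof.
rewrite /wavelet_V cspanE => h; apply: (closed_span_orth (@vinnerDl R n)
  (@vinnerZl R n) (@vinnerC R n) (@vinner_ge0 R n)).
move=> v [m [k [psi [m0 Ppsi ->]]]]; apply: (h (m, k, psi)).
by split => //; move: m0; rewrite oppr0.
Qed.

(** For [f] in [V_0] the terms with [m <= 0] vanish: [U^m T^k psi] lies in [W_(-m)], which is
    orthogonal to the generators of [V_0], as these lie in [W_(-m')] with [m' > 0]. So the frame
    identity of the whole space restricts to the positive scales. *)
Lemma wavelet_ntf : ntf vinner positive_scales affine V0.
Proof.
have [_ [_ e] orthW] := hPsi; split => [[[m k] psi] [/= Ppsi m0]|f Vf].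
  rewrite /wavelet_V cspanE; apply: (closed_span_sub (@vinnerZl R n)).
  by exists m, k, psi; rewrite oppr0.
have inW m k psi : Psi psi -> wavelet_W N s z Psi (- m) (Upow N s m (Tpow z k psi)).
  move=> Ppsi; rewrite /wavelet_W cspanE; apply: (closed_span_sub (@vinnerZl R n)).
  by exists k, psi; rewrite opprK.
rewrite -vnorm_sq -(e f I).
rewrite (_ : positive_scales =
  [set p | Psi p.2] `&` [set p : int * int * ('I_n -> L2 R) | (0 < p.1.1)%R])//.
rewrite esum_mkcondr; apply: eq_esum => -[[m k] psi] /= Ppsi; rewrite normc_sq.
case: ifPn => //; rewrite notin_setE /= => /negP m0.
rewrite wavelet_V0_orth ?nsq0// => -[[m' k'] psi'] [/= Ppsi' m'0].
apply: (orthW (- m') (- m)); [|exact: inW|exact: inW].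
by move/oppr_inj => mm; rewrite -mm m'0 in m0.
Qed.

Lemma scaling_ntf :
  ntf vinner [set p : int * ('I_n -> L2 R) | Phi p.2] (fun p => Tpow z p.1 p.2) V0.
Proof.
have [_ [eV e]] := hPhi; split => // f Vf; rewrite -vnorm_sq -(e f Vf).
by apply: eq_esum => p _; rewrite normc_sq.
Qed.

Lemma scaling_functions_countable : countable Phi.
Proof.
have [eV e] := scaling_ntf; have [wV _] := wavelet_ntf; have [finPsi _ _] := hPsi.
pose K p := [set q : int * ('I_n -> L2 R) |
  Phi q.2 /\ nsq (vinner (affine p) (Tpow z q.1 q.2)) != 0].
have cK p : positive_scales p -> countable (K p).
  move=> Dp; apply: (countable_esum_support
    (D := [set q : int * ('I_n -> L2 R) | Phi q.2])).
    by move=> q; exact: nsq_ge0.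
  by rewrite e ?ltry//; exact: wV.
have cD : countable positive_scales.
  apply: (@sub_countable _ _ _ ([set: int * int] `*` Psi)).
    by apply: subset_card_le => p [].
  by apply: countableX; [exact: countableP|exact: finite_set_countable].
apply: (@sub_countable _ _ _ ([set 0] `|` \bigcup_(p in positive_scales) (snd @` K p))).
  apply: subset_card_le => phi Pphi.
  have [h|/existsNP[p /not_implyP[Dp h]]] :=
      pselect (forall p, positive_scales p -> vinner (affine p) phi = 0).
    (* Such a [phi] lies in [V_0] and is orthogonal to all of [V_0], hence to itself. *)
    left; apply: nsqv_vinner_eq0; rewrite /nsqv (wavelet_V0_orth h)//.
    exact: hPhi.1.
  right; exists p => //; exists (Posz 0, phi) => //; split => //=.
  apply/eqP => h0; apply: h; move: h0; rewrite -normc_sq => /eqP.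
  by rewrite sqrf_eq0 => /eqP /eq0_normc.
rewrite -bigcup2E; apply: bigcup_countable => // -[|[|k]] _ /=; [exact: countable1| |exact: countable0].
by apply: bigcup_countable => // p Dp; apply: card_le_trans (card_image_le _ _) (cK p Dp).
Qed.

End scaling_space.

(** * Testing the two frames and passing to the pointwise identity *)

Section testing.
Context {R : realType} {n : nat}.
Local Notation mu := (@lebesgue_measure R).
Variables (N : nat) (N2 : (2 <= N)%N) (s : {perm 'I_n}) (z : 'I_n -> R[i]).
Variables (Psi Phi : set ('I_n -> L2 R)).
Hypotheses (z1 : forall i, nsq (z i) = 1).
Hypotheses (hPsi : semi_orthogonal_wavelet N s z Psi).
Hypotheses (hPhi : scaling_functions N s z Psi Phi).

Definition undilated : set (('I_n -> L2 R) * nat) := [set j | Phi j.1 /\ j.2 = 0%N].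
Definition dilated : set (('I_n -> L2 R) * nat) := [set j | Psi j.1 /\ (1 <= j.2)%N].

Definition shift_energy (t : 'I_n -> L2 R) (j : ('I_n -> L2 R) * nat) : \bar R :=
  (\esum_(k in [set: int]) (nsq (vinner t (iter j.2 (Un N s) (Tpow z k j.1))))%:E)%E.

Lemma shift_energy_ge0 t j : (0 <= shift_energy t j)%E.
Proof. by apply: esum_ge0 => k _; rewrite lee_fin nsq_ge0. Qed.

Let Vs := wavelet_V0_subspace N s z Psi.

Lemma energy_undilated t : \esum_(j in undilated) shift_energy t j =
  (\esum_(p in [set p : int * ('I_n -> L2 R) | Phi p.2])
     (nsq (vinner t (Tpow z p.1 p.2)))%:E)%E.
Proof.
rewrite /shift_energy esum_esum; last by move=> *; rewrite lee_fin nsq_ge0.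
rewrite (reindex_esum (undilated `*`` (fun=> [set: int]))
  [set p : int * ('I_n -> L2 R) | Phi p.2] (fun q => (q.2, q.1.1))).
  by apply: eq_esum => -[[phi m] k] /= [[_ /= ->] _].
split.
- by move=> [[phi m] k] /= [[]].
- move=> [[phi m] k] [[phi' m'] k']; rewrite !inE /= => -[[_ /= ->] _] [[_ /= ->] _].
  by move=> [-> ->].
- by move=> [k phi] /= Pphi; exists ((phi, 0%N), k).
Qed.

Lemma energy_dilated t : \esum_(j in dilated) shift_energy t j =
  (\esum_(p in positive_scales Psi)
     (nsq (vinner t (Upow N s p.1.1 (Tpow z p.1.2 p.2))))%:E)%E.
Proof.
rewrite /shift_energy esum_esum; last by move=> *; rewrite lee_fin nsq_ge0.
rewrite (reindex_esum (dilated `*`` (fun=> [set: int])) (positive_scales Psi)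
  (fun q => (Posz q.1.2, q.2, q.1.1))).
  by apply: eq_esum => -[[psi m] k].
split.
- by move=> [[psi m] k] /= [[/= Ppsi m0] _].
- by move=> [[psi m] k] [[psi' m'] k'] _ _ /= [-> -> ->].
- move=> [[[m|m] k] psi] [/= Ppsi m0] //.
  by exists ((psi, m), k).
Qed.

Lemma energy_eq t :
  \esum_(j in undilated) shift_energy t j = \esum_(j in dilated) shift_energy t j.
Proof.
rewrite energy_undilated energy_dilated.
exact: (ntf_eq (@vinnerDl R n) (@vinnerZl R n) (@vinnerC R n) (@vinner_ge0 R n) t
  Vs (scaling_ntf hPhi) (wavelet_ntf hPsi)).
Qed.

Lemma energy_lty t : (\esum_(j in undilated) shift_energy t j < +oo)%E.
Proof.
rewrite energy_undilated; apply: le_lt_trans (ltry (nsqv vinner t)).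
exact: (ntf_bessel (@vinnerDl R n) (@vinnerZl R n) (@vinnerC R n) (@vinner_ge0 R n) t
  Vs (scaling_ntf hPhi)).
Qed.

Lemma countable_undilated : countable undilated.
Proof.
apply: (@sub_countable _ _ _ (Phi `*` [set: nat])); first by apply: subset_card_le => p [].
by apply: countableX; [exact: scaling_functions_countable hPsi hPhi|exact: countableP].
Qed.

Lemma countable_dilated : countable dilated.
Proof.
apply: (@sub_countable _ _ _ (Psi `*` [set: nat])); first by apply: subset_card_le => p [].
have [finPsi _ _] := hPsi.
by apply: countableX; [exact: finite_set_countable|exact: countableP].
Qed.

Variable i : 'I_n.
Local Notation v := (dilate_sq N s i).
Local Notation A := (wsum undilated v (fun=> 2 * pi)).
Local Notation lo M := (wsum dilated v (fun j => 2 * pi * (j.2 <= M)%N%:R)).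
Local Notation hi M := (wsum dilated v (fun j => 2 * pi * (N ^ (j.2 - M))%:R)).

Let v0 j (x : R) : 0 <= v j x. Proof. exact: nsq_ge0. Qed.
Let pi2 : 0 <= 2 * pi :> R. Proof. by rewrite mulr_ge0// pi_ge0. Qed.
Let lo0 M (j : ('I_n -> L2 R) * nat) : 0 <= 2 * pi * (j.2 <= M)%N%:R :> R.
Proof. by rewrite mulr_ge0. Qed.
Let hi0 M (j : ('I_n -> L2 R) * nat) : 0 <= 2 * pi * (N ^ (j.2 - M))%:R :> R.
Proof. by rewrite mulr_ge0. Qed.

Section band.
Variables (M : nat) (c : R) (E : set R).
Hypotheses (mE : measurable E) (bE : E `<=` [set x | c < x <= c + 2 * pi / N%:R ^+ M]).
Let t : 'I_n -> L2 R := test_at i (fun x : R => (\1_E x)%:C).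

Let shift_energyP (j : ('I_n -> L2 R) * nat) := shift_sum_test j.2 s j.1 i (ltnW N2) z1 mE bE.

(** The scaling functions sit at level 0, which never exceeds [M], so Parseval is exact for every
    band width. *)
Lemma integral_undilated : (\int[mu]_x ((\1_E x)%:E * A x) =
  \esum_(j in undilated) shift_energy t j)%E.
Proof.
rewrite (integral_wsum countable_undilated (measurable_dilate_sq N s i) v0)//.
apply: eq_esum => -[phi m] [/= _ m0].
by have [/= e _] := shift_energyP (phi, m); rewrite /shift_energy e//= m0.
Qed.

(** Levels up to [M] are computed exactly; the higher ones get weight 0 and are bounded below by
    positivity. *)
Lemma integral_lo : (\int[mu]_x ((\1_E x)%:E * lo M x) <=
  \int[mu]_x ((\1_E x)%:E * A x))%E.
Proof.
rewrite integral_undilated energy_eq.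
rewrite (integral_wsum countable_dilated (measurable_dilate_sq N s i) v0)//.
apply: le_esum => -[psi m] _ /=; have [mM|_] := leqP m M; last first.
  by rewrite mulr0 mul0e shift_energy_ge0.
by have [/= e _] := shift_energyP (psi, m); rewrite mulr1 /shift_energy e.
Qed.

Lemma integral_hi : (\int[mu]_x ((\1_E x)%:E * A x) <=
  \int[mu]_x ((\1_E x)%:E * hi M x))%E.
Proof.
rewrite integral_undilated energy_eq.
rewrite (integral_wsum countable_dilated (measurable_dilate_sq N s i) v0)//.
by apply: le_esum => -[psi m] _; have [_ e] := shift_energyP (psi, m).
Qed.

End band.

Lemma ae_sandwich (M : nat) : {ae mu, forall x, (lo M x <= A x <= hi M x)%E}.
Proof.
have Np : 0 < N%:R ^+ M :> R by rewrite exprn_gt0// ltr0n ltnW.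
have w0 : 0 < 2 * pi / N%:R ^+ M :> R by rewrite divr_gt0// mulr_gt0// pi_gt0.
set w := _ / _ in w0.
(* Countably many bands of the admissible width cover the line. On each, the finite energy of its
   test vector gives the integrability needed to compare integrands. *)
pose band (p : int) : set R := [set x | w * p%:~R < x <= w * p%:~R + w].
have mb p : measurable (band p).
  rewrite (_ : band p = `]w * p%:~R, w * p%:~R + w]%classic); first exact: measurable_itv.
  by apply/seteqP; split => x; rewrite /= in_itv.
have mlo : measurable_fun setT (lo M).
  exact: (measurable_wsum countable_dilated (measurable_dilate_sq N s i) v0).
have mhi : measurable_fun setT (hi M).
  exact: (measurable_wsum countable_dilated (measurable_dilate_sq N s i) v0).
have mA : measurable_fun setT A.
  exact: (measurable_wsum countable_undilated (measurable_dilate_sq N s i) v0).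
have fin p : (\int[mu]_x ((\1_(band p) x)%:E * A x) < +oo)%E.
  by rewrite (@integral_undilated M (w * p%:~R))//; exact: energy_lty.
have h1 p : {ae mu, forall x, band p x -> (lo M x <= A x)%E}.
  apply: ae_le_of_integral => //.
  - by move=> x; exact: wsum_ge0.
  - by move=> x; exact: wsum_ge0.
  - by apply: le_lt_trans (fin p); exact: (integral_lo (c := w * p%:~R)).
  - by move=> E mE Eb; exact: integral_lo Eb.
have h2 p : {ae mu, forall x, band p x -> (A x <= hi M x)%E}.
  apply: ae_le_of_integral => //.
  - by move=> x; exact: wsum_ge0.
  - by move=> x; exact: wsum_ge0.
  - by move=> E mE Eb; exact: integral_hi Eb.
move: (ae_forall_countType h1) (ae_forall_countType h2).
apply: (filterS2 (F := almost_everywhere mu)) => x k1 k2.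
(* The bands are open on the left, hence the ceiling and the shift by 1. *)
have b : band (Num.Def.ceil (x / w) - 1) x.
  have := ceil_itv (x / w); rewrite /band /= => /andP[a1 a2].
  rewrite ltr_pdivlMr// mulrC in a1; rewrite ler_pdivrMr// mulrC in a2.
  by rewrite a1 intrD mulrDr mulrN1z mulrN1 subrK.
by rewrite (k1 _ b) (k2 _ b).
Qed.

(** The weighted series has finite integral over every annulus with positive rational inner radius.
    These countably many annuli cover all nonzero [x]: take a rational between [|x| / N] and
    [|x|]. *)
Lemma ae_weighted_dilates_lty : {ae mu, forall x,
  (wsum dilated v (fun j => (N ^ j.2)%:R) x < +oo)%E}.
Proof.
have Np : 0 < N%:R :> R by rewrite ltr0n ltnW.
set W := wsum _ _ _.
have W0 x : (0 <= W x)%E by exact: wsum_ge0.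
have mW : measurable_fun setT W.
  exact: (measurable_wsum countable_dilated (measurable_dilate_sq N s i) v0).
have h (q : rat) : {ae mu, forall x, 0 < ratr q :> R ->
    annulus N (ratr q) x -> (W x < +oo)%E}.
  have [q0|q0] := boolP (0 < ratr q :> R); last by apply: aeW.
  have mB := measurable_annulus N (ratr q : R).
  have m1W : measurable_fun setT (fun x => (\1_(annulus N (ratr q)) x)%:E * W x)%E.
    apply: emeasurable_funM => //; apply/measurable_EFinP; exact: measurable_indic.
  have int1 : mu.-integrable setT (fun x => (\1_(annulus N (ratr q)) x)%:E * W x)%E.
    apply/integrableP; split => //.
    under eq_integral do rewrite gee0_abs ?mule_ge0 ?lee_fin//.
    rewrite (integral_wsum countable_dilated (measurable_dilate_sq N s i) v0)//.
    by have [finPsi _ _] := hPsi; exact: integral_dilates_annulus.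
  move: (integrable_ae measurableT int1).
  apply: (filterS (F := almost_everywhere mu)) => x /= e _ ax.
  have := e Logic.I; rewrite indicE mem_set// mul1e fin_numElt => /andP[_].
  by [].
have nz : {ae mu, forall x : R, x != 0}.
  exists [set 0]; split => //; first exact: lebesgue_measure_set1.
  by move=> x /= /negP; rewrite negbK => /eqP.
move: (ae_forall_countType h) nz.
apply: (filterS2 (F := almost_everywhere mu)) => x k x0.
have xp : 0 < `|x| by rewrite normr_gt0.
have /rat_in_itvoo[q] : `|x| / N%:R < `|x|.
  by rewrite ltr_pdivrMr// ltr_pMr// ltr1n.
rewrite in_itv/= => /andP[q1 q2].
have q0 : 0 < ratr q :> R by apply: lt_trans q1; rewrite divr_gt0.
apply: (k q q0); apply/annulusP => //.
by rewrite (ltW q2)/= mulrC -ltr_pdivrMr.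
Qed.

Lemma ae_scaling_identity : {ae mu, forall x,
  (\esum_(phi in Phi) (nsq (fourier (phi i) x))%:E =
   \sum_(psi \in Psi) \sum_(1 <= m <oo)
     (nsq (fourier (psi (iter m s i)) (N%:R ^+ m * x)))%:E)%E}.
Proof.
have [finPsi _ _] := hPsi.
have pi2' : 0 < 2 * pi :> R by rewrite mulr_gt0// pi_gt0.
have : {ae mu, forall x : R, forall M : nat, (lo M x <= A x <= hi M x)%E}.
  by apply: ae_foralln => M; exact: ae_sandwich.
move: ae_weighted_dilates_lty.
apply: (filterS2 (F := almost_everywhere mu)) => x fin bounds.
have u0 (j : ('I_n -> L2 R) * nat) : 0 <= 2 * pi * v j x by rewrite mulr_ge0.
have : A x = (\esum_(j in dilated) (2 * pi * v j x)%:E)%E.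
  apply: (@esum_squeeze _ _ dilated snd (fun j => 2 * pi * v j x) N N2 u0).
  - move=> M; have /andP[+ _] := bounds M; apply: le_trans; rewrite le_eqVlt.
    by apply/orP; left; apply/eqP; apply: eq_esum => j _; rewrite mulrCA !mulrA.
  - move=> M; have /andP[_ +] := bounds M; move=> /le_trans; apply; rewrite le_eqVlt.
    by apply/orP; left; apply/eqP; apply: eq_esum => j _; rewrite mulrCA !mulrA.
  - under eq_esum do rewrite mulrCA.
    rewrite esumZl_real//; last by move=> j; rewrite mulr_ge0.
    by rewrite lte_mul_pinfty.
(* Parseval put the factor [2 pi] on both sides; it is cancelled here. *)
rewrite /wsum !esumZl_real// => /(congr1 (fun y => (2 * pi)^-1%:E * y)%E).
rewrite !muleA -!EFinM mulVf ?gt_eqF// !mul1e => e.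
transitivity (\esum_(j in undilated) (v j x)%:E)%E.
  rewrite (reindex_esum Phi undilated (fun phi => (phi, 0%N))).
    by apply: eq_esum => phi _; rewrite /dilate_sq/= expr0 mul1r.
  split.
  - by move=> phi.
  - by move=> phi phi' _ _ [].
  - by move=> [phi m] [/= Pphi ->]; exists phi.
rewrite e (_ : dilated = Psi `*`` (fun=> [set m | (1 <= m)%N]))//.
rewrite -(esum_esum (a := fun psi m => (v (psi, m) x)%:E)); last by move=> *; rewrite lee_fin.
rewrite esum_fset//; last by move=> psi _; apply: esum_ge0 => m _; rewrite lee_fin.
apply: eq_fsbigr => psi _; rewrite eseries_cond nneseries_esum// => m _.
by rewrite lee_fin nsq_ge0.
Qed.

End testing.

Theorem corollary6p6 (R : realType) (N n : nat) (hN : (2 <= N)%N)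
  (hn : (1 <= n)%N) (sigma : {perm 'I_n}) (theta : 'I_n -> R) (z : 'I_n -> R[i])
  (htheta : forall k, - pi <= theta k < pi)
  (hz : forall k, z k = expi (- theta k))
  (hzN : forall k, z k ^+ N = z (sigma k))
  (Psi Phi : set ('I_n -> L2 R))
  (hPsi : semi_orthogonal_wavelet N sigma z Psi)
  (hPhi : scaling_functions N sigma z Psi Phi) :
  forall i : 'I_n, {ae (@lebesgue_measure R), forall xi : R,
    (\esum_(phi in Phi) (normc (fourier (phi i) (xi - theta i)) ^+ 2)%:E =
     \sum_(psi \in Psi) \sum_(1 <= m <oo)
       (normc (fourier (psi (iter m sigma i)) (N%:R ^+ m * (xi - theta i))) ^+ 2)%:E)%E}.
Proof.
have z1 k : nsq (z k) = 1 by rewrite hz nsq_expi.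
(* Translation by [- theta i] preserves null sets. *)
move=> i; have := ae_affine (- theta i) ltr01 (ae_scaling_identity hN z1 hPsi hPhi i).
apply: (filterS (F := almost_everywhere _)) => xi; rewrite mul1r => e.
under eq_esum do rewrite normc_sq.
rewrite e; apply: eq_fsbigr => psi _; apply: eq_eseriesr => m _.
by rewrite normc_sq.
Qed.
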